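(* Let $\mathcal{K}$ be a semi-integral domain. For every free-connex conjunctive query $Q$ over a vocabulary $\sigma$, the problem $\mathrm{Eval}_{\mathcal{K}}(Q,\sigma)$ can be solved with linear-time preprocessing and constant delay. In particular, for every $\mathsf{fc}\text{-}\mathsf{MATLANG}$ query $\mathbf{Q}$ over a matrix schema $\mathcal{S}$, $\mathrm{Eval}_{\mathcal{K}}(\mathbf{Q},\mathcal{S})$ can also be solved with linear-time preprocessing and constant delay.
   Context: $\mathcal{K}=(K,\oplus,\odot,\mathbb{0},\mathbb{1})$ is a commutative semiring with $\mathbb{0}\neq\mathbb{1}$; it is a semi-integral domain if $a\odot b=\mathbb{0}$ implies $a=\mathbb{0}$ or $b=\mathbb{0}$. Relational side: $K$-relations are functions $(\mathbb{N}_{>0})^a\to K$ with finite support; a database maps relation symbols to $K$-relations and constant symbols to positive integers ($1^{db}=1$). A CQ is $H(\bar x)\leftarrow\exists\bar y.a_1\wedge\dots\wedge a_n$ with relational atoms and comparison atoms $x\le c$ under semiring semantics ($\wedge\mapsto\odot$, $\exists\mapsto\bigoplus$, $x\le c\mapsto\mathbb{1}$ iff $\nu(x)\le c^{db}$ else $\mathbb{0}$); output $H(\bar d)$ = value on $\bar x\mapsto\bar d$ if $\bar d$ respects repetitions, else $\mathbb{0}$. Acyclic: a tree on the atoms (comparison atoms as unary atoms) in which, for each variable, the atoms containing it form a connected subtree. Free-connex: acyclic and still acyclic after adding the head atom to the body. $\mathrm{Eval}_{\mathcal{K}}(Q,\sigma)$: given a $\mathcal{K}$-database $db$ over $\sigma$,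 enumerate without repetition the set $\{(\bar d,[\![Q]\!](db)(H)(\bar d))\mid [\![Q]\!](db)(H)(\bar d)\neq\mathbb{0}\}$. Complexity is measured in data complexity (query fixed) on a RAM with uniform cost, assuming semiring elements take $O(1)$ space and $\oplus,\odot$ take $O(1)$ time; the size of $db$ is the number of non-$\mathbb{0}$ tuples (plus constants). Linear-time preprocessing and constant delay: a preprocessing phase of time $O(|db|)$ after which the outputs are printed one by one with $O(1)$ time before the first, between consecutive outputs, and after the last. Matrix side: $\mathsf{fc}\text{-}\mathsf{MATLANG}$ expressions over a schema of size symbols and typed matrix symbols: $e::=\mathbf{A}\mid\mathbf{1}^\alpha\mid\mathbf{I}^\alpha\mid e^T\mid e_1\times e_2\mid e_1\odot e_2\mid e_1\cdot v_2\mid v_1\cdot e_2$ where $v_1,v_2$ have type $(\alpha,1)$ or $(1,\alpha)$ ($\cdot$ matrix product over $K$, $\times$ scalar multiplication by a $1\times1$ expression, $\odot$ entrywise product, $\mathbf{1}^\alpha$ all-ones vector, $\mathbf{I}^\alpha$ identity); a query is $\mathbf{H}:=e$. $\mathrm{Eval}_{\mathcal{K}}(\mathbf{Q},\mathcal{S})$: given a matrix instance $\mathcal{I}$ over $\mathcal{S}$ (dimensions for size symbols and $K$-matrices), represented sparsely as the lists of non-$\mathbb{0}$ entries, enumerate the non-$\mathbb{0}$ entries $(i,j,k)$ of the output matrix $\mathbf{H}$; size of $\mathcal{I}$ is its number of non-$\mathbb{0}$ entries (plus size symbols).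
   Formalization: The RAM is also allowed to compute the n-fold sum of the semiring unit in O(1) time; with only ⊕ and ⊙ at unit cost the claim fails, e.g. for H() ← ∃x. x ≤ c over the natural numbers, whose value c is unbounded while the database size is constant. *)

(* Defs.v *)
From mathcomp Require Import all_boot all_algebra finmap.
From mathcomp Require Import boolp classical_sets fsbigop.

Set Implicit Arguments.
Unset Strict Implicit.
Unset Printing Implicit Defensive.

Import GRing.Theory.
Local Open Scope ring_scope.

Definition semi_integral (K : comNzSemiRingType) : Prop :=
  forall a b : K, a * b = 0 -> a = 0 \/ b = 0.

(* ** K-databases over the domain of positive integers *)

Notation posnat := {n : nat | (0 < n)%N}.

Definition pos1 : posnat := exist _ 1%N isT.

(* Constant symbols are [option (cst S)]: [None] is the distinguished symbol 1,
   which every vocabulary contains and every database interprets by 1. *)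
Record vocab := Vocab {
  rsym : finType;
  ar : rsym -> nat;
  cst : finType }.

Record database (K : comNzSemiRingType) (S : vocab) := Database {
  db_rel : forall R : rsym S, {fsfun (ar R).-tuple posnat -> K with 0};
  db_cst : cst S -> posnat }.

Definition cst_val (K : comNzSemiRingType) (S : vocab) (db : database K S)
    (c : option (cst S)) : posnat :=
  if c is Some c' then db_cst db c' else pos1.

(* ** Conjunctive queries; variables are natural numbers *)

Inductive atom (S : vocab) :=
| RelAtom (R : rsym S) of (ar R).-tuple nat
| LeAtom of nat & option (cst S).

Definition atom_vars (S : vocab) (a : atom S) : seq nat :=
  match a with
  | RelAtom _ xs => xs
  | LeAtom x _ => [:: x]
  end.

Definition atoms_vars (S : vocab) (b : seq (atom S)) : seq nat :=
  flatten [seq atom_vars a | a <- b].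

Record cq (S : vocab) := CQ {
  head_ar : nat;
  hvars : head_ar.-tuple nat;
  body : seq (atom S);
  body_neq0 : (0 < size body)%N;
  head_safe : {subset hvars <= atoms_vars body} }.

(* The tuple y in H(x) <- exists y. a_1 /\ ... /\ a_n *)
Definition bound_vars (S : vocab) (Q : cq S) : seq nat :=
  undup [seq y <- atoms_vars (body Q) | y \notin val (hvars Q)].

Definition upd (nu : nat -> posnat) (y : nat) (d : posnat) : nat -> posnat :=
  fun x => if x == y then d else nu x.

Definition atom_sem (K : comNzSemiRingType) (S : vocab) (db : database K S)
    (nu : nat -> posnat) (a : atom S) : K :=
  match a with
  | RelAtom R xs => db_rel db R (map_tuple nu xs)
  | LeAtom x c => if (val (nu x) <= val (cst_val db c))%N then 1 else 0
  end.

(* [exists ys. f]: each quantifier is a finitely supported sum over all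
   positive integers. *)
Fixpoint ex_sem (K : comNzSemiRingType) (ys : seq nat)
    (f : (nat -> posnat) -> K) (nu : nat -> posnat) : K :=
  if ys is y :: ys' then
    \sum_(d \in [set: posnat]%classic) ex_sem ys' f (upd nu y d)
  else f nu.

Definition head_val (S : vocab) (Q : cq S) (d : (head_ar Q).-tuple posnat) :
    nat -> posnat :=
  fun x => nth pos1 d (index x (hvars Q)).

Definition respects (S : vocab) (Q : cq S) (d : (head_ar Q).-tuple posnat) :
    bool :=
  [forall i, forall j,
     (tnth (hvars Q) i == tnth (hvars Q) j) ==> (tnth d i == tnth d j)].

Definition cq_sem (K : comNzSemiRingType) (S : vocab) (Q : cq S)
    (db : database K S) (d : (head_ar Q).-tuple posnat) : K :=
  if respects d then
    ex_sem (bound_vars Q) (fun nu => \prod_(a <- body Q) atom_sem db nu a)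
      (head_val d)
  else 0.

(* ** Acyclicity *)

Definition is_tree (T : finType) (e : rel T) : Prop :=
  [/\ symmetric e, irreflexive e, forall x y, connect e x y
    & forall p : seq T, ucycle e p -> (size p <= 2)%N].

(* A join tree over the hyperedges [E_0, ..., E_(n-1)] (occurrences, so that
   repeated atoms are distinct nodes). *)
Definition join_tree (E : seq (seq nat)) (e : rel 'I_(size E)) : Prop :=
  is_tree e /\
  forall (x : nat) (i j : 'I_(size E)),
    x \in nth [::] E i -> x \in nth [::] E j ->
    connect [rel k l | [&& e k l, x \in nth [::] E k & x \in nth [::] E l]] i j.

Definition acyclic (E : seq (seq nat)) : Prop :=
  exists e : rel 'I_(size E), join_tree e.

Definition free_connex (S : vocab) (Q : cq S) : Prop :=
  let E := [seq atom_vars a | a <- body Q] in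
  acyclic E /\ acyclic (val (hvars Q) :: E).

(* ** Random access machine, uniform cost

   One memory of naturals and one memory of semiring elements, both addressed by
   naturals and initially zero; a read-only input tape and a write-only output
   tape of tokens that are either naturals or semiring elements. *)

Inductive addr := Dir of nat | Ind of nat.

Inductive operand := Imm of nat | At of addr.

Inductive instr :=
| Mov of addr & operand
| Add of addr & operand & operand
| Sub of addr & operand & operand
| Mul of addr & operand & operand
| Div of addr & operand & operand
| KNat of addr & operand
| KSet of addr & addr
| KAdd of addr & addr & addr
| KMul of addr & addr & addr
| Read of addr
| KRead of addr
| Write of operand
| KWrite of addr
| Jump of nat
| JumpLe of operand & operand & nat
| KJumpZero of addr & nat
| Halt.

Definition token (K : comNzSemiRingType) := (nat + K)%type.

Record config (K : comNzSemiRingType) := Config {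
  pc : nat;
  nmem : nat -> nat;
  kmem : nat -> K;
  inp : seq (token K);
  out : seq (token K) }.

Definition set_mem (T : Type) (m : nat -> T) (i : nat) (v : T) : nat -> T :=
  fun j => if j == i then v else m j.

Definition loc (m : nat -> nat) (a : addr) : nat :=
  match a with Dir i => i | Ind i => m i end.

Definition opval (m : nat -> nat) (x : operand) : nat :=
  match x with Imm n => n | At a => m (loc m a) end.

(* [None] when the machine has halted; reading past the end of the tape or a
   token of the wrong kind also halts.  [KNat] computes the n-fold sum 1 + ... + 1
   of the semiring unit.  For n = 0, 1 it supplies the semiring constants.  Larger
   n are needed because the value of the constant c (or the dimension n) does not
   count towards the size of the input, whereas exists x. x <= c has value c%:R:
   with only + and * at unit cost, no fixed number of steps reaches c%:R for all c
   (already over the semiring of natural numbers). *)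
Definition step (K : comNzSemiRingType) (p : seq instr) (s : config K) :
    option (config K) :=
  let: Config pc m k i o := s in
  let next m' k' i' o' := Some (Config pc.+1 m' k' i' o') in
  let put a v := next (set_mem m (loc m a) v) k i o in
  let kput a v := next m (set_mem k (loc m a) v) i o in
  let jump l := Some (Config l m k i o) in
  let v := opval m in
  let kv a := k (loc m a) in
  match nth Halt p pc with
  | Mov a x => put a (v x)
  | Add a x y => put a (v x + v y)%N
  | Sub a x y => put a (v x - v y)%N
  | Mul a x y => put a (v x * v y)%N
  | Div a x y => put a (v x %/ v y)%N
  | KNat a x => kput a (v x)%:R
  | KSet a b => kput a (kv b)
  | KAdd a b c => kput a (kv b + kv c)
  | KMul a b c => kput a (kv b * kv c)
  | Read a =>
      if i is inl n :: i' then next (set_mem m (loc m a) n) k i' o else None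
  | KRead a =>
      if i is inr x :: i' then next m (set_mem k (loc m a) x) i' o else None
  | Write x => next m k i (rcons o (inl (v x)))
  | KWrite a => next m k i (rcons o (inr (kv a)))
  | Jump l => jump l
  | JumpLe x y l => if (v x <= v y)%N then jump l else jump pc.+1
  | KJumpZero a l => if kv a == 0 then jump l else jump pc.+1
  | Halt => None
  end.

Definition init_config (K : comNzSemiRingType) (w : seq (token K)) : config K :=
  Config 0 (fun=> 0%N) (fun=> 0) w [::].

(* Configuration after [t] time units on input [w]. *)
Definition run (K : comNzSemiRingType) (p : seq instr) (w : seq (token K))
    (t : nat) : config K :=
  iter t (fun s => odflt s (step p s)) (init_config w).

(* ** Enumeration problems *)

Definition enc_entry (K : comNzSemiRingType) (x : seq nat * K) :
    seq (token K) :=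
  [seq inl n | n <- x.1] ++ [:: inr x.2].

(* An instance is presented to the machine by any of the words related to it by
   [encodes]; its answers are index tuples paired with a semiring element. *)
Record enum_problem (K : comNzSemiRingType) := EnumProblem {
  instance : Type;
  encodes : instance -> seq (token K) -> Prop;
  isize : instance -> nat;
  answer : instance -> seq nat * K -> Prop }.

(* At time [t 0] preprocessing is over and nothing is printed; at time [t j],
   [j <= size ans], exactly the first [j] answers are printed; at time
   [t (size ans).+1] the machine has halted, having printed nothing more. *)
Definition enumerates_within (K : comNzSemiRingType) (p : seq instr)
    (w : seq (token K)) (ans : seq (seq nat * K)) (pre delay : nat) : Prop :=
  exists t : nat -> nat,
    [/\ (t 0 <= pre)%N,
        forall j, (j <= size ans)%N -> (t j <= t j.+1 <= t j + delay)%N,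
        forall j, (j <= (size ans).+1)%N ->
          out (run p w (t j)) = flatten [seq enc_entry x | x <- take j ans]
      & step p (run p w (t (size ans).+1)) = None].

Definition linear_prep_const_delay (K : comNzSemiRingType)
    (P : enum_problem K) : Prop :=
  exists (p : seq instr) (c : nat),
    forall (I : instance P) (w : seq (token K)), encodes I w ->
      exists ans : seq (seq nat * K),
        [/\ uniq ans,
            forall x, x \in ans <-> answer I x
          & enumerates_within p w ans (c * isize I) c].

(* [w] is the number of entries in [l] followed by these entries in any order. *)
Definition listing (K : comNzSemiRingType) (l : seq (seq nat * K))
    (w : seq (token K)) : Prop :=
  exists2 l', perm_eq l' l
    & w = inl (size l') :: flatten [seq enc_entry x | x <- l'].

(* ** Evaluation of conjunctive queries *)

Definition rel_entries (K : comNzSemiRingType) (a : nat)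
    (f : {fsfun a.-tuple posnat -> K with 0}) : seq (seq nat * K) :=
  [seq ([seq val n | n <- val d], f d) | d <- enum_fset (finsupp f)].

Definition db_encodes (K : comNzSemiRingType) (S : vocab) (db : database K S)
    (w : seq (token K)) : Prop :=
  exists2 r : rsym S -> seq (token K),
    forall R, listing (rel_entries (db_rel db R)) (r R)
    & w = flatten [seq r R | R <- enum (rsym S)]
          ++ [seq inl (val (db_cst db c)) | c <- enum (cst S)].

Definition db_size (K : comNzSemiRingType) (S : vocab) (db : database K S) :
    nat :=
  (\sum_(R : rsym S) size (rel_entries (db_rel db R)) + #|{: option (cst S)}|)%N.

Definition cq_answer (K : comNzSemiRingType) (S : vocab) (Q : cq S)
    (db : database K S) (x : seq nat * K) : Prop :=
  exists2 d : (head_ar Q).-tuple posnat,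
    cq_sem db d != 0 & x = ([seq val n | n <- val d], cq_sem db d).

Definition eval_cq (K : comNzSemiRingType) (S : vocab) (Q : cq S) :
    enum_problem K :=
  EnumProblem (@db_encodes K S) (@db_size K S) (@cq_answer K S Q).

(* ** fc-MATLANG *)

(* Size symbols are [option (ssym S)]: [None] is the symbol 1, of dimension 1. *)
Record mschema := MSchema {
  ssym : finType;
  msym : finType;
  mtype : msym -> option ssym * option ssym }.

Definition size_sym (S : mschema) := option (ssym S).

Inductive fcmatlang (S : mschema) : size_sym S -> size_sym S -> Type :=
| EMat A : fcmatlang (mtype A).1 (mtype A).2
| EOnes a : fcmatlang a None
| EId a : fcmatlang a a
| ETr a b : fcmatlang a b -> fcmatlang b a
| EScale a b : fcmatlang None None -> fcmatlang a b -> fcmatlang a b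
| EHad a b : fcmatlang a b -> fcmatlang a b -> fcmatlang a b
| EMulR a b c (e1 : fcmatlang a b) (v2 : fcmatlang b c) :
    b = None \/ c = None -> fcmatlang a c
| EMulL a b c (v1 : fcmatlang a b) (e2 : fcmatlang b c) :
    a = None \/ b = None -> fcmatlang a c.

Definition dim_of (S : mschema) (d : ssym S -> posnat) (a : size_sym S) : nat :=
  if a is Some a' then val (d a') else 1%N.

Record minstance (K : comNzSemiRingType) (S : mschema) := MInstance {
  mdim : ssym S -> posnat;
  mval : forall A : msym S,
    'M[K]_(dim_of mdim (mtype A).1, dim_of mdim (mtype A).2) }.

Definition mdim_of (K : comNzSemiRingType) (S : mschema) (I : minstance K S) :=
  dim_of (mdim I).

Fixpoint mat_sem (K : comNzSemiRingType) (S : mschema) (I : minstance K S)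
    (a b : size_sym S) (e : fcmatlang a b) : 'M[K]_(mdim_of I a, mdim_of I b) :=
  match e in fcmatlang a b return 'M[K]_(mdim_of I a, mdim_of I b) with
  | EMat A => mval I A
  | EOnes a => const_mx 1
  | EId a => 1%:M
  | ETr a b e => (mat_sem I e)^T
  | EScale a b e1 e2 => (mat_sem I e1 : 'M_1) ord0 ord0 *: mat_sem I e2
  | EHad a b e1 e2 => map2_mx *%R (mat_sem I e1) (mat_sem I e2)
  | EMulR a b c e1 v2 _ => mat_sem I e1 *m mat_sem I v2
  | EMulL a b c v1 e2 _ => mat_sem I v1 *m mat_sem I e2
  end.

(* Rows and columns are numbered from 1. *)
Definition mx_entries (K : comNzSemiRingType) (m n : nat) (M : 'M[K]_(m, n)) :
    seq (seq nat * K) :=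
  [seq ([:: (p.1 : nat).+1; (p.2 : nat).+1], M p.1 p.2)
     | p : 'I_m * 'I_n <- enum {: 'I_m * 'I_n} & M p.1 p.2 != 0].

Definition inst_encodes (K : comNzSemiRingType) (S : mschema)
    (I : minstance K S) (w : seq (token K)) : Prop :=
  exists2 r : msym S -> seq (token K),
    forall A, listing (mx_entries (mval I A)) (r A)
    & w = flatten [seq r A | A <- enum (msym S)]
          ++ [seq inl (val (mdim I a)) | a <- enum (ssym S)].

Definition inst_size (K : comNzSemiRingType) (S : mschema)
    (I : minstance K S) : nat :=
  (\sum_(A : msym S) size (mx_entries (mval I A)) + #|{: size_sym S}|)%N.

Definition mat_answer (K : comNzSemiRingType) (S : mschema) (a b : size_sym S)
    (e : fcmatlang a b) (I : minstance K S) (x : seq nat * K) : Prop :=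
  x \in mx_entries (mat_sem I e).

Definition eval_matlang (K : comNzSemiRingType) (S : mschema)
    (a b : size_sym S) (e : fcmatlang a b) : enum_problem K :=
  EnumProblem (@inst_encodes K S) (@inst_size K S)
    (@mat_answer K S a b e).

(* Main.v *)
(* Along a join tree the sum over the quantified variables is computed from the
   leaves to the root: a node whose edge is connected to the rest by variables zs
   sends, for each value of zs, the sum of the weights of its matching tuples, and
   the receiving node multiplies its own weights by it.  A variable that occurs in
   comparisons only ranges over 1, ..., m and contributes m%:R.  What remains is a
   product of weighted projections; the tree containing the head shows that the
   head variables have again a join order.  One more leaf-to-root pass records
   which tuples extend to a nonzero product below them, so that nested loops from
   the root to the leaves never meet a dead end: as K has no zero divisors, a
   product of nonzero weights is an answer, and the delay is bounded by the number
   of loops.  Tuples of bounded length are coded injectively by numbers, so the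
   random access memory serves as lookup tables with constant access time.

   The value of an fc-MATLANG expression is always supported by one input matrix,
   or the product of a column and a row, or a diagonal matrix, where each vector is
   supported by a projection of one input matrix or constant on an initial
   interval; the constructors preserve this form, and the enumeration is that of a
   query with at most two loops. *)

Require Import Defs.
From mathcomp Require Import all_boot all_algebra.
From mathcomp Require Import finmap boolp classical_sets fsbigop zify.

Set Implicit Arguments.
Unset Strict Implicit.
Unset Printing Implicit Defensive.

Import GRing.Theory.

(** * A structured language compiled to the machine *)

(** [K] may have additive inverses or positive characteristic: a sum of nonzero weights, or a count
    [m%:R], can vanish although matching tuples exist. The enumeration therefore tests computed
    values of eliminated sums, never the mere existence of tuples, and closed factors such as [m%:R]
    enter one test made before the loops start. The method is a weighted form of the semijoin
    reduction of Yannakakis. The tree with the head guides the elimination of quantified variables,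
    while the loops over relations follow the tree of the body alone, restricted to head variables.
    Quantifiers range over an infinite domain. Nonzero products confine them to 1, ..., [N] for a
    bound [N] that only the correctness proof mentions, so all sums become finite iterated sums that
    can be permuted and factored. Machine code is never analysed directly: a structured language
    whose traces record one item per step is compiled once, and time bounds are bounds on traces.
    Every constant is chosen before the instance, since it may depend on the query only. *)

(* The memory is divided into arrays, called regions; a region used as a register
   stands for its cell 0. *)
Definition region : countType := (nat * nat * nat)%type.

Definition rnum (r : region) : nat := choice.pickle r.

Inductive operand1 := Lit of nat | Reg of region.

Inductive binop := BAdd | BSub | BMul.

Inductive op :=
| OMov of region & operand1
| OBin of binop & region & operand1 & operand1
| OLoad of region & region & region
| OStore of region & region & region
| OKNat of region & operand1
| OKAdd of region & region & region
| OKMul of region & region & region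
| OKLoad of region & region & region
| OKStore of region & region & region.

Inductive cmd :=
| Block of seq op
| CRead of region
| CKRead of region
| CWrite of region
| CKWrite of region
| CSeq of cmd & cmd
| CIfK of region & cmd
| CWhile of region & region & cmd
| CDo of cmd & region.

Definition binopf b : nat -> nat -> nat :=
  match b with BAdd => addn | BSub => subn | BMul => muln end.

Section Language.
Variable K : comNzSemiRingType.

Record state := State {
  nm : region -> nat -> nat;
  km : region -> nat -> K;
  ip : seq (token K) }.

Definition upd2 (T : Type) (f : region -> nat -> T) (r : region) (i : nat) (v : T) :=
  fun r' i' => if (r' == r) && (i' == i) then v else f r' i'.

Definition oval (f : region -> nat -> nat) (x : operand1) :=
  match x with Lit n => n | Reg r => f r 0 end.

Definition setn (s : state) r i v := State (upd2 (nm s) r i v) (km s) (ip s).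
Definition setk (s : state) r i v := State (nm s) (upd2 (km s) r i v) (ip s).

Definition apply_op (s : state) (o : op) : state :=
  match o with
  | OMov d x => setn s d 0 (oval (nm s) x)
  | OBin b d x y => setn s d 0 (binopf b (oval (nm s) x) (oval (nm s) y))
  | OLoad d a i => setn s d 0 (nm s a (nm s i 0))
  | OStore a i x => setn s a (nm s i 0) (nm s x 0)
  | OKNat d x => setk s d 0 ((oval (nm s) x)%:R)%R
  | OKAdd d x y => setk s d 0 (km s x 0 + km s y 0)%R
  | OKMul d x y => setk s d 0 (km s x 0 * km s y 0)%R
  | OKLoad d a i => setk s d 0 (km s a (nm s i 0))
  | OKStore a i x => setk s a (nm s i 0) (km s x 0)
  end.

Definition opsize (o : op) : nat :=
  match o with
  | OLoad _ _ _ | OStore _ _ _ | OKLoad _ _ _ | OKStore _ _ _ => 3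
  | _ => 1
  end.

(* One item per machine step: the token it prints, if any. *)
Definition trace := seq (option (token K)).
Definition silent n : trace := nseq n None.

Definition bsize (os : seq op) := sumn [seq opsize o | o <- os].

Inductive exec : cmd -> state -> trace -> state -> Prop :=
| XBlock os s : exec (Block os) s (silent (bsize os)) (foldl apply_op s os)
| XRead d s n w : ip s = inl n :: w ->
    exec (CRead d) s [:: None] (State (upd2 (nm s) d 0 n) (km s) w)
| XKRead d s x w : ip s = inr x :: w ->
    exec (CKRead d) s [:: None] (State (nm s) (upd2 (km s) d 0 x) w)
| XWrite d s : exec (CWrite d) s [:: Some (inl (nm s d 0))] s
| XKWrite d s : exec (CKWrite d) s [:: Some (inr (km s d 0))] s
| XSeq c1 c2 s1 s2 s3 t1 t2 : exec c1 s1 t1 s2 -> exec c2 s2 t2 s3 ->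
    exec (CSeq c1 c2) s1 (t1 ++ t2) s3
| XIfF r c s : km s r 0 = 0%R -> exec (CIfK r c) s [:: None] s
| XIfT r c s t s' : km s r 0 <> 0%R -> exec c s t s' ->
    exec (CIfK r c) s (None :: t) s'
| XWhileF x y c s : nm s y 0 <= nm s x 0 -> exec (CWhile x y c) s [:: None] s
| XWhileT x y c s1 t s2 t' s3 : nm s1 x 0 < nm s1 y 0 -> exec c s1 t s2 ->
    exec (CWhile x y c) s2 t' s3 ->
    exec (CWhile x y c) s1 (None :: t ++ None :: t') s3
| XDoF x c s1 t s2 : exec c s1 t s2 -> nm s2 x 0 = 0 ->
    exec (CDo c x) s1 (rcons t None) s2
| XDoT x c s1 t s2 t' s3 : exec c s1 t s2 -> 0 < nm s2 x 0 ->
    exec (CDo c x) s2 t' s3 -> exec (CDo c x) s1 (t ++ None :: t') s3.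

(** * Memory layout and simulation of commands by the machine *)

Section Compile.
(* Cell [i] of region [r] is stored at address [i * M + rnum r + 1]; address 0
   is scratch space for indirect addressing. *)
Variable M : nat.

Definition adr (r : region) (i : nat) := i * M + (rnum r).+1.
Definition fits (r : region) := (rnum r).+1 < M.

(** The stride [M] exceeds every offset, so an address determines its quotient and its remainder.
    Finitely many unbounded arrays thus share one memory, each cell being reached by one
    multiplication and one addition. *)
Lemma adr_inj r i r' i' : fits r -> fits r' ->
  (adr r i == adr r' i') = (r == r') && (i == i').
Proof.
move=> h h'; apply/eqP/andP => [|[/eqP-> /eqP->] //]; rewrite /adr => e.
have ei : i = i'.
  by move: h h'; rewrite /fits; case: (ltngtP i i') => // l h h'; nia.
split; last exact/eqP.
by apply/eqP/(pcan_inj (@choice.pickleK region)); move: e; rewrite ei => /addnI [].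
Qed.

Lemma adr_gt0 r i : 0 < adr r i. Proof. by rewrite /adr addnS. Qed.

Definition D r := Dir (rnum r).+1.
Definition opnd x := match x with Lit n => Imm n | Reg r => At (D r) end.

Definition index_code a i :=
  [:: Mul (Dir 0) (At (D i)) (Imm M);
      Add (Dir 0) (At (Dir 0)) (Imm (rnum a).+1)].

Definition compile_op (o : op) : seq instr :=
  match o with
  | OMov d x => [:: Mov (D d) (opnd x)]
  | OBin b d x y =>
      [:: (match b with BAdd => Add | BSub => Defs.Sub | BMul => Mul end)
            (D d) (opnd x) (opnd y)]
  | OLoad d a i => index_code a i ++ [:: Mov (D d) (At (Ind 0))]
  | OStore a i x => index_code a i ++ [:: Mov (Ind 0) (At (D x))]
  | OKNat d x => [:: KNat (D d) (opnd x)]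
  | OKAdd d x y => [:: KAdd (D d) (D x) (D y)]
  | OKMul d x y => [:: KMul (D d) (D x) (D y)]
  | OKLoad d a i => index_code a i ++ [:: KSet (D d) (Ind 0)]
  | OKStore a i x => index_code a i ++ [:: KSet (Ind 0) (D x)]
  end.

Fixpoint csize c : nat :=
  match c with
  | Block os => bsize os
  | CSeq c1 c2 => csize c1 + csize c2
  | CIfK _ c => (csize c).+1
  | CWhile _ _ c => (csize c).+2
  | CDo c _ => (csize c).+1
  | _ => 1
  end.

Fixpoint compile (o : nat) c : seq instr :=
  match c with
  | Block os => flatten [seq compile_op o | o <- os]
  | CRead d => [:: Read (D d)]
  | CKRead d => [:: KRead (D d)]
  | CWrite d => [:: Write (At (D d))]
  | CKWrite d => [:: KWrite (D d)]
  | CSeq c1 c2 => compile o c1 ++ compile (o + csize c1) c2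
  | CIfK r c => KJumpZero (D r) (o.+1 + csize c) :: compile o.+1 c
  | CWhile x y c =>
      JumpLe (At (D y)) (At (D x)) (o + (csize c).+2) :: compile o.+1 c ++ [:: Jump o]
  | CDo c x => compile o c ++ [:: JumpLe (Imm 1) (At (D x)) o]
  end.

Lemma size_compile_op o : size (compile_op o) = opsize o.
Proof. by case: o. Qed.

Lemma size_compile c o : size (compile o c) = csize c.
Proof.
elim: c o => //= [os|c1 h1 c2 h2|r c h|x y c h|c h x] o.
- by elim: os => //= a os ih; rewrite size_cat ih size_compile_op.
- by rewrite size_cat h1 h2.
- by rewrite h.
- by rewrite size_cat h addn1.
- by rewrite size_cat h addn1.
Qed.

Definition opnd_regs x := if x is Reg r then [:: r] else [::].

Definition op_regs (o : op) : seq region :=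
  match o with
  | OMov d x | OKNat d x => d :: opnd_regs x
  | OBin _ d x y => d :: opnd_regs x ++ opnd_regs y
  | OLoad d a i | OStore d a i | OKAdd d a i | OKMul d a i | OKLoad d a i
  | OKStore d a i => [:: d; a; i]
  end.

Fixpoint regs c : seq region :=
  match c with
  | Block os => flatten [seq op_regs o | o <- os]
  | CRead d | CKRead d | CWrite d | CKWrite d => [:: d]
  | CSeq c1 c2 => regs c1 ++ regs c2
  | CIfK r c | CDo c r => r :: regs c
  | CWhile x y c => x :: y :: regs c
  end.

Definition sim (s : state) (c : config K) :=
  [/\ forall r i, fits r -> nmem c (adr r i) = nm s r i,
      forall r i, fits r -> kmem c (adr r i) = km s r i & inp c = ip s].

Variable P : seq instr.

Fixpoint steps (c : config K) (tr : trace) (c' : config K) : Prop :=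
  if tr is e :: tr' then
    exists c1, [/\ step P c = Some c1,
      out c1 = out c ++ (if e is Some x then [:: x] else [::]) & steps c1 tr' c']
  else c = c'.

Lemma steps_cat c1 t1 c2 t2 c3 :
  steps c1 t1 c2 -> steps c2 t2 c3 -> steps c1 (t1 ++ t2) c3.
Proof.
elim: t1 c1 => [|e t1 ih] c1 /=; first by move=> ->.
by move=> [c [h1 h2 h3]] h; exists c; split=> //; apply: ih.
Qed.

Definition code_at o (is_ : seq instr) :=
  forall k, k < size is_ -> nth Halt P (o + k) = nth Halt is_ k.

Lemma code_at_cat o a b :
  code_at o (a ++ b) -> code_at o a /\ code_at (o + size a) b.
Proof.
move=> h; split=> k hk.
  by rewrite h ?nth_cat ?hk // size_cat ltn_addr.
rewrite -addnA h ?nth_cat ?size_cat ?ltn_add2l //.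
by rewrite ltnNge leq_addr /= addKn.
Qed.

Lemma code_at_cons o a b :
  code_at o (a :: b) -> nth Halt P o = a /\ code_at o.+1 b.
Proof.
move=> h; split; first by rewrite -[o]addn0 h.
by move=> k hk; rewrite addSnnS h.
Qed.

Lemma sim_setn s p m k i o r j v q o' : fits r -> sim s (Config p m k i o) ->
  sim (setn s r j v) (Config q (Defs.set_mem m (adr r j) v) k i o').
Proof.
move=> fr [h1 h2 h3]; split=> //= r' i' fr'.
by rewrite /Defs.set_mem adr_inj // /upd2; case: ifP => // _; exact: h1.
Qed.

Lemma sim_setk s p m k i o r j v q o' : fits r -> sim s (Config p m k i o) ->
  sim (setk s r j v) (Config q m (Defs.set_mem k (adr r j) v) i o').
Proof.
move=> fr [h1 h2 h3]; split=> //= r' i' fr'.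
by rewrite /Defs.set_mem adr_inj // /upd2; case: ifP => // _; exact: h2.
Qed.

Lemma sim_set0 s p m k i o v q o' : sim s (Config p m k i o) ->
  sim s (Config q (Defs.set_mem m 0 v) k i o').
Proof.
move=> [h1 h2 h3]; split=> //= r' i' fr'.
by rewrite /Defs.set_mem; case: eqP => [e|_]; [move: (adr_gt0 r' i'); rewrite e|exact: h1].
Qed.

Lemma sim_goto s p m k i o q o' : sim s (Config p m k i o) ->
  sim s (Config q m k i o').
Proof. by case. Qed.

Lemma adr0 r : adr r 0 = (rnum r).+1. Proof. by []. Qed.

Lemma opnd_ok s p m k i o x : sim s (Config p m k i o) -> all fits (opnd_regs x) ->
  opval m (opnd x) = oval (nm s) x.
Proof.
case: x => //= r [/= h1 _ _] /andP[f _].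
by rewrite -adr0 h1.
Qed.

Lemma reg_ok s p m k i o r : sim s (Config p m k i o) -> fits r ->
  m (rnum r).+1 = nm s r 0.
Proof. by move=> [/= h _ _] f; rewrite -adr0 h. Qed.

Lemma kreg_ok s p m k i o r : sim s (Config p m k i o) -> fits r ->
  k (rnum r).+1 = km s r 0.
Proof. by move=> [_ /= h _] f; rewrite -adr0 h. Qed.

Lemma index_ok s c a i o : code_at o (index_code a i) -> pc c = o -> sim s c ->
  fits a -> fits i ->
  exists c', [/\ steps c (silent 2) c', pc c' = o.+2, sim s c',
     nmem c' 0 = adr a (nm s i 0) & out c' = out c].
Proof.
move=> /code_at_cons[c1 /code_at_cons[c2 _]] e h fa fi.
case: c e h => p m k w ou /= -> h.
eexists; split=> /=.
- eexists; split; first by rewrite /= c1.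
    by rewrite /= cats0.
  eexists; split; first by rewrite /= c2.
    by rewrite /= cats0.
  by [].
- by [].
- exact: (sim_set0 _ _ _ (sim_set0 _ 0 ou h)).
- by rewrite /= /Defs.set_mem /= (reg_ok h fi).
- by [].
Qed.

Ltac one_step := eexists; split; [reflexivity | by rewrite /= ?cats0 -?cats1 | by []].

Lemma compile_op_ok s op o c : code_at o (compile_op op) -> all fits (op_regs op) ->
  pc c = o -> sim s c ->
  exists c', [/\ steps c (silent (opsize op)) c', pc c' = o + opsize op,
    sim (apply_op s op) c' & out c' = out c].
Proof.
case: op => /=.
- move=> d x /code_at_cons[c1 _] /andP[fd fx].
  case: c => p m k w ou /= -> h; eexists; split.
  + rewrite /= c1; one_step.
  + by rewrite addn1.
  + rewrite (opnd_ok h fx); exact: (sim_setn _ _ _ _ fd h).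
  + by [].
- move=> b d x y /code_at_cons[c1 _] /andP[fd]; rewrite all_cat => /andP[fx fy].
  case: c => p m k w ou /= -> h.
  by case: b c1 => c1; (eexists; split; [rewrite /= c1; one_step
   | by rewrite addn1
   | rewrite (opnd_ok h fx) (opnd_ok h fy); exact: (sim_setn _ _ _ _ fd h)
   | by []]).
- move=> d a i /(code_at_cat (a := index_code _ _))[c1 c2] /and4P[fd fa fi _] ep h.
  have [c' [h1 h2 h3 h4 h5]] := index_ok c1 ep h fa fi.
  case: c' h1 h2 h3 h4 h5 => p m k w ou /= h1 h2 h3 h4 h5.
  move: c2; rewrite /= addn2 => /code_at_cons[c2 _].
  eexists; split.
  + refine (steps_cat (t1 := silent 2) (t2 := silent 1) h1 _).
    rewrite /= h2 c2; one_step.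
  + by rewrite /= h2 addn3.
  + rewrite /= h4 (_ : m _ = nm s a (nm s i 0)); last by case: h3 => h3 _ _; exact: h3.
    exact: (sim_setn _ _ _ _ fd h3).
  + by rewrite h5.
- move=> a i x /(code_at_cat (a := index_code _ _))[c1 c2] /and4P[fa fi fx _] ep h.
  have [c' [h1 h2 h3 h4 h5]] := index_ok c1 ep h fa fi.
  case: c' h1 h2 h3 h4 h5 => p m k w ou /= h1 h2 h3 h4 h5.
  move: c2; rewrite /= addn2 => /code_at_cons[c2 _].
  eexists; split.
  + refine (steps_cat (t1 := silent 2) (t2 := silent 1) h1 _).
    rewrite /= h2 c2; one_step.
  + by rewrite /= h2 addn3.
  + rewrite /= h4 (reg_ok h3 fx).
    exact: (sim_setn _ _ _ _ fa h3).
  + by rewrite h5.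
- move=> d x /code_at_cons[c1 _] /andP[fd fx].
  case: c => p m k w ou /= -> h; eexists; split.
  + rewrite /= c1; one_step.
  + by rewrite addn1.
  + rewrite (opnd_ok h fx); exact: (sim_setk _ _ _ _ fd h).
  + by [].
- move=> d x y /code_at_cons[c1 _] /and4P[fd fx fy _].
  case: c => p m k w ou /= -> h; eexists; split.
  + rewrite /= c1; one_step.
  + by rewrite addn1.
  + rewrite (kreg_ok h fx) (kreg_ok h fy); exact: (sim_setk _ _ _ _ fd h).
  + by [].
- move=> d x y /code_at_cons[c1 _] /and4P[fd fx fy _].
  case: c => p m k w ou /= -> h; eexists; split.
  + rewrite /= c1; one_step.
  + by rewrite addn1.
  + rewrite (kreg_ok h fx) (kreg_ok h fy); exact: (sim_setk _ _ _ _ fd h).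
  + by [].
- move=> d a i /(code_at_cat (a := index_code _ _))[c1 c2] /and4P[fd fa fi _] ep h.
  have [c' [h1 h2 h3 h4 h5]] := index_ok c1 ep h fa fi.
  case: c' h1 h2 h3 h4 h5 => p m k w ou /= h1 h2 h3 h4 h5.
  move: c2; rewrite /= addn2 => /code_at_cons[c2 _].
  eexists; split.
  + refine (steps_cat (t1 := silent 2) (t2 := silent 1) h1 _).
    rewrite /= h2 c2; one_step.
  + by rewrite /= h2 addn3.
  + rewrite /= h4 (_ : k _ = km s a (nm s i 0)); last by case: h3 => _ h3 _; exact: h3.
    exact: (sim_setk _ _ _ _ fd h3).
  + by rewrite h5.
- move=> a i x /(code_at_cat (a := index_code _ _))[c1 c2] /and4P[fa fi fx _] ep h.
  have [c' [h1 h2 h3 h4 h5]] := index_ok c1 ep h fa fi.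
  case: c' h1 h2 h3 h4 h5 => p m k w ou /= h1 h2 h3 h4 h5.
  move: c2; rewrite /= addn2 => /code_at_cons[c2 _].
  eexists; split.
  + refine (steps_cat (t1 := silent 2) (t2 := silent 1) h1 _).
    rewrite /= h2 c2; one_step.
  + by rewrite /= h2 addn3.
  + rewrite /= h4 (kreg_ok h3 fx).
    exact: (sim_setk _ _ _ _ fa h3).
  + by rewrite h5.
Qed.

(** The induction follows the execution and not the command: a further round of a loop executes the
    same command at the same offset. *)
Lemma compile_ok c s tr s' : exec c s tr s' -> forall o cf,
  code_at o (compile o c) -> all fits (regs c) -> pc cf = o -> sim s cf ->
  exists cf', [/\ steps cf tr cf', pc cf' = o + csize c & sim s' cf'].
Proof.
elim=> {c s tr s'}.
- move=> os s o cf; elim: os s o cf => [|a os ih] s o cf /=.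
    by move=> _ _ e h; exists cf; rewrite addn0; split.
  move=> /code_at_cat[c1 c2]; rewrite all_cat => /andP[f1 f2] e h.
  have [cf1 [h1 h2 h3 h4]] := compile_op_ok c1 f1 e h.
  rewrite size_compile_op in c2.
  have [cf2 [g1 g2 g3]] := ih _ _ _ c2 f2 h2 h3.
  exists cf2; split=> //; last by rewrite g2 /bsize /= addnA.
  by rewrite /silent /bsize /= nseqD; apply: steps_cat g1.
- move=> d s n w ew o [p m k i ou] /= /code_at_cons[c1 _] /andP[fd _] -> h.
  eexists; split.
  + case: (h) => _ _ /= ->; rewrite ew c1; one_step.
  + by rewrite addn1.
  + have [/= h1 h2 h3] := sim_setn 0 n (p.+1) ou fd h; split=> //; exact: h1.
- move=> d s n w ew o [p m k i ou] /= /code_at_cons[c1 _] /andP[fd _] -> h.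
  eexists; split.
  + case: (h) => _ _ /= ->; rewrite ew c1; one_step.
  + by rewrite addn1.
  + have [/= h1 h2 h3] := sim_setk 0 n (p.+1) ou fd h; split=> //; exact: h2.
- move=> d s o [p m k i ou] /= /code_at_cons[c1 _] /andP[fd _] -> h.
  eexists; split.
  + rewrite -(reg_ok h fd) /= c1; one_step.
  + by rewrite addn1.
  + exact: (sim_goto _ _ h).
- move=> d s o [p m k i ou] /= /code_at_cons[c1 _] /andP[fd _] -> h.
  eexists; split.
  + rewrite -(kreg_ok h fd) /= c1; one_step.
  + by rewrite addn1.
  + exact: (sim_goto _ _ h).
- move=> c1 c2 s1 s2 s3 t1 t2 _ ih1 _ ih2 o cf /= /code_at_cat[a1 a2].
  rewrite all_cat => /andP[f1 f2] e h.
  have [cf1 [h1 h2 h3]] := ih1 _ _ a1 f1 e h.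
  rewrite size_compile in a2.
  have [cf2 [g1 g2 g3]] := ih2 _ _ a2 f2 h2 h3.
  by exists cf2; split=> //; [exact: steps_cat g1|rewrite g2 addnA].
- move=> r c s z o [p m k i ou] /= /code_at_cons[a1 a2] /andP[fr f] -> h.
  eexists; split.
  + rewrite /= a1 (kreg_ok h fr) z eqxx; one_step.
  + by rewrite /= addSnnS.
  + exact: (sim_goto _ _ h).
- move=> r c s t s' z _ ih o [p m k i ou] /= /code_at_cons[a1 a2] /andP[fr f] -> h.
  have [cf2 [g1 g2 g3]] := ih _ (Config o.+1 m k i ou) a2 f erefl (sim_goto _ _ h).
  exists cf2; split=> //; last by rewrite g2 addSnnS.
  rewrite /= a1 (kreg_ok h fr) (introF eqP z).
  by eexists; split; [reflexivity | rewrite cats0 | exact: g1].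
- move=> x y c s z o [p m k i ou] /= /code_at_cons[a1 a2] /and3P[fx fy f] -> h.
  eexists; split.
  + rewrite /= a1 /= (reg_ok h fx) (reg_ok h fy) z; one_step.
  + by [].
  + exact: (sim_goto _ _ h).
- move=> x y c s1 t s2 t' s3 z _ ih _ ih2 o [p m k i ou] /= ca.
  move: (ca) => /code_at_cons[a1 /code_at_cat[a2 a3]] ff.
  move: (ff) => /and3P[fx fy f] -> h.
  have [[p2 m2 k2 i2 ou2] [g1 /= g2 g3]] := ih _ (Config o.+1 m k i ou) a2 f erefl (sim_goto _ _ h).
  rewrite size_compile in a3; move: a3 => /code_at_cons[a3 _].
  have [cf3 [w1 w2 w3]] := ih2 _ (Config o m2 k2 i2 ou2) ca ff erefl (sim_goto _ _ g3).
  exists cf3; split=> //.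
  rewrite /= a1 /= (reg_ok h fx) (reg_ok h fy) leqNgt z.
  eexists; split; [reflexivity | by rewrite cats0 | apply: (steps_cat g1)].
  rewrite /= g2 a3; by eexists; split; [reflexivity | rewrite /= cats0 | exact: w1].
- move=> x c s1 t s2 _ ih z o cf /= /code_at_cat[a1 a2] /andP[fx f] e h.
  have [[p2 m2 k2 i2 ou2] [g1 /= g2 g3]] := ih _ _ a1 f e h.
  rewrite size_compile in a2; move: a2 => /code_at_cons[a2 _].
  eexists; split.
  + rewrite -cats1; apply: (steps_cat g1).
    rewrite /= g2 a2 /= (reg_ok g3 fx) z /=; one_step.
  + by rewrite /= addnS.
  + exact: (sim_goto _ _ g3).
- move=> x c s1 t s2 t' s3 _ ih z _ ih2 o cf /= ca ff e h.
  move: (ca) (ff) => /code_at_cat[a1 a2] /andP[fx f].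
  have [[p2 m2 k2 i2 ou2] [g1 /= g2 g3]] := ih _ _ a1 f e h.
  rewrite size_compile in a2; move: a2 => /code_at_cons[a2 _].
  have [cf3 [w1 w2 w3]] := ih2 _ (Config o m2 k2 i2 ou2) ca ff erefl (sim_goto _ _ g3).
  exists cf3; split=> //.
  apply: (steps_cat g1); rewrite /= g2 a2 /= (reg_ok g3 fx) z.
  by eexists; split; [reflexivity | rewrite /= cats0 | exact: w1].
Qed.

End Compile.

End Language.

(** * From traces of single steps to preprocessing time and delay *)

Section Traces.
Variable K : comNzSemiRingType.

Lemma steps_iter P (c : config K) tr c' : steps P c tr c' ->
  iter (size tr) (fun s => odflt s (step P s)) c = c' /\
  forall j, j <= size tr ->
    out (iter j (fun s => odflt s (step P s)) c) = out c ++ pmap id (take j tr).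
Proof.
elim: tr c => [|e tr ih] c.
  by move=> /= ->; split=> // j; rewrite leqn0 => /eqP-> /=; rewrite cats0.
move=> [c1 [h1 h2 /ih[h3 h4]]]; split; first by rewrite [size _]/= iterSr h1 -h3.
case=> [|j] hj; first by rewrite /= cats0.
by rewrite iterSr h1 [in odflt _ _]/= h4 // h2 -catA; case: (e).
Qed.

(* [tr] splits into blocks of at most [D] steps, each printing one answer, and a
   silent tail of at most [D] steps. *)
Definition enum_trace (D : nat) (ans : seq (seq nat * K)) (tr : trace K) :=
  exists (bs : seq (trace K)) (tl : trace K),
    [/\ tr = flatten bs ++ tl, all (fun b => size b <= D) (tl :: bs),
        [seq pmap id b | b <- bs] = [seq enc_entry x | x <- ans]
      & pmap id tl = [::]].

Lemma pmap_flatten (T U : Type) (f : T -> option U) (s : seq (seq T)) :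
  pmap f (flatten s) = flatten [seq pmap f x | x <- s].
Proof. by elim: s => //= x s ih; rewrite pmap_cat ih. Qed.

Lemma exec_enumerates c w tr s' D ans :
  exec c (State (fun _ _ => 0) (fun _ _ => 0%R) w) tr s' ->
  forall tr0 tr1, tr = tr0 ++ tr1 -> pmap id tr0 = [::] -> enum_trace D ans tr1 ->
  enumerates_within (compile (\max_(r <- regs c) (rnum r).+1).+1 0 c) w ans
    (size tr0) D.
Proof.
set M := _.+1 => X tr0 tr1 etr sil [bs [tl [e1 e2 e3 e4]]].
set P := compile M 0 c.
have fitc : all (fits M) (regs c).
  apply/allP => r hr; rewrite /fits ltnS /M.
  by rewrite (big_rem r) //= leq_maxl.
have S0 : sim M (State (fun _ _ => 0) (fun _ _ => 0%R) w) (init_config w) by [].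
have [cf [h1 h2 _]] := compile_ok X (P := P) (o := 0) (cf := init_config w)
  (fun k hk => erefl) fitc erefl S0.
have [r1 r2] := steps_iter h1.
have szbs : size bs = size ans by rewrite -(size_map (pmap id)) e3 size_map.
have etr2 : tr = flatten (tr0 :: bs) ++ tl by rewrite etr e1 catA.
(* Time [j] is the end of the [j]th block; the last time also includes the silent tail. *)
pose t j := if j <= size ans then size (flatten (tr0 :: take j bs)) else size tr.
have tS j : j < size ans -> t j.+1 = t j + size (nth [::] bs j).
  move=> hj; rewrite /t hj (ltnW hj) /=.
  by rewrite (take_nth [::]) ?szbs // flatten_rcons !size_cat addnA.
have hb j : j < size ans -> size (nth [::] bs j) <= D.
  move=> hj; move: e2 => /= /andP[_ /allP]; apply; apply: mem_nth.
  by rewrite szbs.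
have tlast : t (size ans) = size (flatten (tr0 :: bs)).
  by rewrite /t leqnn take_oversize // szbs.
have tend : t (size ans).+1 = size tr by rewrite /t ltnn.
exists t; split.
- by rewrite /t /= take0 /= cats0.
- move=> j; rewrite leq_eqVlt => /orP[/eqP->|hj].
    rewrite tend tlast etr2 size_cat leq_addr leq_add2l.
    by case/andP: e2.
  by rewrite tS // leq_addr leq_add2l hb.
- move=> j; rewrite leq_eqVlt => /orP[/eqP->|hj].
    rewrite tend /run (r2 _ (leqnn _)) /= take_size etr2 pmap_cat e4 cats0.
    by rewrite /= pmap_cat sil /= pmap_flatten e3 take_oversize.
  rewrite ltnS in hj.
  have e5 : tr = flatten (tr0 :: take j bs) ++ (flatten (drop j bs) ++ tl).
    by rewrite etr2 /= -!catA; congr (_ ++ _); rewrite catA -flatten_cat cat_take_drop.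
  rewrite /run /t hj r2 e5; last by rewrite size_cat leq_addr.
  rewrite take_size_cat //=; by rewrite pmap_cat sil /= pmap_flatten !map_take e3.
(* The machine halts because the program counter has left the code, where [nth] returns [Halt]. *)
- by rewrite tend /run r1; case: (cf) h2 => ? ? ? ? ? /= ->;
    rewrite nth_default // size_compile add0n.
Qed.

End Traces.

(* The regions that an operation or a command may modify. *)
Definition op_wr (o : op) : region :=
  match o with
  | OMov d _ | OBin _ d _ _ | OLoad d _ _ | OStore d _ _ | OKNat d _
  | OKAdd d _ _ | OKMul d _ _ | OKLoad d _ _ | OKStore d _ _ => d
  end.

Fixpoint cmd_wr c : seq region :=
  match c with
  | Block os => map op_wr os
  | CRead d | CKRead d => [:: d]
  | CWrite d | CKWrite d => [::]
  | CSeq c1 c2 => cmd_wr c1 ++ cmd_wr c2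
  | CIfK r c | CDo c r => cmd_wr c
  | CWhile x y c => cmd_wr c
  end.

Lemma regionE (a b c a' b' c' : nat) :
  ((a, b, c) == (a', b', c') :> region) = [&& a == a', b == b' & c == c'].
Proof. by rewrite !xpair_eqE andbA. Qed.

(** * Frame conditions and silent executions with bounded cost *)

Section Exec.
Variable K : comNzSemiRingType.
Implicit Types s : state K.

Definition frame (W : pred region) s s' := forall r, ~~ W r ->
  nm s' r =1 nm s r /\ km s' r =1 km s r.

Lemma frame_refl W s : frame W s s. Proof. by move=> r. Qed.

Lemma frame_trans W s1 s2 s3 : frame W s1 s2 -> frame W s2 s3 -> frame W s1 s3.
Proof.
by move=> h1 h2 r hr; have [a b] := h1 r hr; have [c d] := h2 r hr;
  split=> i; rewrite ?c ?d ?a ?b.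
Qed.

Lemma frame_sub (W W' : pred region) s s' :
  (forall r, W r -> W' r) -> frame W s s' -> frame W' s s'.
Proof. by move=> h f r hr; apply: f; apply: contra hr; exact: h. Qed.

Lemma frame_op (W : pred region) s o : W (op_wr o) -> frame W s (apply_op s o).
Proof.
move=> h r hr.
have e d : W d -> (r == d) = false.
  by move=> wd; apply: contraNF hr => /eqP->.
by case: o h => /= *; split=> // i; rewrite /upd2 e.
Qed.

Lemma frame_block W s os : all W (map op_wr os) ->
  frame W s (foldl (@apply_op K) s os).
Proof.
elim: os s => [|o os ih] s /=; first by move=> _; exact: frame_refl.
by move=> /andP[h1 h2]; apply: frame_trans (frame_op _ h1) (ih _ h2).
Qed.

Lemma frame_exec W c s tr s' : exec c s tr s' -> all W (cmd_wr c) -> frame W s s'.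
Proof.
elim=> {c s tr s'} /=.
- by move=> os s; exact: frame_block.
- move=> d s n w _ /andP[wd _] r hr /=; split=> // i; rewrite /upd2.
  by case: eqP => // e; rewrite e wd in hr.
- move=> d s n w _ /andP[wd _] r hr /=; split=> // i; rewrite /upd2.
  by case: eqP => // e; rewrite e wd in hr.
- by move=> *; exact: frame_refl.
- by move=> *; exact: frame_refl.
- move=> c1 c2 s1 s2 s3 t1 t2 _ h1 _ h2; rewrite all_cat => /andP[a1 a2].
  exact: frame_trans (h1 a1) (h2 a2).
- by move=> *; exact: frame_refl.
- by [].
- by move=> *; exact: frame_refl.
- move=> x y c s1 t s2 t' s3 _ _ h1 _ h2 a; exact: frame_trans (h1 a) (h2 a).
- by [].
- move=> x c s1 t s2 t' s3 _ h1 _ _ h2 a; exact: frame_trans (h1 a) (h2 a).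
Qed.

(* A silent run of at most [n] steps. *)
Definition exec0 c s n s' := exists tr : trace K,
  [/\ exec c s tr s', pmap id tr = [::] & size tr <= n].

Lemma pmap_silent n : pmap id (silent K n) = [::].
Proof. by elim: n. Qed.

Lemma exec0_block os s : exec0 (Block os) s (bsize os) (foldl (@apply_op K) s os).
Proof.
by exists (silent K (bsize os)); split; [constructor|exact: pmap_silent|rewrite size_nseq].
Qed.

Lemma exec0_weak c s n m s' : n <= m -> exec0 c s n s' -> exec0 c s m s'.
Proof. by move=> l [tr [a b d]]; exists tr; split=> //; apply: leq_trans l. Qed.

Lemma exec0_seq c1 c2 s1 s2 s3 n1 n2 : exec0 c1 s1 n1 s2 -> exec0 c2 s2 n2 s3 ->
  exec0 (CSeq c1 c2) s1 (n1 + n2) s3.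
Proof.
move=> [t1 [a1 b1 d1]] [t2 [a2 b2 d2]]; exists (t1 ++ t2); split.
- by econstructor; eauto.
- by rewrite pmap_cat b1 b2.
- by rewrite size_cat leq_add.
Qed.

Lemma exec0_frame W c s n s' : exec0 c s n s' -> all W (cmd_wr c) -> frame W s s'.
Proof. by case=> tr [h _ _]; exact: frame_exec h. Qed.

Lemma exec0_read d s n w : ip s = inl n :: w ->
  exec0 (CRead d) s 1 (State (upd2 (nm s) d 0 n) (km s) w).
Proof. by move=> e; exists [:: None]; split=> //; constructor. Qed.

Lemma exec0_kread d s x w : ip s = inr x :: w ->
  exec0 (CKRead d) s 1 (State (nm s) (upd2 (km s) d 0 x) w).
Proof. by move=> e; exists [:: None]; split=> //; constructor. Qed.

(** Every round pays for its body, the test and the jump back; the additional step is the final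
    failing test. *)
Lemma exec0_for J N c n (I : nat -> state K -> Prop) T s :
  (forall j s, I j s -> nm s J 0 = j /\ nm s N 0 = n) ->
  (forall j s, j < n -> I j s -> exists2 s', exec0 c s T s' & I j.+1 s') ->
  I 0 s ->
  exists2 s', exec0 (CWhile J N c) s (n * T.+2).+1 s' & I n s'.
Proof.
move=> hI hs; suff gen k : forall j s, k + j = n -> I j s ->
    exists2 s', exec0 (CWhile J N c) s (k * T.+2).+1 s' & I n s'.
  by apply: (gen n 0); rewrite addn0.
elim: k => [|k ih] j {}s /=.
  rewrite add0n => -> h; exists s => //; exists [:: None]; split=> //.
  by constructor; have [-> ->] := hI _ _ h.
move=> e h; have [s1 [tr [x1 x2 x3]] h1] := hs j s (ltac:(lia)) h.
have [s2 [tr2 [y1 y2 y3]] h2] := ih j.+1 s1 (ltac:(lia)) h1.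
exists s2 => //; exists (None :: tr ++ None :: tr2); split.
- by apply: XWhileT x1 y1; have [-> ->] := hI _ _ h; lia.
- by rewrite /= pmap_cat x2 /= y2.
- by rewrite /= size_cat /=; lia.
Qed.

Definition nonzero_test u k : cmd :=
  CSeq (Block [:: OMov u (Lit 0)]) (CIfK k (Block [:: OMov u (Lit 1)])).

Lemma exec0_nonzero u k s : exists2 s', exec0 (nonzero_test u k) s 3 s' &
  nm s' u 0 = (km s k 0 != 0%R) :> nat /\ frame (pred1 u) s s'.
Proof.
set s0 := apply_op s (OMov u (Lit 0)).
have ek : km s0 k 0 = km s k 0 by [].
have f0 : frame (pred1 u) s s0 by apply: frame_op => /=.
have [z|z] := eqVneq (km s k 0) 0%R.
  exists s0; last by rewrite /s0 /= /upd2 !eqxx.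
  exists ([:: None] ++ [:: None]); split=> //.
  by econstructor; [constructor|apply: XIfF].
exists (apply_op s0 (OMov u (Lit 1))); last first.
  split; first by rewrite /= /upd2 !eqxx.
  by apply: frame_trans f0 _; apply: frame_op => /=.
exists ([:: None] ++ [:: None; None]); split=> //.
by econstructor; [constructor|apply: XIfT; [exact/eqP|constructor]].
Qed.

End Exec.

(** * Terms and their evaluation in constant time *)

Section Terms.
Variable K : comNzSemiRingType.

(* [rl]: the entries of the input relations; [cv]: the values of the constants. *)
Record inst := Inst { rl : nat -> seq (seq nat * K); cv : nat -> nat }.

(* [TSum R xs ys f zs us] is the sum of [f] over the distinct [ys]-projections of
   the tuples [xs] of [R] whose [zs]-components are the values of [us]; [TAny] is
   the indicator that one of these values of [f] is nonzero. *)
Inductive tm :=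
| TOne
| TMul of tm & tm
| TLe of nat & nat
| TEq of nat & nat
| TRel of nat & seq nat
| TCount of nat & seq nat
| TSum of nat & seq nat & seq nat & tm & seq nat & seq nat
| TAny of nat & seq nat & seq nat & tm & seq nat & seq nat.

Definition vmin (I : inst) c cs := foldl (fun a c => minn a (cv I c)) (cv I c) cs.

Definition asg (ys p : seq nat) : nat -> nat := fun x => nth 0 p (index x ys).

(** For [t] as long as [xs] this fails exactly when a variable repeated in [xs] meets two different
    values, because [asg] reads the first occurrence. *)
Definition consistent xs t := map (asg xs t) xs == t.

(* [gen L xs ys] lists the distinct [ys]-projections of the tuples of [L] that
   match the variables [xs]. *)
Definition gen_step xs ys (g : seq (seq nat)) (e : seq nat * K) :=
  let p := map (asg xs e.1) ys in
  if consistent xs e.1 && (p \notin g) then rcons g p else g.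

Definition gen (L : seq (seq nat * K)) xs ys := foldl (gen_step xs ys) [::] L.

(** As a sum, this does not depend on the order of [L] and can be accumulated while the input is
    read. *)
Definition lkp (L : seq (seq nat * K)) (t : seq nat) : K :=
  (\sum_(e <- L | e.1 == t) e.2)%R.

Definition keyed (ys zs z p : seq nat) := map (asg ys p) zs == z.

Fixpoint eval (I : inst) (t : tm) (nu : nat -> nat) : K :=
  match t with
  | TOne => 1%R
  | TMul f g => (eval I f nu * eval I g nu)%R
  | TLe x c => ((nu x <= cv I c)%N : nat)%:R%R
  | TEq x y => ((nu x == nu y) : nat)%:R%R
  | TRel R xs => lkp (rl I R) (map nu xs)
  | TCount c cs => (vmin I c cs)%:R%R
  | TSum R xs ys f zs us =>
      (\sum_(p <- gen (rl I R) xs ys | keyed ys zs (map nu us) p)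
         eval I f (asg ys p))%R
  | TAny R xs ys f zs us =>
      ((0 < count (fun p => keyed ys zs (map nu us) p &&
                    (eval I f (asg ys p) != 0%R)) (gen (rl I R) xs ys))%N : nat)%:R%R
  end.

Fixpoint fv t : seq nat :=
  match t with
  | TOne | TCount _ _ => [::]
  | TMul f g => fv f ++ fv g
  | TLe x _ => [:: x]
  | TEq x y => [:: x; y]
  | TRel _ xs => xs
  | TSum _ _ _ _ _ us | TAny _ _ _ _ _ us => us
  end.

Lemma eval_fv I t nu nu' : {in fv t, nu =1 nu'} -> eval I t nu = eval I t nu'.
Proof.
elim: t nu nu' => //=.
- move=> f hf g hg nu nu' h; rewrite (hf nu nu') ?(hg nu nu') // => x hx; apply: h.
    by rewrite mem_cat hx orbT.
  by rewrite mem_cat hx.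
- by move=> x c nu nu' h; rewrite h ?mem_head.
- by move=> x y nu nu' h; rewrite !h ?mem_head // !inE eqxx orbT.
- by move=> R xs nu nu' /eq_in_map ->.
- by move=> R xs ys f _ zs us nu nu' /eq_in_map ->.
- by move=> R xs ys f _ zs us nu nu' /eq_in_map ->.
Qed.

Variables (ars : seq nat) (nc : nat).

Definition subl (a b : seq nat) := all (fun x => x \in b) a.

Definition wfgen R (xs ys zs : seq nat) (f : tm) :=
  [&& R < size ars, size xs == nth 0 ars R, subl ys xs, subl zs ys & subl (fv f) ys].

Fixpoint wf t : bool :=
  match t with
  | TOne | TEq _ _ => true
  | TMul f g => wf f && wf g
  | TLe _ c => c < nc
  | TRel R xs => (R < size ars) && (size xs == nth 0 ars R)
  | TCount c cs => (c < nc) && all (fun c => c < nc) cs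
  | TSum R xs ys f zs us | TAny R xs ys f zs us =>
      [&& wf f, wfgen R xs ys zs f & size us == size zs]
  end.

Definition valid (I : inst) := forall R, R < size ars -> forall e, e \in rl I R ->
  size e.1 = nth 0 ars R.

(* Injective on tuples of equal length: [(c + v) ^ 2 + c] determines [c + v], being
   less than [(c + v + 1) ^ 2]. *)
Definition tcode (t : seq nat) := foldl (fun c v => (c + v) * (c + v) + c) 0 t.

Lemma tcode_rcons t v : tcode (rcons t v) = (tcode t + v) * (tcode t + v) + tcode t.
Proof. by rewrite /tcode -cats1 foldl_cat. Qed.

Lemma tcode_inj t t' : size t = size t' -> (tcode t == tcode t') = (t == t').
Proof.
elim/last_ind: t t' => [|t v ih] t'; first by case: t'.
case/lastP: t' => [|t' v']; first by rewrite size_rcons.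
rewrite !size_rcons => -[e]; rewrite !tcode_rcons eqseq_rcons -ih //.
set a := tcode t; set b := tcode t'.
apply/eqP/andP => [h|[/eqP-> /eqP->] //].
have : a + v = b + v' by case: (ltngtP (a + v) (b + v')) => // l; nia.
by move=> h2; rewrite h2 in h; split; apply/eqP; lia.
Qed.

(* Registers: temporaries, variables, constants; for each relation its columns, the
   table of its values, the codes of its tuples and its length.  For each numbered
   subterm or loop: its table [rMsg] indexed by tuple codes, the set [rSeen] of
   tuples already met, and linked lists with heads [rHd] indexed by key codes,
   successors [rNx], columns [rLC], length [rCnt] and current position [rPtr]. *)
Definition rT i : region := (0, i, 0).
Definition rV x : region := (1, x, 0).
Definition rC i : region := (2, i, 0).
Definition rCol R i : region := (3, R, i).
Definition rVal R : region := (4, R, 0).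
Definition rCode R : region := (5, R, 0).
Definition rN R : region := (6, R, 0).
Definition rMsg n : region := (7, n, 0).
Definition rSeen n : region := (8, n, 0).
Definition rHd n : region := (9, n, 0).
Definition rNx n : region := (10, n, 0).
Definition rLC n i : region := (11, n, i).
Definition rCnt n : region := (12, n, 0).
Definition rPtr n : region := (13, n, 0).
Definition rJ : region := (14, 0, 0).
Definition rW : region := (14, 1, 0).

Definition isTemp : pred region := fun r => r.1.1 == 0.

(** Entry [j] lies in cell [j.+1] because the loop counter is incremented before it is used. *)
Definition loaded (I : inst) (s : state K) :=
  [/\ forall R, R < size ars -> nm s (rN R) 0 = size (rl I R),
      forall R j, R < size ars -> j < size (rl I R) ->
        nm s (rCode R) j.+1 = tcode (nth ([::], 0%R) (rl I R) j).1 /\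
        forall i, i < nth 0 ars R ->
          nm s (rCol R i) j.+1 = nth 0 (nth ([::], 0%R) (rl I R) j).1 i,
      forall R t, R < size ars -> size t = nth 0 ars R ->
        km s (rVal R) (tcode t) = lkp (rl I R) t
    & forall c, c < nc -> nm s (rC c) 0 = cv I c].

Definition isdata : pred region := fun r => 1 < r.1.1 < 7.

Lemma loaded_frame (W : pred region) I s s' : (forall r, isdata r -> ~~ W r) ->
  frame W s s' -> loaded I s -> loaded I s'.
Proof.
move=> hW f [h1 h2 h3 h4]; split.
- by move=> R hR; have [-> _] := f (rN R) (hW (rN R) isT); exact: h1.
- move=> R j hR hj; have [-> _] := f (rCode R) (hW (rCode R) isT).
  have [a b] := h2 R j hR hj; split=> // i hi.
  by have [-> _] := f (rCol R i) (hW (rCol R i) isT); exact: b.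
- by move=> R t hR ht; have [_ ->] := f (rVal R) (hW (rVal R) isT); exact: h3.
- by move=> c hc; have [-> _] := f (rC c) (hW (rC c) isT); exact: h4.
Qed.

(* The number of tables used by a term. *)
Fixpoint nreg t : nat :=
  match t with
  | TMul f g => nreg f + nreg g
  | TSum _ _ _ f _ _ | TAny _ _ _ f _ _ => (nreg f).+1
  | _ => 0
  end.

(* The tables of [t], numbered from [n], have been filled. *)
Fixpoint ready (I : inst) (t : tm) (n : nat) (s : state K) : Prop :=
  match t with
  | TMul f g => ready I f n s /\ ready I g (n + nreg f) s
  | TSum R xs ys f zs us => forall z, size z = size zs ->
      km s (rMsg (n + nreg f)) (tcode z) =
        (\sum_(p <- gen (rl I R) xs ys | keyed ys zs z p) eval I f (asg ys p))%R
  | TAny R xs ys f zs us => forall z, size z = size zs ->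
      nm s (rMsg (n + nreg f)) (tcode z) =
        count (fun p => keyed ys zs z p && (eval I f (asg ys p) != 0%R))
          (gen (rl I R) xs ys)
  | _ => True
  end.

Definition ismsg n n' : pred region := fun r => (r.1.1 == 7) && (n <= r.1.2 < n').

Lemma ready_frame (W : pred region) I t n s s' :
  (forall r, ismsg n (n + nreg t) r -> ~~ W r) ->
  frame W s s' -> ready I t n s -> ready I t n s'.
Proof.
elim: t n => //=.
- move=> f hf g hg n hW fr [h1 h2]; split.
    by apply: hf h1 => // r /and3P[h a b]; apply: hW; rewrite /ismsg h; lia.
  by apply: hg h2 => // r /and3P[h a b]; apply: hW; rewrite /ismsg h; lia.
- move=> R xs ys f _ zs us n hW fr h z hz.
  by have [_ ->] := fr (rMsg (n + nreg f)) (hW (rMsg (n + nreg f)) (ltac:(rewrite /ismsg /=; lia))); exact: h.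
- move=> R xs ys f _ zs us n hW fr h z hz.
  by have [-> _] := fr (rMsg (n + nreg f)) (hW (rMsg (n + nreg f)) (ltac:(rewrite /ismsg /=; lia))); exact: h.
Qed.

Definition vars (s : state K) : nat -> nat := fun x => nm s (rV x) 0.

Definition code_ops d us : seq op :=
  OMov d (Lit 0) :: flatten [seq [:: OBin BAdd (rT 9) (Reg d) (Reg (rV x));
     OBin BMul (rT 9) (Reg (rT 9)) (Reg (rT 9));
     OBin BAdd d (Reg (rT 9)) (Reg d)] | x <- us].

Definition exb os s := foldl (@apply_op K) s os.

Lemma exb_cat a b s : exb (a ++ b) s = exb b (exb a s).
Proof. exact: foldl_cat. Qed.

Lemma code_ops_ok i us s : i != 9 ->
  nm (exb (code_ops (rT i) us) s) (rT i) 0 = tcode (map (vars s) us) /\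
  frame (fun r => (r == rT i) || (r == rT 9)) s (exb (code_ops (rT i) us) s).
Proof.
move=> i9; split; last first.
  apply: frame_block => /=; rewrite eqxx /=.
  by elim: us => //= x us ->; rewrite !eqxx !orbT.
elim/last_ind: us => [|us x ih]; first by rewrite /exb /= /upd2 !eqxx.
rewrite map_rcons tcode_rcons -ih.
rewrite /code_ops map_rcons flatten_rcons -cat_cons exb_cat -/(code_ops (rT i) us).
have fr : frame (fun r => (r == rT i) || (r == rT 9)) s (exb (code_ops (rT i) us) s).
  apply: frame_block => /=; rewrite eqxx /=.
  by elim: (us) => //= ? ? ->; rewrite !eqxx !orbT.
have -> : vars s x = vars (exb (code_ops (rT i) us) s) x.
  by rewrite /vars; have [-> _] := fr (rV x) isT.
set s1 := exb _ s.
by rewrite /exb /= /upd2 !regionE /= (negbTE i9) /= !eqxx /=.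
Qed.

End Terms.

Ltac eval_state := rewrite /upd2 /= ?regionE ?eqxx /= ?andbF ?andbT.

Lemma code_ops_wr d us : isTemp d -> all isTemp (map op_wr (code_ops d us)).
Proof.
by move=> td; rewrite /code_ops /= td /=; elim: us => //= x us ->; rewrite td.
Qed.

#[local] Opaque code_ops.

Definition rTr i := Reg (rT i).

Fixpoint min_ops (cs : seq nat) : seq op :=
  if cs is c :: cs' then
    [:: OBin BSub (rT 4) (rTr 3) (Reg (rC c)); OBin BSub (rT 3) (rTr 3) (rTr 4)]
    ++ min_ops cs'
  else [::].

Definition kmul_ops : seq op := [:: OKMul (rT 0) (rT 0) (rT 1)].

(* Multiplies the accumulator [rT 0] by the value of the term. *)
Fixpoint mcode (t : tm) (n : nat) : seq op :=
  match t with
  | TOne => [::]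
  | TMul f g => mcode f n ++ mcode g (n + nreg f)
  | TLe x c =>
      [:: OBin BSub (rT 3) (Reg (rV x)) (Reg (rC c));
          OBin BSub (rT 3) (Lit 1) (rTr 3); OKNat (rT 1) (rTr 3)] ++ kmul_ops
  | TEq x y =>
      [:: OBin BSub (rT 3) (Reg (rV x)) (Reg (rV y));
          OBin BSub (rT 4) (Reg (rV y)) (Reg (rV x));
          OBin BAdd (rT 3) (rTr 3) (rTr 4);
          OBin BSub (rT 3) (Lit 1) (rTr 3); OKNat (rT 1) (rTr 3)] ++ kmul_ops
  | TRel R xs => code_ops (rT 2) xs ++ OKLoad (rT 1) (rVal R) (rT 2) :: kmul_ops
  | TCount c cs =>
      OMov (rT 3) (Reg (rC c)) :: min_ops cs ++ OKNat (rT 1) (rTr 3) :: kmul_ops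
  | TSum _ _ _ f _ us =>
      code_ops (rT 2) us ++ OKLoad (rT 1) (rMsg (n + nreg f)) (rT 2) :: kmul_ops
  | TAny _ _ _ f _ us =>
      code_ops (rT 2) us ++
      [:: OLoad (rT 3) (rMsg (n + nreg f)) (rT 2);
          OBin BSub (rT 4) (Lit 1) (rTr 3);
          OBin BSub (rT 4) (Lit 1) (rTr 4); OKNat (rT 1) (rTr 4)] ++ kmul_ops
  end.

(** The first variable is loaded last, so that a repeated variable keeps the value of its first
    occurrence, in agreement with [asg]. *)
Fixpoint loads R i (xs : seq nat) : seq op :=
  if xs is x :: xs' then rcons (loads R i.+1 xs') (OLoad (rV x) (rCol R i) rJ)
  else [::].

(** The loop takes no branch: [rW] becomes 1 for a consistent tuple with a new projection and 0
    otherwise, and a rejected tuple is simply processed with weight 0. *)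
Definition head_ops R xs ys m : seq op :=
  OBin BAdd rJ (Reg rJ) (Lit 1) :: loads R 0 xs ++ code_ops (rT 2) xs ++
  [:: OLoad (rT 3) (rCode R) rJ; OBin BSub (rT 4) (rTr 2) (rTr 3);
      OBin BSub (rT 5) (rTr 3) (rTr 2); OBin BAdd (rT 4) (rTr 4) (rTr 5);
      OBin BSub rW (Lit 1) (rTr 4)] ++ code_ops (rT 2) ys ++
  [:: OLoad (rT 3) (rSeen m) (rT 2); OBin BSub (rT 5) (Lit 1) (rTr 3);
      OBin BMul rW (Reg rW) (rTr 5); OBin BAdd (rT 3) (rTr 3) (Reg rW);
      OStore (rSeen m) (rT 2) (rT 3)].

Definition gen_loop R xs ys m (body : cmd) : cmd :=
  CSeq (Block [:: OMov rJ (Lit 0)])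
       (CWhile rJ (rN R) (CSeq (Block (head_ops R xs ys m)) body)).

Definition isVar : pred region := fun r => r.1.1 == 1.

Definition head_wr m : pred region := fun r =>
  [|| isTemp r, isVar r, r == rJ, r == rW | r == rSeen m].

Lemma min_ops_wr cs : all isTemp (map op_wr (min_ops cs)).
Proof. by elim: cs. Qed.

Lemma mcode_wr t n : all isTemp (map op_wr (mcode t n)).
Proof.
elim: t n => //=.
- by move=> f hf g hg n; rewrite map_cat all_cat hf hg.
- by move=> R xs n; rewrite map_cat all_cat code_ops_wr.
- by move=> c cs n; rewrite map_cat all_cat min_ops_wr.
- by move=> R xs ys f _ zs us n; rewrite map_cat all_cat code_ops_wr.
- by move=> R xs ys f _ zs us n; rewrite map_cat all_cat code_ops_wr.
Qed.

Lemma loads_wr R i xs : all isVar (map op_wr (loads R i xs)).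
Proof. by elim: xs i => //= x xs ih i; rewrite map_rcons all_rcons /= ih. Qed.

Lemma sub_all_map (T : Type) (f : T -> region) (W W' : pred region) s :
  subpred W W' -> all W (map f s) -> all W' (map f s).
Proof. by move=> h; exact: sub_all. Qed.

Lemma head_ops_wr R xs ys m : all (head_wr m) (map op_wr (head_ops R xs ys m)).
Proof.
have tw : subpred isTemp (head_wr m) by move=> r h; rewrite /head_wr h.
have vw : subpred isVar (head_wr m) by move=> r h; rewrite /head_wr h orbT.
rewrite /head_ops map_cons !map_cat /= !all_cat /= !all_cat.
rewrite (sub_all_map vw (loads_wr _ _ _)).
rewrite (sub_all_map tw (code_ops_wr xs (isT : isTemp (rT 2)))).
rewrite (sub_all_map tw (code_ops_wr ys (isT : isTemp (rT 2)))) /=.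
by rewrite /head_wr !eqxx !orbT.
Qed.

(** * Filling the tables in linear time *)

Section Prep.
Variables (K : comNzSemiRingType) (ars : seq nat) (nc : nat).
Implicit Types (s : state K) (I : inst K).

Lemma vars_frame (W : pred region) s s' : (forall x, ~~ W (rV x)) ->
  frame W s s' -> vars s' =1 vars s.
Proof. by move=> h f x; rewrite /vars; have [-> _] := f (rV x) (h x). Qed.

Lemma exb_temp os s : all isTemp (map op_wr os) -> frame isTemp s (exb os s).
Proof. exact: frame_block. Qed.

Lemma isTemp_data r : isdata r -> ~~ isTemp r.
Proof. by rewrite /isdata /isTemp; lia. Qed.

Lemma isTemp_msg n n' r : ismsg n n' r -> ~~ isTemp r.
Proof. by rewrite /ismsg /isTemp; lia. Qed.

Lemma min_ops_ok I cs s a : loaded ars nc I s -> all (fun c => c < nc) cs ->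
  nm s (rT 3) 0 = a ->
  nm (exb (min_ops cs) s) (rT 3) 0 = foldl (fun a c => minn a (cv I c)) a cs /\
  km (exb (min_ops cs) s) (rT 0) 0 = km s (rT 0) 0.
Proof.
elim: cs s a => [|c cs ih] s a //= l /andP[h1 h2] e.
pose s1 := apply_op (apply_op s (OBin BSub (rT 4) (rTr 3) (Reg (rC c))))
  (OBin BSub (rT 3) (rTr 3) (rTr 4)).
have f1 : frame isTemp s s1.
  by apply: (frame_trans (s2 := apply_op s (OBin BSub (rT 4) (rTr 3) (Reg (rC c)))));
    apply: frame_op.
apply: (ih s1) => //.
case: l => _ _ _ /(_ c h1) ec.
by rewrite /s1 /= /upd2 !regionE /= e ec; lia.
Qed.

Lemma code_ops_temp us s :
  [/\ nm (exb (code_ops (rT 2) us) s) (rT 2) 0 = tcode (map (vars s) us),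
     km (exb (code_ops (rT 2) us) s) (rT 0) 0 = km s (rT 0) 0
   & frame isTemp s (exb (code_ops (rT 2) us) s)].
Proof.
have [h1 h2] := code_ops_ok us s (isT : 2 != 9).
split=> //; first by have [_ ->] := h2 (rT 0) isT.
by apply: exb_temp; apply: code_ops_wr.
Qed.

Lemma mcode_ok I t n s : wf ars nc t -> valid ars I -> loaded ars nc I s ->
  ready I t n s ->
  km (exb (mcode t n) s) (rT 0) 0 = (km s (rT 0) 0 * eval I t (vars s))%R.
Proof.
move=> + vI; elim: t n s => //=.
- by move=> n s _ _ _; rewrite mulr1.
- move=> f hf g hg n s /andP[wf1 wf2] l [r1 r2]; rewrite exb_cat.
  have fr := exb_temp s (mcode_wr f n).
  rewrite hg //; first last.
  + by apply: ready_frame fr r2 => r; exact: isTemp_msg.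
  + exact: loaded_frame isTemp_data fr l.
  by rewrite hf // mulrA (@eval_fv _ _ g _ (vars s)) // => x _; exact: (vars_frame _ fr).
- move=> x c n s hc l _; rewrite /exb /=.
  case: l => _ _ _ /(_ c hc) ec.
  rewrite /upd2 !regionE /= ec; congr (_ * _%:R)%R.
  by rewrite /vars; case: leqP; lia.
- move=> x y n s _ _ _; rewrite /exb /=.
  rewrite /upd2 !regionE /=; congr (_ * _%:R)%R.
  by rewrite /vars; case: eqP; lia.
- move=> R xs n s /andP[h1 /eqP h2] l _.
  rewrite exb_cat; have [c1 c2 c3] := code_ops_temp xs s.
  set s1 := exb _ s in c1 c2 c3 *.
  have [_ _ L _] := loaded_frame isTemp_data c3 l.
  rewrite /exb /= /upd2 !regionE /= c2 c1; congr (_ * _)%R.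
  by apply: L => //; rewrite size_map.
- move=> c cs n s /andP[h1 h2] l _.
  rewrite -[exb _ _]/(exb (min_ops cs ++ _) (apply_op s (OMov (rT 3) (Reg (rC c))))).
  have fr : frame isTemp s (apply_op s (OMov (rT 3) (Reg (rC c)))) by apply: frame_op.
  have l2 := loaded_frame isTemp_data fr l.
  have [e1 e2] := min_ops_ok (a := cv I c) l2 h2 (ltac:(case: (l) => _ _ _ /(_ c h1) <-; by [])).
  rewrite exb_cat; set s2 := exb _ _ in e1 e2 *.
  by rewrite /exb /= /upd2 !regionE /= e1 e2.
- move=> R xs ys f _ zs us n s /and3P[w1 w2 /eqP w3] l rd.
  rewrite exb_cat; have [c1 c2 c3] := code_ops_temp us s.
  set s1 := exb _ s in c1 c2 c3 *.
  rewrite /exb /= /upd2 !regionE /= c2 c1; congr (_ * _)%R.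
  have [_ ->] := c3 (rMsg (n + nreg f)) isT.
  by rewrite rd // size_map.
- move=> R xs ys f _ zs us n s /and3P[w1 w2 /eqP w3] l rd.
  rewrite exb_cat; have [c1 c2 c3] := code_ops_temp us s.
  set s1 := exb _ s in c1 c2 c3 *.
  rewrite /exb /= /upd2 !regionE /= c2 c1; congr (_ * _%:R)%R.
  have [-> _] := c3 (rMsg (n + nreg f)) isT.
  by rewrite rd ?size_map //; lia.
Qed.

Lemma loads_ok R i xs s x : x \in xs ->
  vars (exb (loads R i xs) s) x = nm s (rCol R (i + index x xs)) (nm s rJ 0).
Proof.
elim: xs i => //= y xs ih i; rewrite -cats1 exb_cat inE eq_sym.
have fr : frame isVar s (exb (loads R i.+1 xs) s) by apply: frame_block; exact: loads_wr.
set s1 := exb _ s in ih fr *.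
rewrite /vars /exb /= /upd2 !regionE /= andbT eq_sym.
have [-> _] := fr rJ isT; have [-> _] := fr (rCol R i) isT.
case: eqP => [->|ne] /=; first by rewrite addn0.
by move=> hx; rewrite -[LHS]/(vars s1 x) ih // addnS.
Qed.

Lemma asg_map ys (g : nat -> nat) x : x \in ys -> asg ys (map g ys) x = g x.
Proof. by move=> hx; rewrite /asg (nth_map 0) ?index_mem // nth_index. Qed.

Lemma head_ok I R xs ys zs f m j g s : wfgen ars R xs ys zs f ->
  valid ars I -> loaded ars nc I s ->
  nm s rJ 0 = j -> j < size (rl I R) ->
  (forall p, size p = size ys -> nm s (rSeen m) (tcode p) = (p \in g)) ->
  let e := nth ([::], 0%R) (rl I R) j in
  let p := map (asg xs e.1) ys in
  let b := consistent xs e.1 && (p \notin g) in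
  let s' := exb (head_ops R xs ys m) s in
  [/\ nm s' rJ 0 = j.+1, nm s' rW 0 = b, {in ys, vars s' =1 asg ys p}
    & forall q, size q = size ys ->
        nm s' (rSeen m) (tcode q) = (q \in gen_step xs ys g e)].
Proof.
case/and5P=> hR /eqP sx /allP yx _ _ vI l ej hj hs e p b.
have se : size e.1 = size xs by rewrite sx (vI R) // mem_nth.
rewrite /head_ops -[exb (_ :: _) s]/(exb (_ ++ _) (apply_op s (OBin BAdd rJ (Reg rJ) (Lit 1)))).
set s1 := apply_op _ _.
have f1 : frame (pred1 rJ) s s1 by apply: frame_op => /=.
have j1 : nm s1 rJ 0 = j.+1 by rewrite /s1 /= /upd2 !eqxx /= ej addn1.
have l1 : loaded ars nc I s1.
  by apply: loaded_frame f1 l => -[[a b'] c]; rewrite /isdata /= regionE; case: a; lia.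
rewrite exb_cat; set s2 := exb (loads _ _ _) _.
have f2 : frame isVar s1 s2 by apply: frame_block; exact: loads_wr.
have l2 : loaded ars nc I s2.
  by apply: loaded_frame f2 l1 => r; rewrite /isdata /isVar; lia.
have j2 : nm s2 rJ 0 = j.+1 by have [-> _] := f2 rJ isT.
have v2 : {in xs, vars s2 =1 asg xs e.1}.
  move=> x hx; rewrite loads_ok // j1 add0n.
  case: l1 => _ /(_ R j hR hj)[_ ->] //.
  by rewrite -sx index_mem.
have [c1 c2 c3] := code_ops_temp xs s2.
rewrite exb_cat; set s3 := exb (code_ops _ _) s2 in c1 c2 c3 *.
have l3 := loaded_frame isTemp_data c3 l2.
have j3 : nm s3 rJ 0 = j.+1 by have [-> _] := c3 rJ isT.
rewrite exb_cat; set s4 := exb _ s3.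
have f4 : frame (fun r => isTemp r || (r == rW)) s3 s4 by apply: frame_block.
(* The code recomputed from the loaded variables equals the stored code of the tuple exactly for a
   consistent tuple, by injectivity of [tcode]. *)
have w4 : nm s4 rW 0 = consistent xs e.1.
  rewrite /s4 /exb /= /upd2 !regionE /= j3 c1.
  case: l3 => _ /(_ R j hR hj)[-> _] _ _.
  rewrite ((eq_in_map _ _ _).1 v2) /consistent -tcode_inj ?size_map //.
  rewrite -/e; move: (tcode _) (tcode _) => u v; by case: eqP; lia.
have v4 : vars s4 =1 vars s2.
  move=> x; rewrite (vars_frame _ f4) // (vars_frame _ c3) //.
have j4 : nm s4 rJ 0 = j.+1 by have [-> _] := f4 rJ isT.
have [d1 d2 d3] := code_ops_temp ys s4.
rewrite exb_cat; set s5 := exb (code_ops _ _) s4 in d1 d2 d3 *.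
have e5 : map (vars s4) ys = p.
  by apply/eq_in_map => y hy; rewrite v4 v2 //; apply: yx.
rewrite e5 in d1.
have w5 : nm s5 rW 0 = consistent xs e.1 by have [-> _] := d3 rW isT.
have j5 : nm s5 rJ 0 = j.+1 by have [-> _] := d3 rJ isT.
have n5 : nm s5 (rSeen m) =1 nm s (rSeen m).
  move=> i; have [-> _] := d3 (rSeen m) isT; have [-> _] := f4 (rSeen m) isT.
  by have [-> _] := c3 (rSeen m) isT; have [-> _] := f2 (rSeen m) isT;
    have [-> _] := f1 (rSeen m) isT.
have sp : size p = size ys by rewrite size_map.
have f6 : frame (fun r => [|| isTemp r, r == rW | r == rSeen m]) s5
   (exb [:: OLoad (rT 3) (rSeen m) (rT 2); OBin BSub (rT 5) (Lit 1) (rTr 3);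
      OBin BMul rW (Reg rW) (rTr 5); OBin BAdd (rT 3) (rTr 3) (Reg rW);
      OStore (rSeen m) (rT 2) (rT 3)] s5).
  by apply: frame_block; rewrite /= /isTemp /= !eqxx.
have wE : nm s5 rW 0 * (1 - nm s5 (rSeen m) (nm s5 (rT 2) 0)) = b :> nat.
  by rewrite w5 n5 d1 hs // /b; case: (consistent _ _) => //=; case: (_ \in _).
split.
- by have [-> _] := f6 rJ isT.
- by rewrite /exb /= /upd2 !regionE /= wE.
- move=> y hy; rewrite (vars_frame _ f6) // (vars_frame _ d3) // v4 v2 ?yx //.
  by rewrite asg_map.
- move=> q sq; rewrite /exb /= /upd2 !regionE /= !eqxx /= wE d1 n5 hs //.
  rewrite tcode_inj ?sq // /gen_step -/p -/b.
  case: eqP => [->|ne].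
    by rewrite /b; case: (consistent _ _) => /=; rewrite ?addn0 //; case E: (p \in g); rewrite ?mem_rcons ?mem_head ?E.
  rewrite n5 hs //; case: (b) => //; rewrite mem_rcons inE.
  by case: eqP.
Qed.

(** Reduces the table-filling loops to their bodies. Since rejected tuples run through the body as
    well, the body has to preserve the invariant for both values of the flag. *)
Lemma gen_loop_ok I R xs ys zs f m body Wb T (Inv : seq (seq nat) -> state K -> Prop) :
  wfgen ars R xs ys zs f -> valid ars I ->
  all Wb (cmd_wr body) ->
  (forall r, isdata r || (r == rJ) || (r == rSeen m) -> ~~ Wb r) ->
  (forall g s s', frame (head_wr m) s s' -> Inv g s -> Inv g s') ->
  (forall g s p (b : bool), loaded ars nc I s -> Inv g s -> nm s rW 0 = b ->
     {in ys, vars s =1 asg ys p} -> size p = size ys ->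
     exists2 s', exec0 body s T s' & Inv (if b then rcons g p else g) s') ->
  forall s, loaded ars nc I s -> Inv [::] s -> (forall i, nm s (rSeen m) i = 0) ->
  exists s', [/\ exec0 (gen_loop R xs ys m body) s
      ((bsize (head_ops R xs ys m) + T).+4 * (size (rl I R)).+1) s',
      Inv (gen (rl I R) xs ys) s' & loaded ars nc I s'].
Proof.
move=> wfg vI wrb dW stab stp s l iv sn.
case/and5P: (wfg) => hR /eqP sx /allP yx _ _.
set L := rl I R.
pose J j s := [/\ nm s rJ 0 = j, loaded ars nc I s,
  Inv (foldl (gen_step xs ys) [::] (take j L)) s
  & forall p, size p = size ys -> nm s (rSeen m) (tcode p) =
      (p \in foldl (gen_step xs ys) [::] (take j L))].
have hd r : isdata r -> ~~ head_wr m r.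
  case: r => [[a b] c]; rewrite /isdata /head_wr /isTemp /isVar /= !regionE.
  by case: a => [|[|[|[|[|[|[|a]]]]]]] //=.
pose s0 := apply_op s (OMov rJ (Lit 0)).
have f0 : frame (head_wr m) s s0.
  by apply: frame_op; rewrite /head_wr /= ?eqxx ?orbT.
have J0 : J 0 s0.
  rewrite /J take0 /=; split=> //.
  - exact: stab f0 iv.
  - by move=> p _; rewrite /upd2 regionE /= sn.
have [] := exec0_for (J := rJ) (N := rN R) (n := size L)
    (c := CSeq (Block (head_ops R xs ys m)) body)
    (T := bsize (head_ops R xs ys m) + T) (I := J) (s := s0) _ _ J0.
- by move=> j s1 [h1 [h2 _ _ _] _ _]; split=> //; exact: h2.
- move=> j s1 hj [h1 h2 h3 h4].
  have := head_ok wfg vI h2 h1 hj h4; cbv zeta.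
  set s2 := exb _ s1; move=> [g1 g2 g3 g4].
  have f2 : frame (head_wr m) s1 s2 by apply: frame_block; exact: head_ops_wr.
  have l2 := loaded_frame hd f2 h2.
  have [s3 x3 i3] := stp _ _ _ _ l2 (stab _ _ _ f2 h3) g2 g3 (ltac:(by rewrite size_map)).
  have f3 := exec0_frame x3 wrb.
  exists s3; first exact: exec0_seq (exec0_block _ _) x3.
  have e : foldl (gen_step xs ys) [::] (take j.+1 L) =
    gen_step xs ys (foldl (gen_step xs ys) [::] (take j L)) (nth ([::], 0%R) L j).
    by rewrite (take_nth ([::], 0%R)) // foldl_rcons.
  split.
  + by have [-> _] := f3 rJ (dW rJ isT).
  + by apply: loaded_frame f3 l2 => r h; apply: dW; rewrite h.
  + by rewrite e.
  + move=> p sp; have [-> _] := f3 (rSeen m) (dW (rSeen m) (ltac:(by rewrite eqxx !orbT))).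
    by rewrite e g4.
move=> s1 x1 [h1 h2 h3 h4]; exists s1; split=> //.
- refine (exec0_weak _ (exec0_seq (exec0_block [:: OMov rJ (Lit 0)] s) x1)).
  rewrite /bsize /=; lia.
- by move: h3; rewrite take_size.
Qed.

End Prep.

(** Starting the product from the flag instead of 1 makes a rejected tuple contribute zero. *)
Definition weigh f n : seq op := OKNat (rT 0) (Reg rW) :: mcode f n.

Definition sum_body f n zs m : cmd :=
  Block (weigh f n ++ code_ops (rT 2) zs ++
    [:: OKLoad (rT 1) (rMsg m) (rT 2); OKAdd (rT 1) (rT 1) (rT 0);
        OKStore (rMsg m) (rT 2) (rT 1)]).

Definition any_body f n zs m : cmd :=
  CSeq (Block (weigh f n)) (CSeq (nonzero_test (rT 6) (rT 0))
    (Block (code_ops (rT 2) zs ++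
      [:: OLoad (rT 3) (rMsg m) (rT 2); OBin BAdd (rT 3) (rTr 3) (rTr 6);
          OStore (rMsg m) (rT 2) (rT 3)]))).

Definition sum_cost f n zs m := bsize (weigh f n ++ code_ops (rT 2) zs ++
    [:: OKLoad (rT 1) (rMsg m) (rT 2); OKAdd (rT 1) (rT 1) (rT 0);
        OKStore (rMsg m) (rT 2) (rT 1)]).

Definition any_cost f n zs m := bsize (weigh f n) + (3 + bsize (code_ops (rT 2) zs ++
      [:: OLoad (rT 3) (rMsg m) (rT 2); OBin BAdd (rT 3) (rTr 3) (rTr 6);
          OStore (rMsg m) (rT 2) (rT 3)])).

Fixpoint stores k i (ys : seq nat) : seq op :=
  if ys is y :: ys' then OStore (rLC k i) (rT 4) (rV y) :: stores k i.+1 ys'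
  else [::].

(* Pushes the current tuple on the linked list of its key. If [rT 6] is 0 the
   list and the counter stay the same, and the new cell is garbage. *)
Definition push_ops ys zs k : seq op :=
  code_ops (rT 2) zs ++
  [:: OLoad (rT 3) (rHd k) (rT 2); OBin BAdd (rT 4) (Reg (rCnt k)) (Lit 1);
      OStore (rNx k) (rT 4) (rT 3)] ++ stores k 0 ys ++
  [:: OBin BSub (rT 5) (rTr 4) (rTr 3); OBin BMul (rT 5) (rTr 5) (rTr 6);
      OBin BAdd (rT 3) (rTr 3) (rTr 5); OStore (rHd k) (rT 2) (rT 3);
      OBin BAdd (rCnt k) (Reg (rCnt k)) (rTr 6)].

Definition level_body f n ys zs m : cmd :=
  CSeq (Block (weigh f n)) (CSeq (nonzero_test (rT 6) (rT 0))
    (Block (push_ops ys zs m))).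

Definition level_cost f n ys zs m :=
  bsize (weigh f n) + (3 + bsize (push_ops ys zs m)).

Fixpoint prep (t : tm) (n : nat) : cmd :=
  match t with
  | TMul f g => CSeq (prep f n) (prep g (n + nreg f))
  | TSum R xs ys f zs _ => CSeq (prep f n)
      (gen_loop R xs ys (n + nreg f) (sum_body f n zs (n + nreg f)))
  | TAny R xs ys f zs _ => CSeq (prep f n)
      (gen_loop R xs ys (n + nreg f) (any_body f n zs (n + nreg f)))
  | _ => Block [::]
  end.

Definition prep_level R xs ys f zs n : cmd :=
  CSeq (prep f n)
    (gen_loop R xs ys (n + nreg f) (level_body f n ys zs (n + nreg f))).

Definition prep_wr n n' : pred region := fun r =>
  [|| isTemp r, isVar r, r == rJ, r == rW
    | (6 < r.1.1 < 13) && (n <= r.1.2 < n')].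

Lemma weigh_wr f n : all isTemp (map op_wr (weigh f n)).
Proof. exact: mcode_wr. Qed.

Lemma sum_body_wr f n zs m :
  all (fun r => isTemp r || (r == rMsg m)) (cmd_wr (sum_body f n zs m)).
Proof.
have tw : subpred isTemp (fun r => isTemp r || (r == rMsg m)) by move=> r ->.
rewrite /sum_body /cmd_wr 2!map_cat 2!all_cat (sub_all_map tw (weigh_wr f n)).
by rewrite (sub_all_map tw (code_ops_wr zs (isT : isTemp (rT 2)))) /= eqxx.
Qed.

Lemma any_body_wr f n zs m :
  all (fun r => isTemp r || (r == rMsg m)) (cmd_wr (any_body f n zs m)).
Proof.
have tw : subpred isTemp (fun r => isTemp r || (r == rMsg m)) by move=> r ->.
rewrite /any_body /cmd_wr !map_cat !all_cat (sub_all_map tw (weigh_wr f n)).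
by rewrite (sub_all_map tw (code_ops_wr zs (isT : isTemp (rT 2)))) /= eqxx.
Qed.

Definition level_wr k : pred region := fun r =>
  isTemp r || ((8 < r.1.1 < 13) && (r.1.2 == k)).

Lemma stores_wr k i ys :
  all (fun r => (r.1.1 == 11) && (r.1.2 == k) && (i <= r.2))
    (map op_wr (stores k i ys)).
Proof.
elim: ys i => //= y ys ih i; rewrite eqxx leqnn /=.
by apply: sub_all_map (ih i.+1) => r /andP[-> /ltnW].
Qed.

Lemma push_ops_wr ys zs k : all (level_wr k) (map op_wr (push_ops ys zs k)).
Proof.
have tw : subpred isTemp (level_wr k) by move=> r; rewrite /level_wr => ->.
rewrite /push_ops !map_cat !all_cat (sub_all_map tw (code_ops_wr zs (isT : isTemp (rT 2)))).
rewrite (sub_all_map _ (stores_wr k 0 ys)) /=; first by rewrite /level_wr /= !eqxx ?orbT ?andbT.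
move=> [[a b] c] /=; rewrite /level_wr /= => /andP[/andP[/eqP-> ->] _].
by rewrite orbT.
Qed.

Lemma level_body_wr f n ys zs m : all (level_wr m) (cmd_wr (level_body f n ys zs m)).
Proof.
have tw : subpred isTemp (level_wr m) by move=> r; rewrite /level_wr => ->.
rewrite /level_body /cmd_wr !all_cat (sub_all_map tw (weigh_wr f n)).
by rewrite push_ops_wr.
Qed.

Lemma prep_wr_sub n1 n1' n2 n2' : n2 <= n1 -> n1' <= n2' ->
  subpred (prep_wr n1 n1') (prep_wr n2 n2').
Proof.
move=> h1 h2 r; rewrite /prep_wr.
by case/or4P=> [->|->|->|/orP[->|h]]; rewrite ?orbT //; apply/or4P/Or44/orP; right; lia.
Qed.

Lemma gen_loop_wr (W : pred region) R xs ys m body : subpred (head_wr m) W ->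
  all W (cmd_wr body) -> all W (cmd_wr (gen_loop R xs ys m body)).
Proof.
move=> h hb; rewrite /gen_loop /cmd_wr -/cmd_wr !all_cat hb.
rewrite (sub_all_map h (head_ops_wr R xs ys m)) /= !andbT.
by apply: h; rewrite /head_wr eqxx !orbT.
Qed.

#[local] Opaque gen_loop sum_body any_body level_body.

Lemma head_prep_wr n n' m : n <= m < n' -> subpred (head_wr m) (prep_wr n n').
Proof.
move=> h r; rewrite /head_wr /prep_wr.
by case/or4P=> [->|->|->|/orP[->|/eqP->]]; rewrite ?orbT //= h !orbT.
Qed.

Lemma prep_wrP t n : all (prep_wr n (n + nreg t)) (cmd_wr (prep t n)).
Proof.
elim: t n => //=.
- move=> f hf g hg n; rewrite all_cat; apply/andP; split.
    by apply: sub_all (hf n); apply: prep_wr_sub; lia.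
  by rewrite addnA; apply: sub_all (hg _); apply: prep_wr_sub; lia.
- move=> R xs ys f hf zs us n; rewrite all_cat; apply/andP; split.
    by apply: sub_all (hf n); apply: prep_wr_sub; lia.
  apply: gen_loop_wr; first by apply: head_prep_wr; lia.
  apply: sub_all (sum_body_wr _ _ _ _) => r /orP[h|/eqP->].
    by rewrite /prep_wr h.
  by rewrite /prep_wr /=; lia.
- move=> R xs ys f hf zs us n; rewrite all_cat; apply/andP; split.
    by apply: sub_all (hf n); apply: prep_wr_sub; lia.
  apply: gen_loop_wr; first by apply: head_prep_wr; lia.
  apply: sub_all (any_body_wr _ _ _ _) => r /orP[h|/eqP->].
    by rewrite /prep_wr h.
  by rewrite /prep_wr /=; lia.
Qed.

Lemma prep_level_wrP R xs ys f zs n :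
  all (prep_wr n (n + (nreg f).+1)) (cmd_wr (prep_level R xs ys f zs n)).
Proof.
rewrite /= all_cat; apply/andP; split.
  by apply: sub_all (prep_wrP f n); apply: prep_wr_sub; lia.
apply: gen_loop_wr; first by apply: head_prep_wr; lia.
apply: sub_all (level_body_wr _ _ _ _ _) => r; rewrite /level_wr /prep_wr.
by case/orP=> [->//|/andP[h /eqP->]]; apply/or4P/Or44/orP; right; lia.
Qed.

#[local] Transparent sum_body any_body level_body.

(** * Correctness of the filled tables and linked lists *)

Section PrepOk.
Variables (K : comNzSemiRingType) (ars : seq nat) (nc : nat).
Implicit Types (s : state K) (I : inst K).

Definition isz I := (\sum_(R < size ars) size (rl I R)).+1.

Lemma size_rl I R : R < size ars -> (size (rl I R)).+1 <= isz I.
Proof. by move=> h; rewrite /isz ltnS (bigD1 (Ordinal h)) //= leq_addr. Qed.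

(** A zero cell already means an empty sum, an empty count, an unseen tuple or an empty list. Hence
    the tables need no initialization, and keys that never occur get the right value. *)
Definition fresh n n' s := forall k, n <= k < n' -> forall i,
  [/\ nm s (rMsg k) i = 0, km s (rMsg k) i = 0%R, nm s (rSeen k) i = 0,
      nm s (rHd k) i = 0 & nm s (rCnt k) i = 0].

Lemma fresh_frame (W : pred region) n n' s s' :
  (forall r, (6 < r.1.1 < 13) && (n <= r.1.2 < n') -> ~~ W r) ->
  frame W s s' -> fresh n n' s -> fresh n n' s'.
Proof.
move=> hW f h k hk i; have [a b c d e] := h k hk i.
have [x1 x2] := f (rMsg k) (hW (rMsg k) hk); have [x3 _] := f (rSeen k) (hW (rSeen k) hk).
have [x4 _] := f (rHd k) (hW (rHd k) hk); have [x5 _] := f (rCnt k) (hW (rCnt k) hk).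
by rewrite x1 x2 x3 x4 x5.
Qed.

Lemma fresh_sub n1 n1' n2 n2' s : n1 <= n2 -> n2' <= n1' ->
  fresh n1 n1' s -> fresh n2 n2' s.
Proof. by move=> h1 h2 h k hk; apply: h; lia. Qed.

Lemma prep_wr_fresh n n' m m' r : n' <= m ->
  (6 < r.1.1 < 13) && (m <= r.1.2 < m') -> ~~ prep_wr n n' r.
Proof.
case: r => [[a b] c] h; rewrite /prep_wr /isTemp /isVar !regionE /=; lia.
Qed.

Lemma prep_wr_msg n n' m m' r : n' <= m \/ m' <= n -> ismsg m m' r -> ~~ prep_wr n n' r.
Proof.
case: r => [[a b] c] h; rewrite /ismsg /prep_wr /isTemp /isVar !regionE /=; lia.
Qed.

Lemma vars_temp s s' : frame isTemp s s' -> vars s' =1 vars s.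
Proof. exact: vars_frame. Qed.

Lemma weigh_ok I f n s (b : bool) : wf ars nc f -> valid ars I ->
  loaded ars nc I s -> ready I f n s -> nm s rW 0 = b ->
  km (exb (weigh f n) s) (rT 0) 0 = (b%:R * eval I f (vars s))%R.
Proof.
move=> wff vI l rd hb.
rewrite -[exb _ s]/(exb (mcode f n) (apply_op s (OKNat (rT 0) (Reg rW)))).
have fr : frame isTemp s (apply_op s (OKNat (rT 0) (Reg rW))) by apply: frame_op.
rewrite (mcode_ok wff vI).
- by congr (_ * _)%R; rewrite /= /upd2 !regionE /= hb.
- exact: loaded_frame (@isTemp_data) fr l.
- by apply: ready_frame fr rd => r; exact: isTemp_msg.
Qed.

Lemma keyed_vars ys zs z p s : {in ys, vars s =1 asg ys p} -> subl zs ys ->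
  (map (vars s) zs == z) = keyed ys zs z p.
Proof.
move=> h /allP sz; rewrite /keyed (_ : map (vars s) zs = map (asg ys p) zs) //.
by apply/eq_in_map => x /sz; exact: h.
Qed.

Lemma head_wr_msg n n' m r : ismsg n n' r -> ~~ head_wr m r.
Proof.
case: r => [[a b] c]; rewrite /ismsg /head_wr /isTemp /isVar !regionE /=; lia.
Qed.

Lemma sum_body_ok I R xs ys f zs n m s g p (b : bool) :
  wf ars nc f -> valid ars I -> wfgen ars R xs ys zs f ->
  loaded ars nc I s -> ready I f n s -> nm s rW 0 = b ->
  {in ys, vars s =1 asg ys p} ->
  (forall z, size z = size zs -> km s (rMsg m) (tcode z) =
     (\sum_(p <- g | keyed ys zs z p) eval I f (asg ys p))%R) ->
  exists2 s', exec0 (sum_body f n zs m) s (sum_cost f n zs m) s' &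
  forall z, size z = size zs -> km s' (rMsg m) (tcode z) =
     (\sum_(p <- if b then rcons g p else g | keyed ys zs z p) eval I f (asg ys p))%R.
Proof.
move=> wff vI /and5P[_ _ _ szy /allP fvy] l rd hb hp hk.
eexists; first exact: exec0_block.
move=> z sz; rewrite -/(exb _ _) exb_cat.
have fr := exb_temp s (weigh_wr f n).
have e1 := weigh_ok wff vI l rd hb.
set s1 := exb (weigh f n) s in fr e1 *.
have v1 := vars_temp fr.
rewrite exb_cat; have [c1 c2 c3] := code_ops_temp zs s1.
set s2 := exb (code_ops _ _) s1 in c1 c2 c3 *.
rewrite /exb /= /upd2 !regionE /= !eqxx /= c1 c2.
have [_ m2] := c3 (rMsg m) isT; have [_ m1] := fr (rMsg m) isT.
rewrite !m2 !m1 e1 (eq_map v1) tcode_inj ?size_map //.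
rewrite hk ?size_map // [z == _]eq_sym (keyed_vars _ hp) //.
have -> : eval I f (vars s) = eval I f (asg ys p).
  by apply: eval_fv => x hx; apply/hp/fvy.
have -> : km s (rMsg m) (tcode z) =
   (\sum_(p <- g | keyed ys zs z p) eval I f (asg ys p))%R by exact: hk.
have kz : keyed ys zs z p -> map (vars s) zs = z.
  by rewrite -(keyed_vars _ hp) // => /eqP.
case: (b); rewrite ?mul1r ?mul0r ?addr0.
  rewrite -cats1 big_cat /= (big_cons _ _ p) big_nil.
  by case: ifP => [h|_]; rewrite ?kz ?hk ?addr0.
by case: ifP => // h; rewrite kz ?hk.
Qed.

Lemma any_body_ok I R xs ys f zs n m s g p (b : bool) :
  wf ars nc f -> valid ars I -> wfgen ars R xs ys zs f ->
  loaded ars nc I s -> ready I f n s -> nm s rW 0 = b ->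
  {in ys, vars s =1 asg ys p} ->
  (forall z, size z = size zs -> nm s (rMsg m) (tcode z) =
     count (fun p => keyed ys zs z p && (eval I f (asg ys p) != 0%R)) g) ->
  exists2 s', exec0 (any_body f n zs m) s (any_cost f n zs m) s' &
  forall z, size z = size zs -> nm s' (rMsg m) (tcode z) =
     count (fun p => keyed ys zs z p && (eval I f (asg ys p) != 0%R))
       (if b then rcons g p else g).
Proof.
move=> wff vI /and5P[_ _ _ szy /allP fvy] l rd hb hp hk.
have fr := exb_temp s (weigh_wr f n).
have e1 := weigh_ok wff vI l rd hb.
have [s2 x2 [u2 f2]] := exec0_nonzero (rT 6) (rT 0) (exb (weigh f n) s).
eexists; first exact: exec0_seq (exec0_block _ _) (exec0_seq x2 (exec0_block _ _)).
move=> z sz; rewrite -/(exb _ _).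
set s1 := exb (weigh f n) s in fr e1 x2 u2 f2 *.
have f12 : frame isTemp s s2.
  by apply: frame_trans fr _; apply: frame_sub f2 => r /eqP->.
have v2 := vars_temp f12.
rewrite exb_cat; have [c1 c2] := code_ops_ok zs s2 (isT : 2 != 9).
set s3 := exb (code_ops _ _) s2 in c1 c2 *.
have [m2 _] := c2 (rMsg m) isT; have [m1 _] := f12 (rMsg m) isT.
have [t6 _] := c2 (rT 6) isT.
rewrite /exb /= /upd2 !regionE /= !eqxx /= c1 !m2 !m1 t6 u2 e1.
rewrite (eq_map v2) tcode_inj ?size_map //.
rewrite [z == _]eq_sym (keyed_vars _ hp) //.
have -> : eval I f (vars s) = eval I f (asg ys p).
  by apply: eval_fv => x hx; apply/hp/fvy.
have kz : keyed ys zs z p -> map (vars s) zs = z.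
  by rewrite -(keyed_vars _ hp) // => /eqP.
have -> : count (fun p => keyed ys zs z p && (eval I f (asg ys p) != 0%R))
    (if b then rcons g p else g) =
    count (fun p => keyed ys zs z p && (eval I f (asg ys p) != 0%R)) g
    + (keyed ys zs z p && (b%:R * eval I f (asg ys p) != 0)%R).
  case: (b); rewrite ?mul0r ?mul1r ?eqxx ?andbF ?addn0 //.
  by rewrite -cats1 count_cat /= addn0.
by case: ifP => [h|_]; rewrite ?kz // hk // addn0.
Qed.

(** Pointers decrease strictly along a list and 0 ends it, so [b] bounds every cell that the list
    visits. *)
Fixpoint chain s k (ys : seq nat) (b ptr : nat) (l : seq (seq nat)) : Prop :=
  if l is p :: l' then
    [/\ 0 < ptr <= b, forall i, i < size ys -> nm s (rLC k i) ptr = nth 0 p i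
      & chain s k ys ptr.-1 (nm s (rNx k) ptr) l']
  else ptr = 0.

(** A chain reads only cells up to its bound. A cell written above the counter, even one abandoned
    as garbage, cannot disturb an older list. *)
Lemma chain_eq s s' k ys b ptr l :
  (forall i j, j <= b -> nm s' (rLC k i) j = nm s (rLC k i) j) ->
  (forall j, j <= b -> nm s' (rNx k) j = nm s (rNx k) j) ->
  forall b', b <= b' -> chain s k ys b ptr l -> chain s' k ys b' ptr l.
Proof.
elim: l ptr b => //= p l ih ptr b h1 h2 b' lb [/andP[p0 pb] h4 h5].
split; first by rewrite p0 (leq_trans pb).
- by move=> i hi; rewrite h1 ?h4.
- rewrite h2 //; apply: (ih _ ptr.-1) => //.
  + by move=> i j hj; apply: h1; lia.
  + by move=> j hj; apply: h2; lia.
Qed.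

Lemma chain_le s k ys b ptr l : chain s k ys b ptr l -> ptr <= b.
Proof. by case: l => [->//|p l [/andP[]]]. Qed.

Definition isLC k i : pred region :=
  fun r => (r.1.1 == 11) && (r.1.2 == k) && (i <= r.2).

Lemma stores_frame k i ys s : frame (isLC k i) s (exb (stores k i ys) s).
Proof. by apply: frame_block; exact: stores_wr. Qed.

Lemma stores_new k i ys s i' : i' < size ys ->
  nm (exb (stores k i ys) s) (rLC k (i + i')) (nm s (rT 4) 0) = vars s (nth 0 ys i').
Proof.
elim: ys i s i' => //= y ys ih i s i' hi'.
set s1 := apply_op s (OStore (rLC k i) (rT 4) (rV y)).
rewrite -[exb _ _]/(exb (stores k i.+1 ys) s1).
case: i' hi' => [|i'] hi'.
  have fr : frame (isLC k i.+1) s1 (exb (stores k i.+1 ys) s1) by exact: stores_frame.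
  have [-> _] := fr (rLC k (i + 0)) (ltac:(by rewrite /isLC /= addn0 ltnn !andbF)).
  by rewrite addn0 /= /upd2 !eqxx.
by rewrite -[nm s (rT 4) 0]/(nm s1 (rT 4) 0) addnS -addSn ih.
Qed.

Lemma stores_old k i ys s i' j : j != nm s (rT 4) 0 ->
  nm (exb (stores k i ys) s) (rLC k i') j = nm s (rLC k i') j.
Proof.
elim: ys i s => //= y ys ih i s hj.
set s1 := apply_op s (OStore (rLC k i) (rT 4) (rV y)).
rewrite -[exb _ _]/(exb (stores k i.+1 ys) s1) ih //.
by rewrite /= /upd2 (negbTE hj) andbF.
Qed.

End PrepOk.

Section PrepOk2.
Variables (K : comNzSemiRingType) (ars : seq nat) (nc : nat).
Implicit Types (s : state K) (I : inst K).

(** The order is reversed because projections are pushed at the front. *)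
Definition linked I ys zs f m (g : seq (seq nat)) s := forall z, size z = size zs ->
  chain s m ys (nm s (rCnt m) 0) (nm s (rHd m) (tcode z))
    (rev [seq p <- g | (eval I f (asg ys p) != 0%R) && keyed ys zs z p]).

Lemma level_body_ok I R xs ys f zs n m s g p (b : bool) :
  wf ars nc f -> valid ars I -> wfgen ars R xs ys zs f -> uniq ys ->
  loaded ars nc I s -> ready I f n s -> nm s rW 0 = b ->
  {in ys, vars s =1 asg ys p} -> linked I ys zs f m g s ->
  exists2 s', exec0 (level_body f n ys zs m) s (level_cost f n ys zs m) s' &
    linked I ys zs f m (if b then rcons g p else g) s'.
Proof.
move=> wff vI /and5P[_ _ _ szy /allP fvy] uy l rd hb hp hk.
have fr := exb_temp s (weigh_wr f n).
have e1 := weigh_ok wff vI l rd hb.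
have [s2 x2 [u2 f2]] := exec0_nonzero (rT 6) (rT 0) (exb (weigh f n) s).
eexists; first exact: exec0_seq (exec0_block _ _) (exec0_seq x2 (exec0_block _ _)).
rewrite -/(exb _ _).
set s1 := exb (weigh f n) s in fr e1 x2 u2 f2 *.
have f12 : frame isTemp s s2.
  by apply: frame_trans fr _; apply: frame_sub f2 => r /eqP->.
rewrite /push_ops exb_cat; have [c1 c2] := code_ops_ok zs s2 (isT : 2 != 9).
set s3 := exb (code_ops _ _) s2 in c1 c2 *.
have f3 : frame isTemp s s3.
  by apply: frame_trans f12 _; apply: frame_sub c2 => r /orP[]/eqP->.
have v3 := vars_temp f3.
have t6 : nm s3 (rT 6) 0 = (b%:R * eval I f (asg ys p) != 0)%R.
  have [-> _] := c2 (rT 6) isT; rewrite u2 e1.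
  by rewrite (@eval_fv _ I f _ (asg ys p)) // => x hx; apply/hp/fvy.
set key := map (vars s) zs.
have t2 : nm s3 (rT 2) 0 = tcode key by rewrite c1 (eq_map (vars_temp f12)).
have hh := f3 (rHd m) isT; have hn := f3 (rNx m) isT; have hc := f3 (rCnt m) isT.
have hl i := f3 (rLC m i) isT.
rewrite exb_cat.
set s4 := exb [:: OLoad _ _ _; _; _] s3.
have t34 : nm s4 (rT 3) 0 = nm s (rHd m) (tcode key).
  by rewrite /s4 /exb /= /upd2 !regionE /= t2 hh.1.
have t44 : nm s4 (rT 4) 0 = (nm s (rCnt m) 0).+1.
  by rewrite /s4 /exb /= /upd2 !regionE /= hc.1 addn1.
have t24 : nm s4 (rT 2) 0 = tcode key by [].
have t64 : nm s4 (rT 6) 0 = nm s3 (rT 6) 0 by [].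
have n4 j : nm s4 (rNx m) j = if j == (nm s (rCnt m) 0).+1 then nm s (rHd m) (tcode key)
    else nm s (rNx m) j.
  by rewrite /s4 /exb /= /upd2 !regionE /= !eqxx /= hc.1 addn1 t2 hh.1 hn.1.
have h4 j : nm s4 (rHd m) j = nm s (rHd m) j.
  by rewrite /s4 /exb /= /upd2 !regionE /= hh.1.
have k4 j : nm s4 (rCnt m) j = nm s (rCnt m) j.
  by rewrite /s4 /exb /= /upd2 !regionE /= hc.1.
have l4 i j : nm s4 (rLC m i) j = nm s (rLC m i) j.
  by rewrite /s4 /exb /= /upd2 !regionE /= (hl i).1.
have v4 : vars s4 =1 vars s by move=> x; rewrite -v3.
rewrite exb_cat.
have f5 : frame (isLC m 0) s4 (exb (stores m 0 ys) s4) by exact: stores_frame.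
have lnew i : i < size ys -> nm (exb (stores m 0 ys) s4) (rLC m i) (nm s (rCnt m) 0).+1 = nth 0 p i.
  move=> hi; rewrite -t44 -[i in LHS]add0n stores_new // v4 hp ?mem_nth //.
  by rewrite /asg index_uniq.
have lold i j : j != (nm s (rCnt m) 0).+1 ->
    nm (exb (stores m 0 ys) s4) (rLC m i) j = nm s (rLC m i) j.
  by move=> hj; rewrite stores_old ?t44 // l4.
set s5 := exb (stores _ _ _) s4 in f5 lnew lold *.
have [n5 _] := f5 (rNx m) isT; have [h5 _] := f5 (rHd m) isT.
have [k5 _] := f5 (rCnt m) isT; have [t25 _] := f5 (rT 2) isT.
have [t35 _] := f5 (rT 3) isT; have [t45 _] := f5 (rT 4) isT.
have [t65 _] := f5 (rT 6) isT.
set s6 := exb _ s5.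
(* The flag decides whether head and counter move. If it is 0, the cell just written stays above the
   counter and the next push overwrites it. *)
pose w : nat := (b && (eval I f (asg ys p) != 0%R)).
have ew : nm s5 (rT 6) 0 = w.
  rewrite t65 t64 t6 /w; case: (b); rewrite ?mul1r // mul0r eqxx //.
set cnt := nm s (rCnt m) 0 in t44 n4 lnew lold *.
have n6 j : nm s6 (rNx m) j = if j == cnt.+1 then nm s (rHd m) (tcode key)
    else nm s (rNx m) j.
  by rewrite /s6 /exb /= /upd2 !regionE /= n5 n4.
have l6 i j : nm s6 (rLC m i) j = nm s5 (rLC m i) j.
  by rewrite /s6 /exb /= /upd2 !regionE /=.
have k6 : nm s6 (rCnt m) 0 = cnt + w.
  by rewrite /s6 /exb /= /upd2 !regionE /= !eqxx /= k5 k4 ew.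
have h6 j : nm s6 (rHd m) j = if j == tcode key then
    nm s (rHd m) (tcode key) + (cnt.+1 - nm s (rHd m) (tcode key)) * w
    else nm s (rHd m) j.
  by rewrite /s6 /exb /= /upd2 !regionE /= !eqxx /= t25 t24 t35 t34 t45 t44 ew h5 h4.
clearbody s6.
have skey : size key = size zs by rewrite size_map.
have old ptr b' l' : cnt <= b' -> chain s m ys cnt ptr l' -> chain s6 m ys b' ptr l'.
  apply: chain_eq.
  - by move=> i j hj; rewrite l6 lold //; lia.
  - by move=> j hj; rewrite n6; case: eqP => //; lia.
have kz z : (z == key) = keyed ys zs z p.
  by rewrite eq_sym; exact: keyed_vars hp szy.
move=> z sz; rewrite k6 h6 tcode_inj ?sz ?skey //.
have hz := hk z sz; have hkey := hk key skey.
case: (eqVneq w 0) => [w0|wn].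
  rewrite w0 muln0 !addn0.
  have -> : (if z == key then nm s (rHd m) (tcode key) else nm s (rHd m) (tcode z)) =
    nm s (rHd m) (tcode z) by case: eqP => [->|].
  have -> : [seq p0 <- if b then rcons g p else g |
     (eval I f (asg ys p0) != 0%R) && keyed ys zs z p0] =
     [seq p0 <- g | (eval I f (asg ys p0) != 0%R) && keyed ys zs z p0].
    move: w0; rewrite /w; case: (b) => //= /eqP; rewrite eqb0 => /negbTE e.
    by rewrite filter_rcons e.
  exact: old.
have [hb1 ev] : b /\ (eval I f (asg ys p) != 0%R).
  by move: wn; rewrite /w; case: (b) => //; case: (eval I f (asg ys p) != 0%R).
have -> : w = 1 by rewrite /w hb1 ev.
rewrite hb1 filter_rcons ev /= -kz addn1 muln1.
case: eqP => [ez|_]; last by apply: old.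
(* The old head is at most the counter, so the truncated subtraction in [push_ops] is exact here. *)
have le := chain_le hkey.
rewrite rev_rcons /=; have -> : nm s (rHd m) (tcode key) + (cnt.+1 - nm s (rHd m) (tcode key)) = cnt.+1.
  by rewrite subnKC // (leq_trans le).
split; first by rewrite ltnSn.
- by move=> i hi; rewrite l6 lnew.
- by rewrite n6 eqxx /= ez; apply: old.
Qed.

Lemma size_isz I R c : R < size ars -> c * (size (rl I R)).+1 <= c * isz ars I.
Proof. by move=> h; rewrite leq_mul2l (size_rl I h) orbT. Qed.

Lemma body_wr_data m r : isdata r || (r == rJ) || (r == rSeen m) ->
  ~~ (isTemp r || (r == rMsg m)).
Proof. by case: r => [[a b] c]; rewrite /isdata /isTemp !regionE /=; lia. Qed.

Lemma level_wr_data m r : isdata r || (r == rJ) || (r == rSeen m) -> ~~ level_wr m r.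
Proof. by case: r => [[a b] c]; rewrite /isdata /level_wr /isTemp !regionE /=; lia. Qed.

Lemma head_ready I m f n s s' : frame (head_wr m) s s' -> ready I f n s -> ready I f n s'.
Proof. by apply: ready_frame => r; exact: head_wr_msg. Qed.

Lemma isT_ready I f n s s' : frame (fun r => isTemp r || (r == rMsg (n + nreg f))) s s' ->
  ready I f n s -> ready I f n s'.
Proof.
apply: ready_frame => -[[a b] c]; rewrite /ismsg /isTemp !regionE /=; lia.
Qed.

(** Each [TSum] or [TAny] costs one scan of one relation once the tables of its body are ready. The
    number of scans, and hence the constant, depends on the term only. *)
Lemma prep_ok t n : wf ars nc t -> exists c, forall I s, valid ars I ->
  loaded ars nc I s -> fresh n (n + nreg t) s ->
  exists s', [/\ exec0 (prep t n) s (c * isz ars I) s', loaded ars nc I s'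
    & ready I t n s'].
Proof.
elim: t n.
(* These constructors own no table. *)
1,3,4,5,6: by move=> *; exists 0 => I s *; exists s; split=> //; rewrite mul0n; exact: (exec0_block [::]).
- move=> f hf g hg n /andP[wff wfg].
  have [c1 h1] := hf n wff; have [c2 h2] := hg (n + nreg f) wfg.
  exists (c1 + c2) => I s vI l fr.
  have frf : fresh n (n + nreg f) s by apply: fresh_sub fr => /=; lia.
  have [s1 [x1 l1 r1]] := h1 I s vI l frf.
  have f1 := exec0_frame x1 (prep_wrP f n).
  have [] := h2 I s1 vI l1.
    have frg : fresh (n + nreg f) (n + nreg f + nreg g) s by apply: fresh_sub fr => /=; lia.
    by apply: fresh_frame f1 frg => r; exact: prep_wr_fresh.
  move=> s2 [x2 l2 r2].
  have f2 := exec0_frame x2 (prep_wrP g _).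
  exists s2; split=> //; first by rewrite mulnDl; exact: exec0_seq x2.
  split=> //; apply: ready_frame f2 r1 => r; apply: prep_wr_msg; lia.
- move=> R xs ys f hf zs us n /and3P[wff wfg _].
  have [c1 h1] := hf n wff.
  set m := n + nreg f.
  exists (c1 + (bsize (head_ops R xs ys m) + sum_cost f n zs m).+4) => I s vI l fr.
  have frf : fresh n (n + nreg f) s by apply: fresh_sub fr => /=; lia.
  have [s1 [x1 l1 r1]] := h1 I s vI l frf.
  have f1 := exec0_frame x1 (prep_wrP f n).
  have fr1 : fresh m m.+1 s1.
    have frm : fresh m m.+1 s by apply: fresh_sub fr; rewrite /m /=; lia.
    by apply: fresh_frame f1 frm => r; exact: prep_wr_fresh.
  have fm i := fr1 m (ltac:(by rewrite leqnn ltnSn)) i.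
  pose Inv g s := (forall z, size z = size zs -> km s (rMsg m) (tcode z) =
     (\sum_(p <- g | keyed ys zs z p) eval I f (asg ys p))%R) /\ ready I f n s.
  have stab g s' s'' : frame (head_wr m) s' s'' -> Inv g s' -> Inv g s''.
    move=> fr' [hk rd]; split; last exact: head_ready fr' rd.
    by move=> z sz; have [_ ->] := fr' (rMsg m) isT; exact: hk.
  have stp g s' p (b : bool) : loaded ars nc I s' -> Inv g s' -> nm s' rW 0 = b ->
     {in ys, vars s' =1 asg ys p} -> size p = size ys ->
     exists2 s'', exec0 (sum_body f n zs m) s' (sum_cost f n zs m) s'' & Inv (if b then rcons g p else g) s''.
    move=> l' [hk rd] hb hp sp.
    have [s2 x2 h2] := sum_body_ok wff vI wfg l' rd hb hp hk.
    exists s2; first exact: x2.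
    by split=> //; apply: isT_ready (exec0_frame x2 (sum_body_wr _ _ _ _)) rd.
  have inv0 : Inv [::] s1.
    by split=> // z sz; rewrite big_nil; have [_ ->] := fm (tcode z).
  have sn i : nm s1 (rSeen m) i = 0 by have [_ _ ->] := fm i.
  have [s2 [x2 [i2 r2] l2]] := gen_loop_ok wfg vI (sum_body_wr f n zs m) (@body_wr_data m) stab stp l1 inv0 sn.
  exists s2; split=> //.
  rewrite mulnDl; apply: exec0_seq x1 (exec0_weak _ x2).
  by apply: size_isz; case/and5P: wfg.
- move=> R xs ys f hf zs us n /and3P[wff wfg _].
  have [c1 h1] := hf n wff.
  set m := n + nreg f.
  exists (c1 + (bsize (head_ops R xs ys m) + any_cost f n zs m).+4) => I s vI l fr.
  have frf : fresh n (n + nreg f) s by apply: fresh_sub fr => /=; lia.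
  have [s1 [x1 l1 r1]] := h1 I s vI l frf.
  have f1 := exec0_frame x1 (prep_wrP f n).
  have fr1 : fresh m m.+1 s1.
    have frm : fresh m m.+1 s by apply: fresh_sub fr; rewrite /m /=; lia.
    by apply: fresh_frame f1 frm => r; exact: prep_wr_fresh.
  have fm i := fr1 m (ltac:(by rewrite leqnn ltnSn)) i.
  pose Inv g s := (forall z, size z = size zs -> nm s (rMsg m) (tcode z) =
     count (fun p => keyed ys zs z p && (eval I f (asg ys p) != 0%R)) g) /\ ready I f n s.
  have stab g s' s'' : frame (head_wr m) s' s'' -> Inv g s' -> Inv g s''.
    move=> fr' [hk rd]; split; last exact: head_ready fr' rd.
    by move=> z sz; have [-> _] := fr' (rMsg m) isT; exact: hk.
  have stp g s' p (b : bool) : loaded ars nc I s' -> Inv g s' -> nm s' rW 0 = b ->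
     {in ys, vars s' =1 asg ys p} -> size p = size ys ->
     exists2 s'', exec0 (any_body f n zs m) s' (any_cost f n zs m) s'' & Inv (if b then rcons g p else g) s''.
    move=> l' [hk rd] hb hp sp.
    have [s2 x2 h2] := any_body_ok wff vI wfg l' rd hb hp hk.
    exists s2; first exact: x2.
    by split=> //; apply: isT_ready (exec0_frame x2 (any_body_wr _ _ _ _)) rd.
  have inv0 : Inv [::] s1.
    by split=> // z sz; have [-> _] := fm (tcode z).
  have sn i : nm s1 (rSeen m) i = 0 by have [_ _ ->] := fm i.
  have [s2 [x2 [i2 r2] l2]] := gen_loop_ok wfg vI (any_body_wr f n zs m) (@body_wr_data m) stab stp l1 inv0 sn.
  exists s2; split=> //.
  rewrite mulnDl; apply: exec0_seq x1 (exec0_weak _ x2).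
  by apply: size_isz; case/and5P: wfg.
Qed.

Lemma prep_level_ok R xs ys f zs n : wf ars nc f -> wfgen ars R xs ys zs f ->
  uniq ys -> exists c, forall I s, valid ars I ->
  loaded ars nc I s -> fresh n (n + nreg f).+1 s ->
  exists s', [/\ exec0 (prep_level R xs ys f zs n) s (c * isz ars I) s',
    loaded ars nc I s'
    & linked I ys zs f (n + nreg f) (gen (rl I R) xs ys) s'].
Proof.
move=> wff wfg uy.
have [c1 h1] := prep_ok n wff.
set m := n + nreg f.
exists (c1 + (bsize (head_ops R xs ys m) + level_cost f n ys zs m).+4) => I s vI l fr.
have frf : fresh n (n + nreg f) s by apply: fresh_sub fr; lia.
have [s1 [x1 l1 r1]] := h1 I s vI l frf.
have f1 := exec0_frame x1 (prep_wrP f n).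
have fr1 : fresh m m.+1 s1.
  have frm : fresh m m.+1 s by apply: fresh_sub fr; rewrite /m; lia.
  by apply: fresh_frame f1 frm => r; exact: prep_wr_fresh.
have fm i := fr1 m (ltac:(by rewrite leqnn ltnSn)) i.
  pose Inv g s := linked I ys zs f m g s /\ ready I f n s.
  have stab g s' s'' : frame (head_wr m) s' s'' -> Inv g s' -> Inv g s''.
    move=> fr' [hk rd]; split; last exact: head_ready fr' rd.
    move=> z sz; have [-> _] := fr' (rHd m) isT; have [-> _] := fr' (rCnt m) isT.
    apply: chain_eq (hk z sz) => //.
    + by move=> i j _; have [-> _] := fr' (rLC m i) isT.
    + by move=> j _; have [-> _] := fr' (rNx m) isT.
  have stp g s' p (b : bool) : loaded ars nc I s' -> Inv g s' -> nm s' rW 0 = b ->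
     {in ys, vars s' =1 asg ys p} -> size p = size ys ->
     exists2 s'', exec0 (level_body f n ys zs m) s' (level_cost f n ys zs m) s'' & Inv (if b then rcons g p else g) s''.
    move=> l' [hk rd] hb hp sp.
    have [s2 x2 h2] := level_body_ok wff vI wfg uy l' rd hb hp hk.
    exists s2; first exact: x2.
    split=> //; apply: ready_frame (exec0_frame x2 (level_body_wr _ _ _ _ _)) rd => r.
    by case: r => [[u v] w]; rewrite /ismsg /level_wr /isTemp /=; lia.
  have inv0 : Inv [::] s1.
    by split=> // z sz /=; have [_ _ _ -> _] := fm (tcode z).
  have sn i : nm s1 (rSeen m) i = 0 by have [_ _ ->] := fm i.
  have [s2 [x2 [i2 r2] l2]] := gen_loop_ok wfg vI (level_body_wr f n ys zs m) (@level_wr_data m) stab stp l1 inv0 sn.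
  exists s2; split=> //.
  rewrite mulnDl; apply: exec0_seq x1 (exec0_weak _ x2).
  by apply: size_isz; case/and5P: wfg.
Qed.

End PrepOk2.

(** * Loading the input *)

Fixpoint read_cols R i a : cmd :=
  if a is a'.+1 then
    CSeq (CRead (rT 1)) (CSeq (Block [:: OStore (rCol R i) rJ (rT 1);
       OBin BAdd (rT 9) (rTr 2) (rTr 1); OBin BMul (rT 9) (rTr 9) (rTr 9);
       OBin BAdd (rT 2) (rTr 9) (rTr 2)]) (read_cols R i.+1 a'))
  else Block [::].

(** The code of the tuple is computed while its components are read. The value is added to its cell
    rather than stored there, so that the cell ends as [lkp]. *)
Definition load_entry R a : cmd :=
  CSeq (Block [:: OBin BAdd rJ (Reg rJ) (Lit 1); OMov (rT 2) (Lit 0)])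
  (CSeq (read_cols R 0 a) (CSeq (CKRead (rT 1))
    (Block [:: OStore (rCode R) rJ (rT 2); OKLoad (rT 0) (rVal R) (rT 2);
       OKAdd (rT 0) (rT 0) (rT 1); OKStore (rVal R) (rT 2) (rT 0)]))).

Definition load_rel R a : cmd :=
  CSeq (CRead (rN R)) (CSeq (Block [:: OMov rJ (Lit 0)])
    (CWhile rJ (rN R) (load_entry R a))).

Fixpoint load_rels R (ars : seq nat) : cmd :=
  if ars is a :: ars' then CSeq (load_rel R a) (load_rels R.+1 ars')
  else Block [::].

Fixpoint load_csts i n : cmd :=
  if n is n'.+1 then CSeq (CRead (rC i)) (load_csts i.+1 n') else Block [::].

(** Constant 0 is the distinguished symbol 1, which the input word does not contain. *)
Definition load ars nc : cmd :=
  CSeq (load_rels 0 ars) (CSeq (load_csts 1 nc) (Block [:: OMov (rC 0) (Lit 1)])).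

Definition load_wr R R' : pred region := fun r =>
  [|| isTemp r, r == rJ | (2 < r.1.1 < 7) && (R <= r.1.2 < R')].

Lemma read_cols_wr R i a :
  all (fun r => isTemp r || ((r.1.1 == 3) && (r.1.2 == R) && (i <= r.2)))
    (cmd_wr (read_cols R i a)).
Proof.
elim: a i => //= a ih i; rewrite !eqxx leqnn /=.
apply: sub_all (ih i.+1) => r /orP[->//|/andP[-> /ltnW->]].
by rewrite orbT.
Qed.

Lemma load_rel_wr R a : all (load_wr R R.+1) (cmd_wr (load_rel R a)).
Proof.
rewrite /= all_cat /= (@sub_all _ _ _ _ _ (read_cols_wr R 0 a)).
  by rewrite /load_wr /= leqnn ltnSn.
move=> r; rewrite /load_wr; case/orP=> [->//|/andP[/andP[/eqP-> /eqP->] _]].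
by rewrite /= leqnn ltnSn !orbT.
Qed.

#[local] Opaque load_rel.

Lemma load_rels_wr R ars : all (load_wr R (R + size ars)) (cmd_wr (load_rels R ars)).
Proof.
elim: ars R => //= a ars ih R; rewrite all_cat; apply/andP; split.
  apply: sub_all (load_rel_wr R a) => r; rewrite /load_wr.
  by case/or3P=> [->|->|h]; rewrite ?orbT //; apply/or3P/Or33; lia.
apply: sub_all (ih R.+1) => r; rewrite /load_wr.
by case/or3P=> [->|->|h]; rewrite ?orbT //; apply/or3P/Or33; lia.
Qed.

#[local] Transparent load_rel.

Section Load.
Variable K : comNzSemiRingType.
Implicit Types (s : state K) (I : inst K) (L : seq (seq nat * K)).

Definition rel_word L : seq (token K) :=
  inl (size L) :: flatten [seq enc_entry x | x <- L].

Definition word (ars : seq nat) nc I : seq (token K) :=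
  flatten [seq rel_word (rl I R) | R <- iota 0 (size ars)] ++
  [seq inl (cv I c) | c <- iota 1 nc].

Lemma read_cols_ok R i t s w : ip s = [seq inl v | v <- t] ++ w ->
  exists2 s', exec0 (read_cols R i (size t)) s (7 * size t) s' &
  [/\ ip s' = w,
     nm s' (rT 2) 0 = foldl (fun c v => (c + v) * (c + v) + c) (nm s (rT 2) 0) t,
     forall k, k < size t -> nm s' (rCol R (i + k)) (nm s rJ 0) = nth 0 t k
   & forall k j, j != nm s rJ 0 -> nm s' (rCol R k) j = nm s (rCol R k) j].
Proof.
elim: t i s => [|v t ih] i s /= e.
  exists s => //; exact: (exec0_block [::]).
have x1 := exec0_read (rT 1) e; set s1 := State _ _ _ in x1.
set os := [:: OStore (rCol R i) rJ (rT 1);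
       OBin BAdd (rT 9) (rTr 2) (rTr 1); OBin BMul (rT 9) (rTr 9) (rTr 9);
       OBin BAdd (rT 2) (rTr 9) (rTr 2)].
have [s2 x2 [h1 h2 h3 h4]] := ih i.+1 (exb os s1) erefl.
have f2 := exec0_frame x2 (read_cols_wr R i.+1 (size t)).
exists s2.
  rewrite mulnS -[7]/(1 + 6) -addnA.
  exact: exec0_seq x1 (exec0_seq (exec0_block os s1) x2).
have ej : nm (exb os s1) rJ 0 = nm s rJ 0 by [].
split=> //.
- case=> [|k] hk; last by rewrite addnS -addSn -ej h3.
  have [-> _] := f2 (rCol R (i + 0)) (ltac:(by rewrite /= addn0 ltnn !andbF)).
  by rewrite addn0 /exb /= /upd2 !regionE /= !eqxx.
- move=> k j hj; rewrite h4 ?ej // /exb /= /upd2 !regionE /= (_ : j == nm s rJ 0 = false) ?andbF //.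
  exact: negbTE.
Qed.

Definition loaded_rel a L R s :=
  [/\ nm s (rN R) 0 = size L,
      forall j, j < size L -> nm s (rCode R) j.+1 = tcode (nth ([::], 0%R) L j).1 /\
        forall i, i < a -> nm s (rCol R i) j.+1 = nth 0 (nth ([::], 0%R) L j).1 i
    & forall t, size t = a -> km s (rVal R) (tcode t) = lkp L t].

Lemma lkp_rcons L e t : lkp (rcons L e) t =
  (lkp L t + if e.1 == t then e.2 else 0)%R.
Proof. by rewrite /lkp -cats1 big_cat /= big_cons big_nil; case: ifP; rewrite ?addr0. Qed.

Lemma load_rel_ok R a L s w : (forall e, e \in L -> size e.1 = a) ->
  ip s = rel_word L ++ w -> (forall i, km s (rVal R) i = 0%R) ->
  exists2 s', exec0 (load_rel R a) s ((7 * a + 13).+2 * (size L).+1) s' &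
  ip s' = w /\ loaded_rel a L R s'.
Proof.
move=> ha e z.
have x1 := exec0_read (rN R) e; set s1 := State _ _ _ in x1.
set s2 := exb [:: OMov rJ (Lit 0)] s1.
pose Inv j s := [/\ nm s rJ 0 = j, nm s (rN R) 0 = size L,
   ip s = flatten [seq enc_entry x | x <- drop j L] ++ w,
   forall j', j' < j -> nm s (rCode R) j'.+1 = tcode (nth ([::], 0%R) L j').1 /\
        forall i, i < a -> nm s (rCol R i) j'.+1 = nth 0 (nth ([::], 0%R) L j').1 i
   & forall t, size t = a -> km s (rVal R) (tcode t) = lkp (take j L) t].
have I0 : Inv 0 s2.
  split=> //.
  - by rewrite /s2 /exb /= /upd2 !regionE /= !eqxx.
  - by rewrite drop0.
  - by move=> t _; rewrite take0 /lkp big_nil /s2 /exb /= z.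
have [|j s3 hj [h1 h2 h3 h4 h5]|s3 x3 [h1 h2 h3 h4 h5]] :=
  exec0_for (J := rJ) (N := rN R) (n := size L) (c := load_entry R a)
    (T := 2 + (7 * a + (1 + 10))) (I := Inv) _ _ I0; first by move=> j s3 [].
- set x := nth ([::], 0%R) L j.
  have xL : x \in L by rewrite mem_nth.
  have sx := ha x xL.
  set os := [:: OBin BAdd rJ (Reg rJ) (Lit 1); OMov (rT 2) (Lit 0)].
  set s4 := exb os s3.
  have j4 : nm s4 rJ 0 = j.+1 by rewrite /s4 /exb /= /upd2 /= h1 addn1.
  have e4 : ip s4 = [seq inl v | v <- x.1] ++ (inr x.2 :: flatten [seq enc_entry x | x <- drop j.+1 L] ++ w).
    rewrite /s4 /exb /= h3 (drop_nth ([::], 0%R) hj) /= /enc_entry -!catA; by [].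
  have [s5 x5 [g1 g2 g3 g4]] := read_cols_ok R 0 e4.
  have f5 := exec0_frame x5 (read_cols_wr R 0 (size x.1)).
  have x6 := exec0_kread (rT 1) g1; set s6 := State _ _ _ in x6.
  set os7 := [:: OStore (rCode R) rJ (rT 2); OKLoad (rT 0) (rVal R) (rT 2);
       OKAdd (rT 0) (rT 0) (rT 1); OKStore (rVal R) (rT 2) (rT 0)].
  have j5 : nm s5 rJ 0 = j.+1 by have [-> _] := f5 rJ isT.
  have t5 : nm s5 (rT 2) 0 = tcode x.1 by rewrite g2.
  exists (exb os7 s6).
    rewrite -sx.
    exact: exec0_seq (exec0_block os s3) (exec0_seq x5 (exec0_seq x6 (exec0_block os7 s6))).
  split.
  + by rewrite /exb /= /upd2 /=.
  + by rewrite /exb /= /upd2 !regionE /= -h2; have [-> _] := f5 (rN R) isT.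
  + by [].
  + move=> j' hj'; split.
      rewrite /exb /= /upd2 !regionE /= !eqxx /= j5 t5.
      case: eqP => [[->] //|ne].
      have [-> _] := f5 (rCode R) isT; rewrite /s4 /exb /= /upd2 !regionE /=.
      by have [] := h4 j' (ltac:(lia)).
    move=> i hi; rewrite /exb /= /upd2 !regionE /=.
    have [e1|ne] := eqVneq j' j.
      by rewrite e1 -j4 -[i in LHS]add0n g3 ?sx.
    rewrite g4 ?j4 ?eqSS // /s4 /exb /= /upd2 !regionE /=.
    by have [_ ->] := h4 j' (ltac:(lia)).
  + move=> t st; rewrite /exb /= /upd2 !regionE /= !eqxx /= t5.
    have [_ k5] := f5 (rVal R) isT.
    rewrite (take_nth ([::], 0%R)) // lkp_rcons -/x tcode_inj ?st ?sx //.
    rewrite eq_sym; case: eqP => [<-|_].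
      by rewrite k5 /s4 /exb /= h5.
    by rewrite k5 /s4 /exb /= h5 // addr0.
exists s3.
  apply: (exec0_weak _ (exec0_seq x1 (exec0_seq (exec0_block [:: OMov rJ (Lit 0)] s1) x3))).
  by rewrite /bsize /=; lia.
split; first by rewrite h3 drop_size.
split=> //.
by move=> t st; rewrite h5 // take_size.
Qed.

Lemma loaded_rel_frame W a L R s s' :
  (forall r, (2 < r.1.1 < 7) && (r.1.2 == R) -> ~~ W r) -> frame W s s' ->
  loaded_rel a L R s -> loaded_rel a L R s'.
Proof.
move=> hW f [h1 h2 h3].
have e r (h : (2 < r.1.1 < 7) && (r.1.2 == R)) := f r (hW r h).
split.
- by have [-> _] := e (rN R) (eqxx R).
- move=> j hj; have [a1 a2] := h2 j hj; split.
    by have [-> _] := e (rCode R) (eqxx R).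
  by move=> i hi; have [-> _] := e (rCol R i) (eqxx R); exact: a2.
- by move=> t st; have [_ ->] := e (rVal R) (eqxx R); exact: h3.
Qed.

Lemma load_rels_ok ars R0 I s w :
  (forall R, R < size ars -> forall e, e \in rl I (R0 + R) -> size e.1 = nth 0 ars R) ->
  ip s = flatten [seq rel_word (rl I R) | R <- iota R0 (size ars)] ++ w ->
  (forall R i, R0 <= R -> km s (rVal R) i = 0%R) ->
  exists2 s', exec0 (load_rels R0 ars) s
     (\sum_(R < size ars) (7 * nth 0 ars R + 13).+2 * (size (rl I (R0 + R))).+1) s' &
  ip s' = w /\ forall R, R < size ars -> loaded_rel (nth 0 ars R) (rl I (R0 + R)) (R0 + R) s'.
Proof.
elim: ars R0 s => [|a ars ih] R0 s hv e z.
  exists s; last by split=> //; rewrite e.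
  by rewrite big_ord0; exact: (exec0_block [::]).
move: e => /=; rewrite -catA => e.
have hv0 e0 : e0 \in rl I R0 -> size e0.1 = a.
  by move=> h; apply: (hv 0) => //; rewrite addn0.
have [s1 x1 [i1 l1]] := load_rel_ok hv0 e
  (fun i => z R0 i (leqnn R0)).
have f1 := exec0_frame x1 (load_rel_wr R0 a).
have [||s2 x2 [i2 l2]] := ih R0.+1 s1 _ i1.
- by move=> R hR e0; rewrite addSnnS; exact: (hv R.+1).
- move=> R i hR; have [_ ->] := f1 (rVal R) (ltac:(rewrite /load_wr /isTemp regionE /=; lia)).
  by apply: z; lia.
have f2 := exec0_frame x2 (load_rels_wr R0.+1 ars).
exists s2.
  apply: (exec0_weak _ (exec0_seq x1 x2)).
  rewrite big_ord_recl /= addn0 leq_add2l; apply: leq_sum => i _.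
  by rewrite /= /bump /= addnA addn1.
split=> // -[|R] hR; last by rewrite addnS -addSn; exact: l2.
rewrite addn0 /=; apply: loaded_rel_frame f2 l1 => -[[u v] q].
by rewrite /load_wr /isTemp regionE /=; lia.
Qed.

Lemma load_csts_wr i n : all (fun r => (r.1.1 == 2) && (i <= r.1.2)) (cmd_wr (load_csts i n)).
Proof.
elim: n i => //= n ih i; rewrite leqnn /=.
by apply: sub_all (ih i.+1) => r /andP[-> /ltnW->].
Qed.

Lemma load_csts_ok i n I s w : ip s = [seq inl (cv I c) | c <- iota i n] ++ w ->
  exists2 s', exec0 (load_csts i n) s n s' &
   forall c, i <= c < i + n -> nm s' (rC c) 0 = cv I c.
Proof.
elim: n i s => [|n ih] i s /= e.
  by exists s; [exact: (exec0_block [::])|move=> c; lia].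
have x1 := exec0_read (rC i) e; set s1 := State _ _ _ in x1.
have [s2 x2 h2] := ih i.+1 s1 erefl.
exists s2; first exact: exec0_seq x1 x2.
move=> c hc; have [ec|ne] := eqVneq c i; last by apply: h2; lia.
have f2 := exec0_frame x2 (load_csts_wr i.+1 n).
have [-> _] := f2 (rC c) (ltac:(by rewrite /= ec ltnn)).
by rewrite ec /s1 /= /upd2 !eqxx.
Qed.

End Load.

(** * Nested loops *)

(* [LInt x c cs] lets [x] range from 1 to the minimum of the constants;
   [LRel R xs ys f zs] lets [ys] range over the projections of [R] with [f] nonzero
   that agree with the current values of [zs]. *)
Inductive level :=
| LInt of nat & nat & seq nat
| LRel of nat & seq nat & seq nat & tm & seq nat.

Section Levels.
Variable K : comNzSemiRingType.
Implicit Types (s : state K) (I : inst K).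

Definition updn (nu : nat -> nat) x v : nat -> nat :=
  fun y => if y == x then v else nu y.

Definition ovr ys p (nu : nat -> nat) : nat -> nat :=
  fun x => if x \in ys then asg ys p x else nu x.

(** Reversed to match the order in which the linked lists are traversed. *)
Definition group I R xs ys f zs z := rev [seq p <- gen (rl I R) xs ys |
  (eval I f (asg ys p) != 0%R) && keyed ys zs z p].

Definition level_step I (l : level) nu : seq (nat -> nat) :=
  match l with
  | LInt x c cs => [seq updn nu x i.+1 | i <- iota 0 (vmin I c cs)]
  | LRel R xs ys f zs =>
      [seq ovr ys p nu | p <- group I R xs ys f zs (map nu zs)]
  end.

Fixpoint loops I (ls : seq level) nu : seq (nat -> nat) :=
  if ls is l :: ls' then flatten [seq loops I ls' nu' | nu' <- level_step I l nu]
  else [:: nu].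

(* No loop is ever empty. *)
Fixpoint good I (ls : seq level) nu : Prop :=
  if ls is l :: ls' then
    level_step I l nu <> [::] /\
    forall nu', nu' \in level_step I l nu -> good I ls' nu'
  else True.

Definition outs I hd F (nus : seq (nat -> nat)) :=
  [seq (map nu hd, eval I F nu) | nu <- nus].

Variables (ars : seq nat) (nc : nat).

(* [B] is the set of variables assigned by the outer levels. *)
Fixpoint wfl (hd : seq nat) (F : tm) (B : seq nat) (ls : seq level) : bool :=
  match ls with
  | [::] => subl hd B && subl (fv F) B
  | LInt x c cs :: ls' =>
      [&& x \notin B, (c < nc) && all (fun c => c < nc) cs & wfl hd F (x :: B) ls']
  | LRel R xs ys f zs :: ls' =>
      [&& wf ars nc f, wfgen ars R xs ys zs f, uniq ys,
          subl zs B && all (fun y => (y \in B) ==> (y \in zs)) ys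
        & wfl hd F (ys ++ B) ls']
  end.

End Levels.

(** * Code of the nested loops and the delay of its traces *)

Section Enum.
Variables (K : comNzSemiRingType) (ars : seq nat) (nc : nat).
Implicit Types (s : state K) (I : inst K).

Definition lreg l := match l with LInt _ _ _ => 1 | LRel _ _ _ f _ => (nreg f).+1 end.

Fixpoint lvload m i (ys : seq nat) : seq op :=
  if ys is y :: ys' then OLoad (rV y) (rLC m i) (rPtr m) :: lvload m i.+1 ys'
  else [::].

Definition min_code c cs : seq op := OMov (rT 3) (Reg (rC c)) :: min_ops cs.

(** The tests come after the bodies because [good] guarantees a first round; thus every round prints
    an answer. The end of an interval is recomputed after the inner loops, which may overwrite the
    temporaries. *)
Fixpoint enum_cmd (body : cmd) n (ls : seq level) : cmd :=
  match ls with
  | [::] => body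
  | LInt x c cs :: ls' =>
      CSeq (Block [:: OMov (rPtr n) (Lit 0)])
        (CDo (CSeq (Block [:: OBin BAdd (rPtr n) (Reg (rPtr n)) (Lit 1);
                              OMov (rV x) (Reg (rPtr n))])
              (CSeq (enum_cmd body n.+1 ls')
                (Block (min_code c cs ++ [:: OBin BSub (rT 7) (rTr 3) (Reg (rPtr n))]))))
             (rT 7))
  | LRel R xs ys f zs :: ls' =>
      let m := n + nreg f in
      CSeq (Block (code_ops (rT 2) zs ++ [:: OLoad (rPtr m) (rHd m) (rT 2)]))
        (CDo (CSeq (Block (lvload m 0 ys))
              (CSeq (enum_cmd body m.+1 ls')
                (Block [:: OLoad (rPtr m) (rNx m) (rPtr m)])))
             (rPtr m))
  end.

Fixpoint write_regs (hd : seq nat) : cmd :=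
  if hd is h :: hd' then CSeq (CWrite (rV h)) (write_regs hd') else Block [::].

Definition out_body hd F : cmd :=
  CSeq (write_regs hd)
    (CSeq (Block (OKNat (rT 0) (Lit 1) :: mcode F 0)) (CKWrite (rT 0))).

Definition enum_wr n : pred region := fun r =>
  [|| isTemp r, isVar r | (r.1.1 == 13) && (n <= r.1.2)].

Lemma lvload_wr m i ys : all isVar (map op_wr (lvload m i ys)).
Proof. by elim: ys i => //= y ys ih i; rewrite ih. Qed.

Lemma lvload_wr_in m i ys :
  all (fun r => (r.1.1 == 1) && (r.1.2 \in ys)) (map op_wr (lvload m i ys)).
Proof.
elim: ys i => //= z zs ih i; rewrite mem_head /=.
by apply: sub_all (ih i.+1) => r /andP[-> h]; rewrite inE h orbT.
Qed.

Lemma write_regs_wr hd : cmd_wr (write_regs hd) = [::].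
Proof. by elim: hd. Qed.

Lemma enum_wrP hd F n ls : all (enum_wr n) (cmd_wr (enum_cmd (out_body hd F) n ls)).
Proof.
have tw n' : subpred isTemp (enum_wr n') by move=> r h; rewrite /enum_wr h.
have vw n' : subpred isVar (enum_wr n') by move=> r h; rewrite /enum_wr h orbT.
elim: ls n => [|[x c cs|R xs ys f zs] ls ih] n /=.
- rewrite write_regs_wr /= cats0.
  by apply: sub_all (mcode_wr F 0); exact: tw.
- rewrite all_cat map_cat /= all_cat (sub_all_map (@tw n) (min_ops_wr cs)) /= andbT.
  rewrite {1}/enum_wr /= leqnn {1}/enum_wr /= leqnn /=.
  by apply: sub_all (ih n.+1) => r; rewrite /enum_wr; case/or3P=> [->|->|h]; rewrite ?orbT //; apply/or3P/Or33; lia.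
- rewrite map_cat !all_cat (sub_all_map (@tw n) (code_ops_wr zs (isT : isTemp (rT 2)))) /=.
  rewrite (sub_all_map (@vw n) (lvload_wr _ _ _)) {1 3}/enum_wr /= leq_addr /= andbT.
  apply: sub_all (ih (n + nreg f).+1) => r; rewrite /enum_wr.
  by case/or3P=> [->|->|h]; rewrite ?orbT //; apply/or3P/Or33; lia.
Qed.

(* The trace prints [ans], with at most [a] steps before the first and after the
   last answer, and at most [d] steps between consecutive ones. *)
Definition etr (a d : nat) (ans : seq (seq nat * K)) (tr : trace K) :=
  exists (b1 : trace K) (bs : seq (trace K)) (tl : trace K),
    [/\ tr = b1 ++ flatten bs ++ tl, size b1 <= a, all (fun b => size b <= d) bs,
        size tl <= a & pmap id tl = [::] /\
        [seq pmap id b | b <- b1 :: bs] = [seq enc_entry x | x <- ans]].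

Lemma etr_enumtr a d ans tr : a <= d -> etr a d ans tr -> enum_trace d ans tr.
Proof.
move=> l [b1 [bs [tl [-> h1 h2 h3 [h4 h5]]]]]; exists (b1 :: bs), tl; split=> //.
  by rewrite /= catA.
by rewrite /= (leq_trans h1 l) (leq_trans h3 l).
Qed.

(** The steps after the last answer of one trace and those up to the first answer of the next form a
    single gap, whence [a + a <= d]. *)
Lemma etr_cat a d x y t1 t2 : a + a <= d -> etr a d x t1 -> etr a d y t2 ->
  etr a d (x ++ y) (t1 ++ t2).
Proof.
move=> l [b1 [bs [tl [-> h1 h2 h3 [h4 h5]]]]] [b1' [bs' [tl' [-> k1 k2 k3 [k4 k5]]]]].
exists b1, (bs ++ (tl ++ b1') :: bs'), tl'; split=> //.
- by rewrite flatten_cat /= !catA.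
- rewrite all_cat h2 /= k2 size_cat andbT; apply: leq_trans l; exact: leq_add.
- split=> //; rewrite -[b1 :: _ ++ _]cat_cons !map_cat h5 -k5 /=.
  by rewrite pmap_cat h4.
Qed.

Lemma etr_pad a d p q x t tp tq : pmap id tp = [::] -> pmap id tq = [::] ->
  size tp <= p -> size tq <= q -> etr a d x t ->
  etr (p + a + q) d x (tp ++ t ++ tq).
Proof.
move=> e1 e2 s1 s2 [b1 [bs [tl [-> h1 h2 h3 [h4 h5]]]]].
exists (tp ++ b1), bs, (tl ++ tq); split=> //.
- by rewrite !catA.
- rewrite size_cat; lia.
- rewrite size_cat; lia.
- by rewrite pmap_cat h4 e2; split=> //; rewrite -h5 /= pmap_cat e1.
Qed.

Lemma etr_weak a d a' d' x t : a <= a' -> d <= d' -> etr a d x t -> etr a' d' x t.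
Proof.
move=> la ld [b1 [bs [tl [-> h1 h2 h3 h4]]]]; exists b1, bs, tl; split=> //.
- exact: leq_trans la.
- by apply: sub_all h2 => b hb; apply: leq_trans ld.
- exact: leq_trans la.
Qed.

(** [P] describes a state by the items still to be visited; after a round, the tested register is
    zero exactly when none is left. *)
Lemma exec_do (T : Type) body x (l : seq T) (P : seq T -> state K -> Prop)
    (o : T -> seq (seq nat * K)) A d s :
  A + A <= d ->
  (forall t l s, P (t :: l) s -> exists s' tr,
     [/\ exec body s tr s', etr A d (o t) (rcons tr None), P l s'
       & nm s' x 0 = 0 <-> l = [::]]) ->
  l <> [::] -> P l s ->
  exists s' tr, [/\ exec (CDo body x) s tr s',
     etr A d (flatten [seq o t | t <- l]) tr & P [::] s'].
Proof.
move=> lA h; elim: l s => // t l ih s _ /h[s1 [tr1 [x1 e1 p1 z1]]].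
case: l ih p1 z1 => [|t' l] ih p1 z1.
  exists s1, (rcons tr1 None); rewrite /= cats0; split=> //.
  by apply: XDoF x1 _; apply/z1.
have [s2 [tr2 [x2 e2 p2]]] := ih s1 (ltac:(by [])) p1.
exists s2, (tr1 ++ None :: tr2); split=> //.
  by apply: XDoT x1 _ x2; case: (nm s1 x 0) z1 => // -[] /(_ erefl).
by rewrite -cat_rcons; apply: etr_cat.
Qed.

Lemma write_regs_ok hd s : exists2 tr, exec (write_regs hd) s tr s &
  size tr = size hd /\ pmap id tr = [seq inl (vars s h) | h <- hd].
Proof.
elim: hd => [|h hd [tr x [s1 s2]]] /=.
  by exists [::]; [exact: (XBlock [::])|].
exists ([:: Some (inl (vars s h))] ++ tr); last by rewrite /= s1 s2.
by econstructor; [exact: XWrite|].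
Qed.

Fixpoint lready I (n : nat) (ls : seq level) s : Prop :=
  match ls with
  | [::] => True
  | LInt _ _ _ :: ls' => lready I n.+1 ls' s
  | LRel R xs ys f zs :: ls' => linked I ys zs f (n + nreg f) (gen (rl I R) xs ys) s /\
      lready I (n + nreg f).+1 ls' s
  end.

Lemma enum_wr_data n r : isdata r -> ~~ enum_wr n r.
Proof. by case: r => [[a b] c]; rewrite /isdata /enum_wr /isTemp /isVar /=; lia. Qed.

Lemma enum_wr_msg n m m' r : ismsg m m' r -> ~~ enum_wr n r.
Proof. by case: r => [[a b] c]; rewrite /ismsg /enum_wr /isTemp /isVar /=; lia. Qed.

Lemma linked_frame n I ys zs f m g s s' : frame (enum_wr n) s s' ->
  linked I ys zs f m g s -> linked I ys zs f m g s'.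
Proof.
move=> fr h z sz; have [-> _] := fr (rHd m) isT; have [-> _] := fr (rCnt m) isT.
apply: chain_eq (h z sz) => //.
- by move=> i j _; have [-> _] := fr (rLC m i) isT.
- by move=> j _; have [-> _] := fr (rNx m) isT.
Qed.

Lemma lready_frame n I k ls s s' : frame (enum_wr n) s s' ->
  lready I k ls s -> lready I k ls s'.
Proof.
move=> fr; elim: ls k => //= -[x c cs|R xs ys f zs] ls ih k; first exact: ih.
by move=> [h1 h2]; split; [exact: linked_frame fr h1|exact: ih].
Qed.

Lemma loaded_enum n I s s' : frame (enum_wr n) s s' -> loaded ars nc I s -> loaded ars nc I s'.
Proof. by apply: loaded_frame => r; exact: enum_wr_data. Qed.

Lemma ready_enum n I F k s s' : frame (enum_wr n) s s' -> ready I F k s -> ready I F k s'.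
Proof. by apply: ready_frame => r; exact: enum_wr_msg. Qed.

Lemma lvload_ok m i ys s y : uniq ys -> y \in ys ->
  vars (exb (lvload m i ys) s) y = nm s (rLC m (i + index y ys)) (nm s (rPtr m) 0).
Proof.
elim: ys i s => //= x ys ih i s /andP[xy uy]; rewrite inE eq_sym.
pose s1 := apply_op s (OLoad (rV x) (rLC m i) (rPtr m)).
rewrite -[exb _ _]/(exb (lvload m i.+1 ys) s1).
have fr : frame (fun r => (r.1.1 == 1) && (r.1.2 \in ys)) s1 (exb (lvload m i.+1 ys) s1).
  by apply: frame_block; exact: lvload_wr_in.
case: eqP => [<-|ne] /=.
  move=> _; rewrite /vars; have [-> _] := fr (rV x) (ltac:(by rewrite /=)).
  by rewrite addn0 /s1 /= /upd2 !eqxx.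
by move=> hy; rewrite ih // addnS.
Qed.

Lemma vmin_frame I c cs s : loaded ars nc I s -> c < nc -> all (fun c => c < nc) cs ->
  nm (exb (min_code c cs) s) (rT 3) 0 = vmin I c cs.
Proof.
move=> l h1 h2; rewrite -[exb _ _]/(exb (min_ops cs) (apply_op s (OMov (rT 3) (Reg (rC c))))).
have fr : frame isTemp s (apply_op s (OMov (rT 3) (Reg (rC c)))) by apply: frame_op.
have l2 := loaded_frame (@isTemp_data) fr l.
have e : nm (apply_op s (OMov (rT 3) (Reg (rC c)))) (rT 3) 0 = cv I c.
  by case: l => _ _ _ /(_ c h1) <-.
by have [] := min_ops_ok l2 h2 e.
Qed.

End Enum.

Section EnumOk.
Variables (K : comNzSemiRingType) (ars : seq nat) (nc : nat).
Implicit Types (s : state K) (I : inst K).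

Variables (hd : seq nat) (F : tm).
Hypothesis wfF : wf ars nc F.

Definition einv I n ls (B : seq nat) nu s :=
  [/\ loaded ars nc I s, ready I F 0 s, lready I n ls s & {in B, vars s =1 nu}].

Lemma einv_frame k I n ls (B : seq nat) nu s s' : frame (enum_wr k) s s' ->
  {in B, vars s' =1 nu} -> einv I n ls B nu s -> einv I n ls B nu s'.
Proof.
move=> fr hv [h1 h2 h3 h4]; split=> //.
- exact: loaded_enum fr h1.
- exact: ready_enum fr h2.
- exact: lready_frame fr h3.
Qed.

Lemma isTemp_enum k s s' : frame isTemp s s' -> frame (enum_wr k) s s'.
Proof. by apply: frame_sub => r h; rewrite /enum_wr h. Qed.

Lemma enum_wr_le k k' s s' : k <= k' -> frame (enum_wr k') s s' -> frame (enum_wr k) s s'.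
Proof.
move=> l; apply: frame_sub => r; rewrite /enum_wr.
by case/or3P=> [->|->|h]; rewrite ?orbT //; apply/or3P/Or33; lia.
Qed.

Lemma enum_base I B nu s : valid ars I -> subl hd B -> subl (fv F) B ->
  einv I 0 [::] B nu s ->
  exists s' tr, [/\ exec (out_body hd F) s tr s',
    size tr = size hd + (bsize (OKNat (rT 0) (Lit 1) :: mcode F 0) + 1),
    pmap id tr = enc_entry (map nu hd, eval I F nu) & {in B, vars s' =1 nu}].
Proof.
move=> vI /allP hB /allP fB [h1 h2 _ h4].
have [tr x [sz ptr]] := write_regs_ok hd s.
set s1 := exb (OKNat (rT 0) (Lit 1) :: mcode F 0) s.
have f1 : frame isTemp s s1.
  by apply: frame_block => /=; exact: mcode_wr.
have kv : km s1 (rT 0) 0 = eval I F nu.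
  rewrite /s1 -[exb _ s]/(exb (mcode F 0) (apply_op s (OKNat (rT 0) (Lit 1)))).
  have f0 : frame isTemp s (apply_op s (OKNat (rT 0) (Lit 1))) by apply: frame_op.
  rewrite (mcode_ok wfF vI).
  + by rewrite [km _ _ _]/= /upd2 !regionE /= mul1r; apply: eval_fv => y /fB hy; exact: h4.
  + exact: loaded_frame (@isTemp_data) f0 h1.
  + by apply: ready_frame f0 h2 => r; exact: isTemp_msg.
exists s1; eexists; split.
- econstructor; first exact: x; econstructor; [exact: XBlock|exact: XKWrite].
- by rewrite size_cat sz /= size_cat size_nseq.
- rewrite pmap_cat ptr pmap_cat pmap_silent /= /enc_entry -map_comp; congr (_ ++ [:: inr _]).
    by apply/eq_in_map => y /hB hy /=; rewrite h4.
  exact: kv.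
- by move=> y hy; rewrite (vars_temp f1) h4.
Qed.

Lemma iota_drop_head k n t l : t :: l = iota k n -> [/\ t = k, l = iota k.+1 n.-1 & 0 < n].
Proof. by case: n => //= n [-> ->]. Qed.

(** A level adds its own overhead once before the first and once after the last inner answer of a
    round, and consecutive rounds meet in one gap. So [A] and [d] grow with the number of levels but
    not with the number of rounds. *)
Lemma enum_ok ls : forall n B, wfl ars nc hd F B ls ->
  exists A d, A + A <= d /\ forall I s nu, valid ars I -> einv I n ls B nu s ->
    good I ls nu ->
    exists s' tr, [/\ exec (enum_cmd (out_body hd F) n ls) s tr s',
      etr A d (outs I hd F (loops I ls nu)) tr & {in B, vars s' =1 nu}].
Proof.
elim: ls => [|[x c cs|R xs ys f zs] ls ih] n B.
- move=> /andP[hB fB].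
  set A := size hd + (bsize (OKNat (rT 0) (Lit 1) :: mcode F 0) + 1).
  exists A, (A + A); split=> // I s nu vI [e1 e2 e3 e4] _.
  have ei : einv I 0 [::] B nu s by [].
  have [s' [tr [x st pt hv]]] := enum_base vI hB fB ei.
  exists s', tr; split=> //; exists tr, [::], [::].
  by rewrite /= !cats0 st leqnn pt.
- move=> /= /and3P[xB /andP[hc hcs] wfl'].
  have [A [d [lA h]]] := ih n.+1 _ wfl'.
  set blk := min_code c cs ++ [:: OBin BSub (rT 7) (rTr 3) (Reg (rPtr n))].
  pose A' := 2 + A + (bsize blk).+1.
  exists (1 + A' + 0), (d + (1 + A' + 0 + (1 + A' + 0))); split; first by lia.
  move=> I s nu vI [e1 e2 e3 e4] [ne hg].
  set N := vmin I c cs in ne hg *.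
  set s0 := exb [:: OMov (rPtr n) (Lit 0)] s.
  have f0 : frame (enum_wr n) s s0.
    by apply: frame_op; rewrite /enum_wr /= leqnn.
  pose P (l : seq nat) s := [/\ einv I n.+1 ls B nu s, nm s (rPtr n) 0 + size l = N
      & l = iota (nm s (rPtr n) 0) (size l)].
  pose o i := outs I hd F (loops I ls (updn nu x i.+1)).
  have P0 : P (iota 0 N) s0.
    split.
    - apply: (einv_frame f0); last by [].
      by move=> y hy; rewrite -e4.
    - by rewrite size_iota /s0 /exb /= /upd2 eqxx.
    - by rewrite size_iota /s0 /exb /= /upd2 eqxx.
  have [||s2 [tr2 [x2 et2 [[_ _ _ v2] _ _]]]] := exec_do (T := nat) (x := rT 7)
     (body := CSeq (Block [:: OBin BAdd (rPtr n) (Reg (rPtr n)) (Lit 1);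
                              OMov (rV x) (Reg (rPtr n))])
              (CSeq (enum_cmd (out_body hd F) n.+1 ls) (Block blk)))
     (o := o) (P := P) (A := A') (d := d + (A' + A')) (ltac:(lia)) _ _ P0.
  + move=> i l s1 [i1 p1 l1].
    have [ei el _] := iota_drop_head l1.
    set s2 := exb [:: OBin BAdd (rPtr n) (Reg (rPtr n)) (Lit 1);
                              OMov (rV x) (Reg (rPtr n))] s1.
    have p2 : nm s2 (rPtr n) 0 = i.+1.
      by rewrite /s2 /exb /= /upd2 !regionE /= !eqxx /= -ei addn1.
    have f2 : frame (enum_wr n) s1 s2.
      by apply: frame_block => /=; rewrite /enum_wr /= leqnn.
    have v2 : {in x :: B, vars s2 =1 updn nu x i.+1}.
      move=> y; rewrite inE /updn /vars => hy.
      rewrite -p2 /s2 /exb /= /upd2 !regionE /=.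
      case: eqP hy => //= _ hy; case: i1 => _ _ _ v1.
      by rewrite -v1.
    have i2 : einv I n.+1 ls (x :: B) (updn nu x i.+1) s2.
      have [a1 a2 a3 _] := i1.
      by split; [exact: loaded_enum f2 a1|exact: ready_enum f2 a2|exact: lready_frame f2 a3|].
    have iN : i < N by move: p1; rewrite /= -ei; lia.
    have [|s3 [tr3 [x3 t3 v3]]] := h I s2 _ vI i2.
      by apply: hg; apply: (map_f (fun i => updn nu x i.+1)); rewrite mem_iota.
    have f3 := frame_exec x3 (enum_wrP hd F n.+1 ls).
    set s4 := exb blk s3.
    have f4 : frame isTemp s3 s4.
      apply: frame_block; rewrite map_cat all_cat /= andbT; exact: min_ops_wr.
    have l3 : loaded ars nc I s3 by case: i2 => a _ _ _; exact: loaded_enum f3 a.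
    have p3 : nm s3 (rPtr n) 0 = i.+1.
      by rewrite -p2; have [-> _] := f3 (rPtr n) (ltac:(by rewrite /enum_wr /= ltnn)).
    have p4 : nm s4 (rPtr n) 0 = i.+1.
      by rewrite -p3; have [-> _] := f4 (rPtr n) isT.
    have t7 : nm s4 (rT 7) 0 = N - i.+1.
      have fm : frame isTemp s3 (exb (min_code c cs) s3).
        by apply: frame_block => /=; exact: min_ops_wr.
      have em := vmin_frame l3 hc hcs.
      rewrite /s4 /blk exb_cat; set s5 := exb (min_code c cs) s3 in fm em *.
      rewrite /exb /= /upd2 !regionE /= em.
      by have [-> _] := fm (rPtr n) isT; rewrite p3.
    have i4 : einv I n.+1 ls B nu s4.
      have f24 : frame (enum_wr n) s2 s4.
        apply: frame_trans (enum_wr_le (leqnSn n) f3) _; exact: isTemp_enum f4.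
      apply: einv_frame (frame_trans f2 f24) _ i1 => y hy.
      rewrite (vars_temp f4) v3 ?inE ?hy ?orbT // /updn.
      by case: eqP => // e; rewrite -e hy in xB.
    exists s4; eexists; split.
    * econstructor; first exact: XBlock.
      econstructor; [exact: x3|exact: XBlock].
    * rewrite -!cats1 -!catA.
      apply: (etr_weak (a := 2 + A + (bsize blk).+1) (d := d)); [by []|lia|].
      by apply: etr_pad t3; rewrite ?pmap_cat ?pmap_silent ?size_cat ?size_nseq ?addn1.
    * split=> //; first by move: p1; rewrite p4 /= -ei; lia.
      by rewrite p4 {1}el -ei.
    * rewrite t7; move: p1; rewrite /= -ei; case: (l) => [|? ?] /=; split=> //; lia.
  + by move=> e; apply: ne; rewrite /= e.
  exists s2; eexists; split; [|..|exact: v2].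
  + by econstructor; [exact: XBlock|exact: x2].
  + rewrite -[tr2]cats0.
    have -> : outs I hd F (flatten [seq loops I ls nu' | nu' <- level_step I (LInt x c cs) nu]) =
      flatten [seq o t | t <- iota 0 N].
      by rewrite /outs /o /= map_flatten -!map_comp.
    apply: (etr_weak (a := 1 + A' + 0) (d := d + (A' + A'))); [by []|lia|].
    by apply: etr_pad et2; rewrite ?pmap_silent.
- move=> /= /and5P[wff wfg uy /andP[/allP szB /allP zB] wfl'].
  set m := n + nreg f.
  have [A [d [lA h]]] := ih m.+1 _ wfl'.
  case/and5P: (wfg) => _ _ _ /allP szy _.
  pose A' := bsize (lvload m 0 ys) + A + 4.
  set b0 := code_ops (rT 2) zs ++ [:: OLoad (rPtr m) (rHd m) (rT 2)].
  exists (bsize b0 + A' + 0), (d + (bsize b0 + A' + 0 + (bsize b0 + A' + 0))); split; first by lia.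
  move=> I s nu vI [e1 e2 [e3 e3'] e4] [ne hg].
  set key := map nu zs.
  set s0 := exb b0 s.
  have [c1 c2 c3] := code_ops_temp zs s.
  have f0 : frame (enum_wr n) s s0.
    apply: frame_block; rewrite map_cat all_cat; apply/andP; split.
      by apply: sub_all_map (code_ops_wr zs (isT : isTemp (rT 2))) => r hr; rewrite /enum_wr hr.
    by rewrite /= /enum_wr /= leq_addr.
  have p0 : nm s0 (rPtr m) 0 = nm s (rHd m) (tcode key).
    rewrite /s0 /b0 exb_cat; set s1 := exb (code_ops _ _) s in c1 c2 c3 *.
    rewrite /exb /= /upd2 !eqxx /= c1; have [-> _] := c3 (rHd m) isT.
    by congr (nm s _ (tcode _)); apply/eq_in_map => y /szB hy; rewrite e4.
  have v0 : {in B, vars s0 =1 nu}.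
    move=> y hy; rewrite -e4 // /vars /s0 /b0 exb_cat.
    set s1 := exb (code_ops _ _) s in c1 c2 c3 *.
    by rewrite /exb /= /upd2 regionE /=; have [-> _] := c3 (rV y) isT.
  pose G := group I R xs ys f zs key.
  pose P (l : seq (seq nat)) s := [/\ einv I m.+1 ls B nu s,
     exists b, chain s m ys b (nm s (rPtr m) 0) l & {subset l <= G}].
  pose o p := outs I hd F (loops I ls (ovr ys p nu)).
  have P0 : P G s0.
    split=> //.
    - by apply: einv_frame f0 v0 _.
    - exists (nm s0 (rCnt m) 0); rewrite p0.
      have := linked_frame f0 e3; move=> /(_ key (ltac:(by rewrite size_map))).
      by have [-> _] := f0 (rHd m) isT.
  have [||s2 [tr2 [x2 et2 [[_ _ _ v2] _ _]]]] := exec_do (T := seq nat) (x := rPtr m)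
     (body := CSeq (Block (lvload m 0 ys))
              (CSeq (enum_cmd (out_body hd F) m.+1 ls)
                (Block [:: OLoad (rPtr m) (rNx m) (rPtr m)])))
     (o := o) (P := P) (A := A') (d := d + (A' + A')) (ltac:(lia)) _ _ P0.
  + move=> p l s1 [i1 [b [pb lb cb]] sub1].
    have kp : keyed ys zs key p.
      have := sub1 p (mem_head _ _).
      by rewrite /G /group mem_rev mem_filter => /andP[/andP[_ ->]].
    set s2 := exb (lvload m 0 ys) s1.
    have fv2 : frame isVar s1 s2 by apply: frame_block; exact: lvload_wr.
    have f2 : frame (enum_wr n) s1 s2.
      by apply: frame_sub fv2 => r hr; rewrite /enum_wr hr orbT.
    have fy2 : frame (fun r => (r.1.1 == 1) && (r.1.2 \in ys)) s1 s2.
      by apply: frame_block; exact: lvload_wr_in.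
    have v2 : {in ys ++ B, vars s2 =1 ovr ys p nu}.
      move=> y; rewrite mem_cat /ovr; case: ifP => [hy _|hy /= hB].
        by rewrite lvload_ok // add0n lb ?index_mem.
      rewrite /vars; have [-> _] := fy2 (rV y) (ltac:(by rewrite /= hy)).
      by case: i1 => _ _ _; apply.
    (* An outer variable that occurs again in [ys] belongs to [zs], and the key forces it to keep
       its current value. *)
    have ovB : {in B, ovr ys p nu =1 nu}.
      move=> y hy; rewrite /ovr; case: ifP => // hyy.
      have yz : y \in zs by move: (zB y hyy); rewrite hy.
      by move: kp => /eqP /eq_in_map; apply.
    have i2 : einv I m.+1 ls (ys ++ B) (ovr ys p nu) s2.
      have [a1 a2 a3 _] := i1.
      by split; [exact: loaded_enum f2 a1|exact: ready_enum f2 a2|exact: lready_frame f2 a3|].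
    have [|s3 [tr3 [x3 t3 v3]]] := h I s2 _ vI i2.
      by apply: hg; apply: (map_f (fun p => ovr ys p nu)); apply: sub1; exact: mem_head.
    have f3 := frame_exec x3 (enum_wrP hd F m.+1 ls).
    set s4 := exb [:: OLoad (rPtr m) (rNx m) (rPtr m)] s3.
    have f4 : frame (fun r => r == rPtr m) s3 s4.
      by apply: frame_block => /=; rewrite eqxx.
    have p3 : nm s3 (rPtr m) 0 = nm s1 (rPtr m) 0.
      have [-> _] := f3 (rPtr m) (ltac:(by rewrite /enum_wr /= ltnn)).
      by have [-> _] := fv2 (rPtr m) isT.
    have n3 : nm s3 (rNx m) =1 nm s1 (rNx m).
      move=> j; have [-> _] := f3 (rNx m) isT.
      by have [-> _] := fv2 (rNx m) isT.
    have p4 : nm s4 (rPtr m) 0 = nm s1 (rNx m) (nm s1 (rPtr m) 0).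
      by rewrite /s4 /exb /= /upd2 !eqxx /= p3 n3.
    have f14 : frame (enum_wr n) s1 s4.
      apply: frame_trans f2 _; apply: frame_trans (enum_wr_le _ f3) _; first by lia.
      by apply: frame_sub f4 => r /eqP->; rewrite /enum_wr /= leq_addr.
    have i4 : einv I m.+1 ls B nu s4.
      apply: einv_frame f14 _ i1 => y hy.
      rewrite /vars; have [-> _] := f4 (rV y) isT.
      by rewrite -/(vars s3 y) v3 ?mem_cat ?hy ?orbT // ovB.
    have c4 : chain s4 m ys (nm s1 (rPtr m) 0).-1 (nm s4 (rPtr m) 0) l.
      rewrite p4; apply: chain_eq cb => //.
      - by move=> i j _; have [-> _] := f14 (rLC m i) isT.
      - by move=> j _; have [-> _] := f14 (rNx m) isT.
    exists s4; eexists; split.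
    * econstructor; first exact: XBlock.
      econstructor; [exact: x3|exact: XBlock].
    * rewrite -!cats1 -!catA.
      apply: (etr_weak (a := bsize (lvload m 0 ys) + A + 4) (d := d)); [by []|lia|].
      by apply: etr_pad t3; rewrite ?pmap_cat ?pmap_silent ?size_cat ?size_nseq ?addn1.
    * split=> //; first by eexists; exact: c4.
      by move=> q hq; apply: sub1; rewrite inE hq orbT.
    * case: (l) c4 => [|q l'] /=; first by move=> ->.
      by case=> /andP[q0 _] _ _; split=> // e; rewrite e in q0.
  + by move=> e; apply: ne; rewrite /= -/key -/G e.
  exists s2; eexists; split; [|..|exact: v2].
  + by econstructor; [exact: XBlock|exact: x2].
  + rewrite -[tr2]cats0.
    have -> : outs I hd F (flatten [seq loops I ls nu' | nu' <- level_step I (LRel R xs ys f zs) nu]) =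
      flatten [seq o t | t <- G].
      by rewrite /outs /o /= map_flatten -!map_comp.
    apply: (etr_weak (a := bsize b0 + A' + 0) (d := d + (A' + A'))); [by []|lia|].
    by apply: etr_pad et2; rewrite ?pmap_silent ?size_nseq.
Qed.

End EnumOk.

(** * Assembling loading, table filling, test and enumeration *)

Section Program.
Variables (K : comNzSemiRingType) (ars : seq nat) (nc : nat).
Implicit Types (s : state K) (I : inst K).

Fixpoint prep_levels n (ls : seq level) : cmd :=
  match ls with
  | [::] => Block [::]
  | LInt _ _ _ :: ls' => prep_levels n.+1 ls'
  | LRel R xs ys f zs :: ls' =>
      CSeq (prep_level R xs ys f zs n) (prep_levels (n + nreg f).+1 ls')
  end.

Fixpoint nlev (ls : seq level) := if ls is l :: ls' then lreg l + nlev ls' else 0.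

Lemma prep_levels_wr n ls : all (prep_wr n (n + nlev ls)) (cmd_wr (prep_levels n ls)).
Proof.
elim: ls n => //= -[x c cs|R xs ys f zs] ls ih n.
  by apply: sub_all (ih n.+1); apply: prep_wr_sub => /=; lia.
rewrite [cmd_wr _]/(cmd_wr (prep_level R xs ys f zs n) ++ cmd_wr (prep_levels (n + nreg f).+1 ls)).
rewrite all_cat; apply/andP; split.
  by apply: sub_all (prep_level_wrP _ _ _ _ _ _); apply: prep_wr_sub => /=; lia.
by apply: sub_all (ih _); apply: prep_wr_sub => /=; lia.
Qed.

Lemma linked_prep n n' I ys zs f m g s s' : m < n \/ n' <= m -> frame (prep_wr n n') s s' ->
  linked I ys zs f m g s -> linked I ys zs f m g s'.
Proof.
move=> hm fr h z sz.
have e r : (r.1.1 == 9) || (r.1.1 == 10) || (r.1.1 == 11) || (r.1.1 == 12) ->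
  r.1.2 = m -> nm s' r =1 nm s r.
  move=> h1 h2; have h3 : ~~ prep_wr n n' r.
    case: r h1 h2 => [[a b] c] /= h1 h2.
    rewrite /prep_wr /isTemp /isVar !regionE /=; lia.
  by case: (fr r h3).
rewrite (e (rHd m)) // (e (rCnt m)) //.
apply: chain_eq (h z sz) => //.
- by move=> i j _; rewrite (e (rLC m i)).
- by move=> j _; rewrite (e (rNx m)).
Qed.

Lemma prep_levels_ok hd F ls : forall n B, wfl ars nc hd F B ls ->
  exists c, forall I s, valid ars I -> loaded ars nc I s -> fresh n (n + nlev ls) s ->
  exists s', [/\ exec0 (prep_levels n ls) s (c * isz ars I) s',
    loaded ars nc I s' & lready I n ls s'].
Proof.
elim: ls => [|[x c cs|R xs ys f zs] ls ih] n B.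
- by move=> _; exists 0 => I s *; exists s; split=> //; rewrite mul0n; exact: (exec0_block [::]).
- move=> /and3P[_ _ /(ih n.+1)[c0 h]]; exists c0 => I s vI l fr.
  have fr1 : fresh n.+1 (n.+1 + nlev ls) s by apply: fresh_sub fr => /=; lia.
  by have [s' [x1 l1 r1]] := h I s vI l fr1; exists s'.
- move=> /and5P[wff wfg uy _ /(ih (n + nreg f).+1)[c2 h2]].
  have [c1 h1] := prep_level_ok K n wff wfg uy.
  exists (c1 + c2) => I s vI l fr.
  have frf : fresh n (n + nreg f).+1 s by apply: fresh_sub fr => /=; lia.
  have [s1 [x1 l1 r1]] := h1 I s vI l frf.
  have f1 := exec0_frame x1 (prep_level_wrP _ _ _ _ _ _).
  have fr1 : fresh (n + nreg f).+1 ((n + nreg f).+1 + nlev ls) s1.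
    have : fresh (n + nreg f).+1 ((n + nreg f).+1 + nlev ls) s by apply: fresh_sub fr => /=; lia.
    by apply: fresh_frame f1 => r; apply: prep_wr_fresh; lia.
  have [s2 [x2 l2 r2]] := h2 I s1 vI l1 fr1.
  have f2 := exec0_frame x2 (prep_levels_wr _ _).
  exists s2; split=> //; first by rewrite mulnDl; exact: exec0_seq x1 x2.
  by split=> //; apply: linked_prep f2 r1; left.
Qed.

Definition nu0 : nat -> nat := fun=> 0.

Lemma load_ok n : exists c, forall I w, valid ars I -> cv I 0 = 1 ->
  w = word ars n I ->
  exists s', [/\ exec0 (load ars n) (State (fun _ _ => 0) (fun _ _ => 0%R) w)
      (c * isz ars I) s', loaded ars n.+1 I s' & forall m m', fresh m m' s'].
Proof.
pose c1 := \sum_(R < size ars) ((7 * nth 0 ars R + 13).+2 * 1).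
exists (c1 + (n + 1)) => I w vI c0 ew.
set s0 := State _ _ _.
have [|||s1 x1 [i1 l1]] := load_rels_ok (ars := ars) (R0 := 0) (I := I) (s := s0) (w := [seq inl (cv I c) | c <- iota 1 n]).
- by move=> R hR e he; apply: vI.
- by rewrite /= ew.
- by [].
rewrite -[ip s1]cats0 in i1.
have i1' : ip s1 = [seq inl (cv I c) | c <- iota 1 n] ++ [::] by rewrite cats0 -i1 cats0.
have f1 := exec0_frame x1 (load_rels_wr 0 ars).
have [s2 x2 h2] := load_csts_ok i1'.
have f2 := exec0_frame x2 (load_csts_wr 1 n).
set s3 := exb [:: OMov (rC 0) (Lit 1)] s2.
have f3 : frame (fun r => r == rC 0) s2 s3.
  by apply: frame_block.
exists s3; split.
- apply: exec0_weak (exec0_seq x1 (exec0_seq x2 (exec0_block [:: OMov (rC 0) (Lit 1)] s2))).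
  rewrite mulnDl; apply: leq_add; last by rewrite /bsize /= leq_pmulr.
  rewrite /c1 big_distrl; apply: leq_sum => R _.
  by rewrite muln1 add0n leq_mul2l size_rl ?orbT.
- have l3 R : R < size ars -> loaded_rel (nth 0 ars R) (rl I R) R s3.
    move=> hR; have := l1 R hR; rewrite add0n => h.
    apply: loaded_rel_frame f3 _; first by case=> [[a b] c]; rewrite regionE /=; lia.
    by apply: loaded_rel_frame f2 h; case=> [[a b] c] /=; lia.
  split.
  + by move=> R /l3[].
  + by move=> R j /l3[_ h _] hj; exact: h.
  + by move=> R t /l3[_ _ h]; exact: h.
  + case=> [|c] hc; first by rewrite c0.
    have [-> _] := f3 (rC c.+1) isT; apply: h2; lia.
- move=> m m' k hk i.
  have fr r : 6 < r.1.1 < 13 -> nm s3 r =1 (fun=> 0) /\ km s3 r =1 (fun=> 0%R).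
    case: r => [[a b] c]; rewrite [(_, _, _).1.1]/= => hr.
    have [a1 a2] := f1 (a, b, c) (ltac:(rewrite /load_wr /isTemp regionE /=; lia)).
    have [b1 b2] := f2 (a, b, c) (ltac:(simpl; lia)).
    have [c1' c2] := f3 (a, b, c) (ltac:(cbv beta; rewrite regionE /=; lia)).
    by split=> j; [rewrite c1' b1 a1|rewrite c2 b2 a2].
  have [e1 e2] := fr (rMsg k) isT; have [e3 _] := fr (rSeen k) isT.
  have [e4 _] := fr (rHd k) isT; have [e5 _] := fr (rCnt k) isT.
  by rewrite e1 e2 e3 e4 e5.
Qed.

(** A single guard in front of the outermost loop deals with the empty answer set; the do-loops
    behind it could not represent it. *)
Definition program n hd F chk ls : cmd :=
  let n1 := nreg F + nreg chk in
  CSeq (CSeq (load ars n) (CSeq (prep F 0) (CSeq (prep chk (nreg F))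
    (CSeq (prep_levels n1 ls) (Block (OKNat (rT 0) (Lit 1) :: mcode chk (nreg F)))))))
  (CIfK (rT 0) (enum_cmd (out_body hd F) n1 ls)).

Lemma enumerates_weak (p : seq instr) (w : seq (token K)) ans pre pre' d d' :
  pre <= pre' -> d <= d' -> enumerates_within p w ans pre d ->
  enumerates_within p w ans pre' d'.
Proof.
move=> l1 l2 [t [h1 h2 h3 h4]]; exists t; split=> //.
- exact: leq_trans l1.
- move=> j /h2/andP[-> h]; apply: leq_trans h _; by rewrite leq_add2l.
Qed.

End Program.

(** The interface between machine and combinatorics: what remains is to find, for a given query, a
    value term, a test and loops that are never empty when the test succeeds. *)
Theorem machine_enumerates (K : comNzSemiRingType) (ars : seq nat) (n : nat)
    (hd : seq nat) (F chk : tm) (ls : seq level) :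
  wf ars n.+1 F -> wf ars n.+1 chk -> fv chk = [::] -> wfl ars n.+1 hd F [::] ls ->
  exists (p : seq instr) (c : nat), forall (I : inst K) w, valid ars I ->
    cv I 0 = 1 -> w = word ars n I ->
    (eval I chk nu0 <> 0%R -> good I ls nu0) ->
    enumerates_within p w
      (if eval I chk nu0 == 0%R then [::] else outs I hd F (loops I ls nu0))
      (c * isz ars I) c.
Proof.
move=> wfF wfc fvc wfL.
have [c0 h0] := load_ok K ars n.
have [c1 h1] := prep_ok K 0 wfF.
have [c2 h2] := prep_ok K (nreg F) wfc.
set n1 := nreg F + nreg chk.
have [c3 h3] := prep_levels_ok K n1 wfL.
have [A [d [lA h4]]] := enum_ok K wfF n1 wfL.
set ev := OKNat (rT 0) (Lit 1) :: mcode chk (nreg F).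
eexists; exists (c0 + (c1 + (c2 + (c3 + bsize ev))) + (d + A).+2) => I w vI c10 ew hg.
have [s0 [x0 l0 fr0]] := h0 I w vI c10 ew.
have [s1 [x1 l1 r1]] := h1 I s0 vI l0 (fr0 _ _).
have f1 := exec0_frame x1 (prep_wrP F 0).
have fr1 : fresh (nreg F) n1 s1.
  by apply: fresh_frame f1 (fr0 _ _) => r; apply: prep_wr_fresh.
have [s2 [x2 l2 r2]] := h2 I s1 vI l1 fr1.
have f2 := exec0_frame x2 (prep_wrP chk (nreg F)).
have fr2 : fresh n1 (n1 + nlev ls) s2.
  apply: fresh_frame f2 _; first by move=> r; apply: prep_wr_fresh.
  by apply: fresh_frame f1 (fr0 _ _) => r; apply: prep_wr_fresh; rewrite add0n /n1 leq_addr.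
have [s3 [x3 l3 r3]] := h3 I s2 vI l2 fr2.
have f3 := exec0_frame x3 (prep_levels_wr n1 ls).
set s4 := exb ev s3.
have f4 : frame isTemp s3 s4 by apply: frame_block => /=; exact: mcode_wr.
have rc3 : ready I chk (nreg F) s3.
  by apply: ready_frame f3 r2 => r; apply: prep_wr_msg; right.
have rF3 : ready I F 0 s3.
  have : ready I F 0 s2 by apply: ready_frame f2 r1 => r; apply: prep_wr_msg; right.
  by apply: ready_frame f3 => r; apply: prep_wr_msg; right; rewrite /n1 add0n leq_addr.
have k4 : km s4 (rT 0) 0 = eval I chk nu0.
  rewrite /s4 -[exb _ _]/(exb (mcode chk (nreg F)) (apply_op s3 (OKNat (rT 0) (Lit 1)))).
  have f0 : frame isTemp s3 (apply_op s3 (OKNat (rT 0) (Lit 1))) by apply: frame_op.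
  rewrite (mcode_ok wfc vI).
  + by rewrite [km _ _ _]/= /upd2 !regionE /= mul1r; apply: eval_fv => y; rewrite fvc.
  + exact: loaded_frame (@isTemp_data) f0 l3.
  + by apply: ready_frame f0 rc3 => r; exact: isTemp_msg.
have [tr0 [y0 sil0 sz0]] := exec0_seq x0 (exec0_seq x1 (exec0_seq x2 (exec0_seq x3 (exec0_block ev s3)))).
have szp : size tr0 <= (c0 + (c1 + (c2 + (c3 + bsize ev))) + (d + A).+2) * isz ars I.
  apply: leq_trans sz0 _.
  have : 0 < isz ars I by [].
  move: (bsize ev) (isz ars I) => b i i0.
  have : b <= b * i by rewrite leq_pmulr.
  rewrite !mulnDl; lia.
have [z|nz] := eqVneq (eval I chk nu0) 0%R.
- apply: (enumerates_weak szp); first exact: leq_addl.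
  apply: (exec_enumerates (c := program ars n hd F chk ls) (tr := tr0 ++ [:: None])
    (tr1 := [:: None]) _ _ sil0) => //.
    by apply: (XSeq y0); apply: XIfF; rewrite -/(exb _ _) -/s4 k4.
  by exists [::], [:: None].
- have i4 : einv ars n.+1 F I n1 ls [::] nu0 s4.
    split; [exact: loaded_frame (@isTemp_data) f4 l3| |
      |by []]; last by apply: (@lready_frame _ 0 _ _ _ s3 s4 _ r3); exact: isTemp_enum f4.
    by apply: ready_frame f4 rF3 => r; exact: isTemp_msg.
  have [s5 [tr5 [x5 e5 _]]] := h4 I s4 nu0 vI i4 (hg (elimN eqP nz)).
  (* The additional step is the guard, charged to the time before the first answer. *)
  apply: (enumerates_weak szp (d := d + A + 1)); first by lia.
  apply: (exec_enumerates (c := program ars n hd F chk ls) (tr := tr0 ++ None :: tr5)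
    (tr1 := None :: tr5) _ _ sil0) => //.
    by apply: (XSeq y0); apply: XIfT x5; rewrite -/(exb _ _) -/s4 k4; exact/eqP.
  apply: (etr_enumtr (a := 1 + A + 0)); first by lia.
  have -> : None :: tr5 = [:: None] ++ tr5 ++ [::] by rewrite cats0.
  apply: etr_pad => //; apply: etr_weak e5 => //; lia.
Qed.

(** * Enumeration plans *)

Section Gen.
Variable K : comNzSemiRingType.
Implicit Types (L : seq (seq nat * K)).

Lemma gen_rcons L e xs ys : gen (rcons L e) xs ys = gen_step xs ys (gen L xs ys) e.
Proof. by rewrite /gen foldl_rcons. Qed.

Lemma gen_uniq L xs ys : uniq (gen L xs ys).
Proof.
elim/last_ind: L => // L e ih; rewrite gen_rcons /gen_step.
by case: ifP => // /andP[_ h]; rewrite rcons_uniq h.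
Qed.

Lemma genP L xs ys p : reflect
  (exists2 e, e \in L & consistent xs e.1 /\ p = map (asg xs e.1) ys)
  (p \in gen L xs ys).
Proof.
elim/last_ind: L => [|L e ih]; first by right; case.
rewrite gen_rcons /gen_step.
have [/andP[ce ne]|h] := ifP.
  rewrite mem_rcons inE; apply: (iffP orP).
    case=> [/eqP->|/ih[e' he' h]]; first by exists e; rewrite // mem_rcons mem_head.
    by exists e' => //; rewrite mem_rcons inE he' orbT.
  case=> e'; rewrite mem_rcons inE => /orP[/eqP->|he'] [h1 h2].
    by left; apply/eqP.
  by right; apply/ih; exists e'.
apply: (iffP ih) => -[e' he' h'].
  by exists e' => //; rewrite mem_rcons inE he' orbT.
move: he'; rewrite mem_rcons inE => /orP[/eqP ee|he']; last by exists e'.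
move: h'; rewrite ee => -[h1 h2]; move: h; rewrite h1 /= => /negbFE.
by rewrite -h2 => hp; exact/ih.
Qed.

Lemma gen_asg L xs ys p : p \in gen L xs ys -> map (asg ys p) ys = p.
Proof.
case/genP=> e _ [_ ->]; apply/eq_in_map => y hy; exact: asg_map.
Qed.

Lemma lkp_neq0 L t : lkp L t != 0%R -> exists2 e, e \in L & e.1 = t.
Proof.
move=> h; apply/exists2P; apply: contrapT => nex; move/eqP: h; apply.
rewrite /lkp big_seq_cond big1 // => e /andP[he /eqP et].
by case: nex; exists e.
Qed.

Lemma gen_lkp L xs ys nu : subl ys xs -> lkp L (map nu xs) != 0%R ->
  map nu ys \in gen L xs ys.
Proof.
move=> /allP h /lkp_neq0[e he et]; apply/genP; exists e => //.
have ex x : x \in xs -> asg xs e.1 x = nu x by move=> hx; rewrite et asg_map.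
split; last by apply/eq_in_map => y /h/ex ->.
by rewrite /consistent {2}et; apply/eqP/eq_in_map.
Qed.

End Gen.

Lemma subseteq_nil (s : seq nat) : {subset s <= [::]} -> s = [::].
Proof. by case: s => // x s /(_ x (mem_head _ _)). Qed.

(** [k] recovers from an element the label [h] of its block, so blocks with different labels are
    disjoint. *)
Lemma uniq_flatten_map (T : Type) (U V : eqType) (s : seq T) (F : T -> seq U)
    (h : T -> V) (k : U -> V) :
  uniq (map h s) -> (forall x, uniq (F x)) ->
  (forall x u, u \in F x -> k u = h x) -> uniq (flatten (map F s)).
Proof.
move=> + uF kh; elim: s => //= x s ih /andP[hx us].
rewrite cat_uniq uF ih // andbT; apply/hasPn => u hu; apply/negP => hux.
move/negP: hx; apply; rewrite -(kh _ _ hux).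
elim: (s) hu => //= y s' ih'; rewrite mem_cat inE.
by case/orP=> [/kh->|/ih'->]; rewrite ?eqxx ?orbT.
Qed.

Section Plan.
Variables (K : comNzSemiRingType) (ars : seq nat) (nc : nat).
Hypothesis hK : semi_integral K.
Implicit Types (I : inst K).

Lemma mulr_neq0P (a b : K) : (a * b != 0)%R = (a != 0%R) && (b != 0%R).
Proof.
apply/idP/andP => [h|[ha hb]].
  by split; apply: contra h => /eqP->; rewrite ?mul0r ?mulr0.
apply/eqP => /hK[] /eqP; [exact: negP ha|exact: negP hb].
Qed.

Lemma natr_bool_neq0 (b : bool) : ((b : nat)%:R != 0 :> K)%R = b.
Proof. by case: b; rewrite ?oner_eq0 ?eqxx. Qed.

Definition proper_inst I := valid ars I /\ forall c, 0 < cv I c.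

Definition lvars l := match l with LInt x _ _ => [:: x] | LRel _ _ ys _ _ => ys end.

Fixpoint bnd (B : seq nat) ls := if ls is l :: ls' then bnd (lvars l ++ B) ls' else B.

Definition wflv (B : seq nat) l :=
  match l with
  | LInt x c cs => (x \notin B) && ((c < nc) && all (fun c => c < nc) cs)
  | LRel R xs ys f zs => [&& wf ars nc f, wfgen ars R xs ys zs f, uniq ys &
          subl zs B && all (fun y => (y \in B) ==> (y \in zs)) ys]
  end.

Lemma wfl_rcons hd F B ls l : wfl ars nc [::] TOne B ls -> wflv (bnd B ls) l ->
  subl hd (lvars l ++ bnd B ls) -> subl (fv F) (lvars l ++ bnd B ls) ->
  wfl ars nc hd F B (rcons ls l).
Proof.
elim: ls B => [|[x c cs|R xs ys f zs] ls ih] B /=.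
- by case: l => [x c cs|R xs ys f zs] _ /= h h1 h2; [case/andP: h => -> ->|case/and4P: h => -> -> -> ->]; rewrite h1 h2.
- by move=> /and3P[-> -> h] h1 h2 h3 /=; exact: ih.
- by move=> /and5P[-> -> -> -> h] h1 h2 h3 /=; exact: ih.
Qed.

Lemma wfl_any hd F B ls : wfl ars nc [::] TOne B ls -> subl hd (bnd B ls) ->
  subl (fv F) (bnd B ls) -> wfl ars nc hd F B ls.
Proof.
elim: ls B => [|[x c cs|R xs ys f zs] ls ih] B /=; first by move=> _ -> ->.
- by move=> /and3P[-> -> h] h1 h2 /=; exact: ih.
- by move=> /and5P[-> -> -> -> h] h1 h2 /=; exact: ih.
Qed.

Lemma bnd_rcons B ls l : bnd B (rcons ls l) = lvars l ++ bnd B ls.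
Proof. by elim: ls B => //= l' ls ih B. Qed.

Lemma loops_rcons I ls l nu :
  loops I (rcons ls l) nu = flatten [seq level_step I l nu' | nu' <- loops I ls nu].
Proof.
elim: ls nu => [|l' ls ih] nu /=.
  by rewrite cats0; elim: (level_step I l nu) => //= a s ->.
by elim: (level_step I l' nu) => //= a s ihs; rewrite map_cat flatten_cat -ihs ih.
Qed.

Lemma good_rcons I ls l nu : good I ls nu ->
  (forall nu', nu' \in loops I ls nu -> level_step I l nu' <> [::]) ->
  good I (rcons ls l) nu.
Proof.
elim: ls nu => [|l' ls ih] nu /=.
  by move=> _ h; split; [apply: h; exact: mem_head|].
move=> [h1 h2] h; split=> // nu' hnu'; apply: ih; first exact: h2.
by move=> nu'' h''; apply: h; apply/flattenP; exists (loops I ls nu') => //; exact: map_f.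
Qed.

(* Running the loops [ls] enumerates, without repetition on the bound variables,
   the valuations satisfying [P]; there is one if and only if [chk] is nonzero. *)
Definition plan (ls : seq level) (chk : tm) (P : inst K -> (nat -> nat) -> Prop) :=
  [/\ wf ars nc chk /\ fv chk = [::], wfl ars nc [::] TOne [::] ls,
      forall I nu mu, {in bnd [::] ls, nu =1 mu} -> P I nu -> P I mu &
      forall I, proper_inst I -> forall mu0,
        (eval I chk mu0 = 0%R -> forall mu, ~ P I mu) /\
        (eval I chk mu0 <> 0%R -> [/\ good I ls nu0,
           forall nu, nu \in loops I ls nu0 -> P I nu,
           forall mu, P I mu -> exists2 nu, nu \in loops I ls nu0 &
             {in bnd [::] ls, nu =1 mu}
         & uniq [seq map nu (bnd [::] ls) | nu <- loops I ls nu0]])].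

Lemma plan_nil : plan [::] TOne (fun _ _ => True).
Proof.
split=> // I _ mu0; split=> /=; first by move/eqP; rewrite oner_eq0.
by move=> _; split=> // mu _; exists nu0; rewrite ?mem_head.
Qed.

Lemma plan_eq ls chk P P' : plan ls chk P ->
  (forall I nu, P I nu <-> P' I nu) -> plan ls chk P'.
Proof.
move=> h e; have -> : P' = P by apply/funext => I; apply/funext => nu; apply/propext; rewrite e.
by [].
Qed.

(** A closed factor does not depend on the valuation, so it can be decided in [chk] before any loop
    starts. Without zero divisors, one product represents all such tests. *)
Lemma plan_closed ls chk P t : plan ls chk P -> wf ars nc t -> fv t = [::] ->
  plan ls (TMul chk t) (fun I nu => P I nu /\ eval I t nu <> 0%R).
Proof.
move=> [[w1 f1] w2 hd h] wt ft.
have et I nu mu : eval I t nu = eval I t mu by apply: eval_fv => x; rewrite ft.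
split=> /=; first by rewrite w1 wt f1 ft.
- by [].
- by move=> I nu mu e [p1 p2]; split; [exact: hd e p1|rewrite (et _ _ nu)].
move=> I pI mu0; have [h1 h2] := h I pI mu0; split.
  move=> z mu [p1 p2]; have /hK[/h1|] := z; first by move=> /(_ mu).
  by rewrite (et _ _ mu).
move=> nz; have [] : (eval I chk mu0 != 0%R) && (eval I t mu0 != 0%R).
  by rewrite -mulr_neq0P; apply/eqP.
case/andP=> /eqP c1 /eqP c2; have [g1 g2 g3 g4] := h2 c1; split=> //.
- by move=> nu /g2 pn; split=> //; rewrite (et _ _ mu0).
- by move=> mu [p1 _]; exact: g3.
Qed.

(** Constants denote positive integers, so interval loops have no dead ends. *)
Lemma vmin_gt0 I c cs : proper_inst I -> 0 < vmin I c cs.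
Proof.
move=> [_ h]; rewrite /vmin; elim: cs (cv I c) (h c) => //= c' cs ih a ha.
by apply: ih; rewrite leq_min ha h.
Qed.

Lemma plan_int ls chk P x c cs : plan ls chk P -> x \notin bnd [::] ls ->
  c < nc -> all (fun c => c < nc) cs ->
  plan (rcons ls (LInt x c cs)) chk
    (fun I nu => P I nu /\ 0 < nu x <= vmin I c cs).
Proof.
move=> [w1 w2 hd h] xY hc hcs.
split=> //.
- by apply: wfl_rcons => //=; rewrite xY hc.
- move=> I nu mu; rewrite bnd_rcons /= => e [p1 p2]; split.
    by apply: hd p1 => y hy; rewrite e // inE hy orbT.
  by rewrite -(e x) ?mem_head.
move=> I pI mu0; have [h1 h2] := h I pI mu0; split.
  by move=> /h1 hn mu [/hn].
move=> /h2[g1 g2 g3 g4]; rewrite bnd_rcons loops_rcons /=.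
set N := vmin I c cs.
have up nu i : {in bnd [::] ls, updn nu x i =1 nu}.
  by move=> y hy; rewrite /updn; case: eqP => // e; rewrite -e hy in xY.
split.
- apply: good_rcons => // nu' _ /=.
  by have := vmin_gt0 c cs pI; case: (vmin I c cs).
- move=> nu /flattenP[s /mapP[nu' hnu' ->] /mapP[i hi ->]].
  split; last by rewrite /updn eqxx /=; move: hi; rewrite mem_iota.
  by apply: hd (g2 _ hnu') => y hy; rewrite up.
- move=> mu [/g3[nu hnu e] /andP[m0 mN]].
  exists (updn nu x (mu x)).
    apply/flattenP; exists (level_step I (LInt x c cs) nu); first exact: map_f.
    apply/mapP; exists (mu x).-1; last by rewrite prednK.
    by rewrite mem_iota add0n prednK.
  move=> y; rewrite inE /updn; case: eqP => [->//|_] /= hy; exact: e.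
- rewrite map_flatten -map_comp.
  (* The new variable is listed first, so [behead] recovers the outer valuation. *)
  apply: (uniq_flatten_map (h := fun nu => map nu (bnd [::] ls)) (k := behead)) => //.
    move=> nu /=; rewrite -map_comp map_inj_in_uniq ?iota_uniq // => i j _ _ /=.
    by rewrite /updn eqxx => -[].
  move=> nu u /mapP[nu' /mapP[i _ ->] ->] /=.
  by apply/eq_in_map => y hy; rewrite up.
Qed.

(** The hypothesis on [TAny] excludes dead ends: what the outer loops have established must already
    imply a matching projection of nonzero weight. *)
Lemma plan_rel ls chk P R xs ys f zs : plan ls chk P ->
  wflv (bnd [::] ls) (LRel R xs ys f zs) ->
  (forall I nu, proper_inst I -> P I nu -> eval I (TAny R xs ys f zs zs) nu <> 0%R) ->
  plan (rcons ls (LRel R xs ys f zs)) chk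
    (fun I nu => [/\ P I nu, map nu ys \in gen (rl I R) xs ys & eval I f nu <> 0%R]).
Proof.
move=> [w1 w2 hd h] wl hany.
have := wl => /= /and4P[_ /and5P[_ _ _ /allP szy /allP fy] uy /andP[/allP szB /allP yB]].
split=> //.
- exact: wfl_rcons.
- move=> I nu mu; rewrite bnd_rcons /= => e [p1 p2 p3]; split.
  + by apply: hd p1 => y hy; rewrite e // mem_cat hy orbT.
  + rewrite (_ : map mu ys = map nu ys) //; apply/eq_in_map => y hy.
    by rewrite e // mem_cat hy.
  + rewrite (@eval_fv _ I f _ nu) // => y /fy hy; by rewrite e // mem_cat hy.
move=> I pI mu0; have [h1 h2] := h I pI mu0; split.
  by move=> /h1 hn mu [/hn].
move=> /h2[g1 g2 g3 g4]; rewrite bnd_rcons loops_rcons /=.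
have inG nu p : p \in group I R xs ys f zs (map nu zs) =
  [&& eval I f (asg ys p) != 0%R, keyed ys zs (map nu zs) p & p \in gen (rl I R) xs ys].
  by rewrite mem_rev mem_filter -andbA.
have ovf nu p : eval I f (ovr ys p nu) = eval I f (asg ys p).
  by apply: eval_fv => y /fy hy; rewrite /ovr hy.
have ovB nu p : keyed ys zs (map nu zs) p -> {in bnd [::] ls, ovr ys p nu =1 nu}.
  move=> kp y hy; rewrite /ovr; case: ifP => // hyy.
  have yz : y \in zs by move: (yB y hyy); rewrite hy.
  by move: kp => /eqP /eq_in_map; apply.
have ovy nu p : p \in gen (rl I R) xs ys -> map (ovr ys p nu) ys = p.
  by move=> hp; rewrite -[RHS](gen_asg hp); apply/eq_in_map => y hy; rewrite /ovr hy.
split.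
- apply: good_rcons => // nu' hnu' /=.
  move: (hany I nu' pI (g2 _ hnu')) => /= /eqP; rewrite natr_bool_neq0 -has_count.
  case/hasP=> p hp /andP[kp fp] e.
  have : p \in group I R xs ys f zs (map nu' zs) by rewrite inG fp kp.
  by case: (group _ _ _ _ _ _ _) e.
- move=> nu /flattenP[s /mapP[nu' hnu' ->] /mapP[p]].
  rewrite inG => /and3P[fp kp gp ->]; split.
  + by apply: hd (g2 _ hnu') => y hy; rewrite ovB.
  + by rewrite ovy.
  + by rewrite ovf; apply/eqP.
- move=> mu [/g3[nu hnu e] gp fp].
  set p := map mu ys in gp.
  have pm : {in ys, asg ys p =1 mu} by move=> y hy; rewrite /p asg_map.
  exists (ovr ys p nu).
    apply/flattenP; exists (level_step I (LRel R xs ys f zs) nu); first exact: map_f.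
    apply/mapP; exists p => //; rewrite inG gp andbT; apply/andP; split.
      by rewrite (@eval_fv _ I f _ mu); [apply/eqP|move=> y /fy hy; rewrite pm].
    by apply/eqP/eq_in_map => y hy; rewrite pm ?szy // e ?szB.
  move=> y; rewrite mem_cat /ovr; case: ifP => [hy _|_ /= hy]; [exact: pm|exact: e].
- rewrite map_flatten -map_comp.
  apply: (uniq_flatten_map (h := fun nu => map nu (bnd [::] ls)) (k := drop (size ys))) => //.
    move=> nu /=; rewrite -map_comp map_inj_in_uniq; first by rewrite rev_uniq filter_uniq // gen_uniq.
    move=> p q; rewrite !inG => /and3P[_ _ gp] /and3P[_ _ gq] /= e.
    by rewrite -(ovy nu p gp) -(ovy nu q gq); move: e; rewrite !map_cat => /eqP; rewrite eqseq_cat ?size_map // => /andP[/eqP].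
  move=> nu u /mapP[nu' /mapP[p]]; rewrite inG => /and3P[_ kp _] -> ->.
  rewrite map_cat drop_size_cat ?size_map //.
  by apply/eq_in_map => y hy; rewrite ovB.
Qed.

End Plan.

(* Running intersection property, parents after children: the variables that an
   edge shares with [h] and the later edges lie in one of these (an index past the
   end stands for [h]). *)
Fixpoint rip (h : seq nat) (s : seq (seq nat)) : Prop :=
  if s is v :: s' then
    rip h s' /\ exists k, forall x, x \in v -> x \in h ++ flatten s' -> x \in nth h s' k
  else True.

(** * Nested loops along a join order of weighted atoms *)

Record item := Item { iR : nat; ixs : seq nat; iys : seq nat; iw : tm }.

Definition scale (it : item) (t : tm) := Item (iR it) (ixs it) (iys it) (TMul (iw it) t).

Lemma split_nth (T : Type) (x0 : T) k (s : seq T) : k < size s ->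
  exists l1 l2, s = l1 ++ nth x0 s k :: l2.
Proof.
move=> h; exists (take k s), (drop k.+1 s).
by rewrite -drop_nth // cat_take_drop.
Qed.

Lemma in_split_iff (T : Type) (a u : T) l1 l2 :
  List.In a (l1 ++ u :: l2) <-> (a = u \/ List.In a (l1 ++ l2)).
Proof.
elim: l1 => [|b l1 ih] /=; first by split=> -[->|h]; auto.
rewrite ih; split; intuition.
Qed.

Section JoinPlan.
Variables (K : comNzSemiRingType) (ars : seq nat) (nc : nat).
Hypothesis hK : semi_integral K.
Implicit Types (I : inst K).

Definition item_ok it :=
  [&& wf ars nc (iw it), wfgen ars (iR it) (ixs it) (iys it) [::] (iw it) & uniq (iys it)].

(** [List.In] is used because items contain terms, for which no decidable equality is declared. *)
Definition sat (its : seq item) I nu := forall it, List.In it its ->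
  map nu (iys it) \in gen (rl I (iR it)) (ixs it) (iys it) /\ eval I (iw it) nu <> 0%R.

Lemma sat_cons it its I nu : sat (it :: its) I nu <->
  (map nu (iys it) \in gen (rl I (iR it)) (ixs it) (iys it) /\ eval I (iw it) nu <> 0%R)
  /\ sat its I nu.
Proof.
split=> [h|[h1 h2] it' /= [<-//|]]; last exact: h2.
by split=> [|it' hi]; apply: h; [left|right].
Qed.

Lemma eval_any I R xs ys f zs nu : eval I (TAny R xs ys f zs zs) nu <> 0%R <->
  exists2 p, p \in gen (rl I R) xs ys &
    keyed ys zs (map nu zs) p /\ eval I f (asg ys p) <> 0%R.
Proof.
split=> [/eqP|[p hp [kp fp]]].
  rewrite /= natr_bool_neq0 -has_count => /hasP[p hp /andP[kp /eqP fp]].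
  by exists p.
apply/eqP; rewrite /= natr_bool_neq0 -has_count; apply/hasP; exists p => //.
by rewrite kp; apply/eqP.
Qed.

Lemma any_of_sat I R xs ys f zs nu : subl zs ys -> subl (fv f) ys ->
  map nu ys \in gen (rl I R) xs ys -> eval I f nu <> 0%R ->
  eval I (TAny R xs ys f zs zs) nu <> 0%R.
Proof.
move=> /allP zy /allP fy hg hf; apply/eval_any; exists (map nu ys) => //.
have e : {in ys, asg ys (map nu ys) =1 nu} by move=> y hy; rewrite asg_map.
split; last by rewrite (@eval_fv _ I f _ nu) // => y /fy; exact: e.
by apply/eqP/eq_in_map => y /zy; exact: e.
Qed.

(** The first item is a leaf, sharing variables with the rest inside one later item [u] or not at
    all. Its filter [TAny] is multiplied into the weight of [u], the rest is planned recursively,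
    and the loop of the leaf becomes the innermost one, where the filter guarantees a match. The
    filter of a leaf that shares nothing is closed and goes to [chk]. *)
Lemma join_plan n : forall its, size its = n -> (forall it, List.In it its -> item_ok it) ->
  rip [::] (map iys its) ->
  exists ls chk, plan (K := K) ars nc ls chk (sat its) /\
    bnd [::] ls =i flatten (map iys its).
Proof.
elim: n => [|n ih] [|it its] //.
  move=> _ _ _; exists [::], TOne; split=> //.
  by apply: plan_eq (plan_nil K ars nc) _ => I nu; split.
move=> [sn] ok /= [hr [k hk]].
have /and3P[wfw wfg uy] : item_ok it by apply: ok; left.
have ok' it' : List.In it' its -> item_ok it' by move=> h; apply: ok; right.
case/and5P: (wfg) => hR sx yx _ fy.
set zs := [seq y <- iys it | y \in flatten (map iys its)].
have zy : subl zs (iys it) by apply/allP => y; rewrite mem_filter => /andP[].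
pose a := TAny (iR it) (ixs it) (iys it) (iw it) zs zs.
have wfg' : wfgen ars (iR it) (ixs it) (iys it) zs (iw it) by rewrite /wfgen hR sx yx zy fy.
have wfa : wf ars nc a by rewrite /= wfw wfg' eqxx.
have step ls chk P : plan (K := K) ars nc ls chk P -> bnd [::] ls =i flatten (map iys its) ->
   (forall I nu, sat its I nu /\ eval I a nu <> 0%R <-> P I nu) ->
   exists ls chk, plan (K := K) ars nc ls chk (sat (it :: its)) /\
    bnd [::] ls =i iys it ++ flatten (map iys its).
  move=> pl hb hP; exists (rcons ls (LRel (iR it) (ixs it) (iys it) (iw it) zs)), chk.
  split; last by move=> y; rewrite bnd_rcons !mem_cat hb.
  apply: plan_eq (plan_rel (zs := zs) pl _ _) _.
  - rewrite /wflv wfw wfg' uy /=; apply/andP; split; apply/allP => y.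
      by rewrite mem_filter hb => /andP[].
    by move=> hy; rewrite hb mem_filter hy andbT implybb.
  - by move=> I nu pI /hP[].
  - move=> I nu; split.
      by case=> /hP[h1 h2] h3 h4; apply/sat_cons.
    move=> /sat_cons[[h1 h2] h3]; split=> //; apply/hP; split=> //.
    exact: any_of_sat.
have [ks|ks] := ltnP k (size its).
- have [l1 [l2 e]] := split_nth it ks.
  set u := nth it its k in e.
  have zu : subl zs (iys u).
    apply/allP => y; rewrite mem_filter => /andP[h1 h2].
    by have := hk y h2 h1; rewrite (nth_map it).
  set its' := l1 ++ scale u a :: l2.
  have emap : map iys its' = map iys its by rewrite e /its' !map_cat.
  have satE I nu : sat its' I nu <-> sat its I nu /\ eval I a nu <> 0%R.
    rewrite e /its'; split.
      move=> h; split; last first.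
        have [_ h2] := h (scale u a) (proj2 (in_split_iff _ _ _ _) (or_introl erefl)).
        by move=> z; apply: h2; rewrite -[LHS]/(eval I (iw u) nu * eval I a nu)%R z mulr0.
      move=> it' /in_split_iff[->|hi].
        have [h1 h2] := h (scale u a) (proj2 (in_split_iff _ _ _ _) (or_introl erefl)).
        by split=> // z; apply: h2; rewrite -[LHS]/(eval I (iw u) nu * eval I a nu)%R z mul0r.
      by apply: h; apply/in_split_iff; right.
    move=> [h1 h2] it' /in_split_iff[->|hi].
      have [h3 h4] := h1 u (proj2 (in_split_iff _ _ _ _) (or_introl erefl)).
      by split=> // /hK[].
    by apply: h1; apply/in_split_iff; right.
  have [] := ih its'.
  + by rewrite -sn e /its' !size_cat.
  + move=> it' /in_split_iff[->|hi]; last by apply: ok'; rewrite e; apply/in_split_iff; right.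
    have /and3P[w1 w2 w3] : item_ok u by apply: ok'; rewrite e; apply/in_split_iff; left.
    case/and5P: w2 => v1 v2 v3 _ v5.
    apply/and3P; split=> //; first by apply/andP.
    rewrite /wfgen v1 v2 v3 /=; rewrite /subl all_cat; apply/andP; split=> //.
  + by rewrite emap.
  move=> ls [chk [pl hb]]; apply: (step ls chk _ pl); first by rewrite -emap.
  by move=> I nu; rewrite satE.
- have zs0 : zs = [::].
    apply: subseteq_nil => y; rewrite mem_filter => /andP[h1 h2].
    by have := hk y h2 h1; rewrite nth_default // size_map.
  have [ls [chk [pl hb]]] := ih its sn ok' hr.
  by apply: (step ls (TMul chk a) _ (plan_closed hK pl wfa _) hb) => //; rewrite /a /= zs0.
Qed.

End JoinPlan.

(** * Eliminating the quantified variables *)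

Section Isum.
Variables (K : comNzSemiRingType).

(** Finite stand-in for a block of quantifiers, legitimate once [N] bounds the support. *)
Fixpoint isum (N : nat) (ys : seq nat) (g : (nat -> nat) -> K) nu : K :=
  if ys is y :: ys' then
    (\sum_(d <- iota 1 N) isum N ys' g (updn nu y d))%R
  else g nu.

(* [g] depends on the variables [X] only. *)
Definition dep (X : seq nat) (g : (nat -> nat) -> K) :=
  forall nu mu, {in X, nu =1 mu} -> g nu = g mu.

Lemma isum_ext N ys g g' nu : (forall mu, g mu = g' mu) -> isum N ys g nu = isum N ys g' nu.
Proof.
by move=> h; elim: ys nu => //= y ys ih nu; apply: eq_bigr => d _; exact: ih.
Qed.

Lemma isum_cat N a b g nu : isum N (a ++ b) g nu = isum N a (isum N b g) nu.
Proof. by elim: a nu => //= y a ih nu; apply: eq_bigr => d _; exact: ih. Qed.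

Lemma updnC nu x y d d' : x != y -> updn (updn nu x d) y d' = updn (updn nu y d') x d.
Proof.
move=> h; apply/funext => z; rewrite /updn; case: (eqVneq z x) => // ->.
by rewrite (negbTE h).
Qed.

Lemma isum_comm1 N y b g nu : isum N [:: y] (isum N b g) nu = isum N b (isum N [:: y] g) nu.
Proof.
elim: b nu => //= z b ih nu; case: (eqVneq y z) ih => [<-|ne] ih.
  (* For equal variables the two updates do not commute, but then the outer sums agree as they
     stand. *)
  by apply: eq_bigr => d _; exact: ih.
rewrite exchange_big /=; apply: eq_bigr => d _; rewrite -ih.
by apply: eq_bigr => d' _; rewrite updnC.
Qed.

Lemma isum_comm N a b g nu : isum N a (isum N b g) nu = isum N b (isum N a g) nu.
Proof.
elim: a nu => //= y a ih nu.
transitivity (isum N [:: y] (isum N b (isum N a g)) nu); first by apply: eq_bigr => d _; exact: ih.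
by rewrite isum_comm1; apply: isum_ext.
Qed.

Lemma isum_perm N a b g nu : perm_eq a b -> isum N a g nu = isum N b g nu.
Proof.
move=> h; apply/esym.
apply: (catCA_perm_ind (P := fun s => isum N s g nu = isum N a g nu) _ h erefl).
have cat s1 s2 : isum N (s1 ++ s2) g = isum N s1 (isum N s2 g).
  by apply/funext => mu; exact: isum_cat.
by move=> s1 s2 s3 <-; rewrite !isum_cat !cat isum_comm.
Qed.

(** Distributivity, the law behind the whole elimination: it turns one global sum into local sums at
    the tuples of single relations. *)
Lemma isum_mull N ys X f g nu : dep X g -> (forall x, x \in X -> x \notin ys) ->
  isum N ys (fun mu => g mu * f mu)%R nu = (g nu * isum N ys f nu)%R.
Proof.
move=> dg; elim: ys nu => //= y ys ih nu h.
rewrite big_distrr; apply: eq_bigr => d _ /=; rewrite ih.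
  congr (_ * _)%R; apply: dg => x /h; rewrite inE negb_or /updn => /andP[/negbTE->] //.
by move=> x /h; rewrite inE negb_or => /andP[].
Qed.

Lemma isum_sum N ys (T : eqType) (s : seq T) (F : T -> (nat -> nat) -> K) nu :
  isum N ys (fun mu => \sum_(p <- s) F p mu)%R nu = (\sum_(p <- s) isum N ys (F p) nu)%R.
Proof.
elim: ys nu => //= y ys ih nu; rewrite exchange_big.
by apply: eq_bigr => d _; exact: ih.
Qed.

Lemma isum_neq0 N ys g nu : isum N ys g nu <> 0%R ->
  exists2 mu, g mu <> 0%R & forall x, x \notin ys -> mu x = nu x.
Proof.
elim: ys nu => [|y ys ih] nu /= h; first by exists nu.
have [d _ hd] : exists2 d, d \in iota 1 N & isum N ys g (updn nu y d) != 0%R.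
  apply/exists2P; apply: contrapT => nex; apply: h; rewrite big_seq big1 // => d hd.
  by apply/eqP/negPn/negP => hd'; apply: nex; exists d.
have [mu gmu e] := ih _ (elimN eqP hd); exists mu => // x.
by rewrite inE negb_or => /andP[/negbTE xy /e->]; rewrite /updn xy.
Qed.

Lemma isum_delta N ws ys (t : nat -> nat) nu : uniq ws -> {subset ws <= ys} ->
  (forall x, x \in ws -> 0 < t x <= N) ->
  isum N ws (fun mu => ((all (fun y => mu y == t y) ys) : nat)%:R)%R nu =
  ((all (fun y => (y \notin ws) ==> (nu y == t y)) ys : nat)%:R)%R.
Proof.
elim: ws nu => [|w ws ih] nu /=.
  by move=> _ _ _; congr (_%:R)%R; congr nat_of_bool; apply: eq_all.
move=> /andP[hw uw] sub ht.
have tw := ht w (mem_head _ _).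
rewrite (bigD1_seq (t w)) ?iota_uniq //=; last by rewrite mem_iota; lia.
rewrite ih //; first last.
- by move=> x hx; apply: ht; rewrite inE hx orbT.
- by move=> x hx; apply: sub; rewrite inE hx orbT.
rewrite big1 ?addr0.
  congr (_%:R)%R; congr nat_of_bool; apply: eq_all => y /=.
  rewrite inE negb_or /updn; case: (eqVneq y w) => [->|_] //=; by rewrite eqxx implybT.
move=> d hd; rewrite ih //; first last.
- by move=> x hx; apply: ht; rewrite inE hx orbT.
- by move=> x hx; apply: sub; rewrite inE hx orbT.
rewrite (_ : all _ _ = false) //; apply/negbTE/allPn; exists w; first exact: sub (mem_head _ _).
by rewrite hw /= /updn eqxx.
Qed.

(** [A] is a sum over [G] of its values times indicators of agreement with [p] on [ys]. Summing such
    an indicator over [ws] removes the conditions on [ws] and leaves those on [zs], which say that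
    [p] has the right key. *)
Lemma isum_reindex N ws ys zs (G : seq (seq nat)) (A : (nat -> nat) -> K) nu :
  uniq ws -> {subset ws <= ys} ->
  (forall y, y \in zs = (y \in ys) && (y \notin ws)) ->
  uniq G -> (forall p, p \in G -> map (asg ys p) ys = p) ->
  (forall p, p \in G -> forall v, v \in p -> 0 < v <= N) ->
  dep ys A -> (forall mu, A mu <> 0%R -> map mu ys \in G) ->
  isum N ws A nu =
  (\sum_(p <- G | keyed ys zs (map nu zs) p) A (asg ys p))%R.
Proof.
move=> uw wy hz uG gG bG dA sA.
have AE mu : A mu = (\sum_(p <- G) A (asg ys p) * ((all (fun y => mu y == asg ys p y) ys) : nat)%:R)%R.
  have aE p : p \in G -> all (fun y => mu y == asg ys p y) ys = (p == map mu ys).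
    move=> hp; rewrite -{2}(gG p hp); apply/allP/eqP => [h|/eq_in_map h y /h->//].
    by apply/eq_in_map => y /h/eqP->.
  have eA p : p \in G -> p = map mu ys -> A (asg ys p) = A mu.
    by move=> hp e; apply: dA => y hy; rewrite e asg_map.
  have [z|nz] := eqVneq (A mu) 0%R.
    rewrite z big_seq big1 // => p hp; rewrite aE //; case: eqP => [e|_]; last by rewrite mulr0.
    by rewrite eA // z mul0r.
  have hp := sA _ (elimN eqP nz).
  rewrite (bigD1_seq _ hp uG) /= big_seq_cond big1 ?addr0.
    by rewrite aE // eqxx mulr1 eA.
  by move=> p /andP[hp' ne]; rewrite aE // (negbTE ne) mulr0.
rewrite (isum_ext _ _ _ AE) isum_sum [RHS]big_mkcond.
rewrite big_seq [RHS]big_seq; apply: eq_bigr => p hp.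
rewrite (@isum_mull N ws [::]) // isum_delta //; last first.
  by move=> x /wy hx; apply: (bG p hp); rewrite -{2}(gG p hp); exact: (map_f (asg ys p)).
have -> : all (fun y => (y \notin ws) ==> (nu y == asg ys p y)) ys = keyed ys zs (map nu zs) p.
  apply/allP/eqP => [h|/eq_in_map h y hy].
    by apply/eq_in_map => y; rewrite hz => /andP[/h hy yw]; move: hy; rewrite yw => /eqP->.
  by apply/implyP => yw; rewrite h // hz hy yw.
by case: ifP => _; rewrite ?mulr1 ?mulr0.
Qed.

End Isum.

(** * Leaf-to-root elimination along a join order *)

Section SumElim.
Variables (K : comNzSemiRingType) (ars : seq nat) (nc : nat).
Implicit Types (I : inst K).

Definition bounded I N := forall R, R < size ars -> forall e, e \in rl I R ->
  forall v, v \in e.1 -> 0 < v <= N.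

(** The last clause confines the weight to tuples of the relation, so that a sum over valuations can
    become a sum over tuples. *)
Definition sum_item it :=
  [/\ wf ars nc (iw it), wfgen ars (iR it) (ixs it) (iys it) [::] (iw it),
      iys it = undup (ixs it)
    & forall I nu, eval I (iw it) nu <> 0%R ->
        lkp (rl I (iR it)) (map nu (ixs it)) != 0%R].

Lemma gen_bounded I N R xs ys p : bounded I N -> R < size ars -> subl ys xs ->
  p \in gen (rl I R) xs ys -> forall v, v \in p -> 0 < v <= N.
Proof.
move=> hb hR /allP yx /genP[e he [/eqP ce ->]] v /mapP[y hy ->].
by apply: (hb R hR e he); rewrite -{2}ce; apply: (map_f (asg xs e.1)); exact: yx.
Qed.

Lemma dep_eval I t X : subl (fv t) X -> dep X (eval I t).
Proof. by move=> /allP h nu mu e; apply: eval_fv => x /h; exact: e. Qed.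

Lemma dep_prod I its X : (forall it, List.In it its -> subl (fv (iw it)) X) ->
  dep X (fun mu => \prod_(it <- its) eval I (iw it) mu)%R.
Proof.
move=> h nu mu e; elim: its h => [|it its ih] h; first by rewrite !big_nil.
rewrite !big_cons ih; last by move=> it' hi; apply: h; right.
by rewrite (dep_eval _ _ e) //; apply: h; left.
Qed.

(** The private variables of the first item can be summed first, as no other factor depends on them.
    The resulting function of [zs] is multiplied into the parent; if the parent is the head it
    becomes one of the factors [ms]. That each factor fits inside one item is recorded for the
    loops, where some relation has to carry it. *)
Lemma sum_elim h n : forall its, size its = n ->
  (forall it, List.In it its -> sum_item it) -> rip h (map ixs its) ->
  exists ms : seq tm,
    (forall m, List.In m ms -> [/\ wf ars nc m, subl (fv m) h &
       exists2 it, List.In it its & subl (fv m) (iys it)]) /\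
    forall I N nu ws, valid ars I -> bounded I N -> uniq ws ->
      (forall x, x \in ws = (x \in flatten (map ixs its)) && (x \notin h)) ->
      isum N ws (fun mu => \prod_(it <- its) eval I (iw it) mu)%R nu =
      (\prod_(m <- ms) eval I m nu)%R.
Proof.
elim: n => [|n ih] [|it its] //.
  move=> _ _ _; exists [::]; split=> // I N nu [|w ws] _ _ _ hw /=.
    by rewrite !big_nil.
  by have := hw w; rewrite mem_head.
move=> [sn] ok /= [hr [k hk]].
have [wfw wfg ey sup] : sum_item it by apply: ok; left.
have ok' it' : List.In it' its -> sum_item it' by move=> hi; apply: ok; right.
case/and5P: (wfg) => hR sx yx _ fy.
set R := iR it in hR sx wfg sup *; set xs := ixs it in sx yx wfg ey hk sup *.
set ys := iys it in ey yx fy wfg *.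
set rest := h ++ flatten (map ixs its) in hk.
set zs := [seq x <- ys | x \in rest].
(* The private variables of the first item: neither in the head nor in a later item. *)
set wit := [seq x <- ys | x \notin zs].
have uy : uniq ys by rewrite ey undup_uniq.
have zy : subl zs ys by apply/allP => y; rewrite mem_filter => /andP[].
pose m := TSum R xs ys (iw it) zs zs.
have wfg' : wfgen ars R xs ys zs (iw it) by rewrite /wfgen hR sx yx zy fy.
have wfm : wf ars nc m by rewrite /= wfw wfg' eqxx.
have mE I N mu : valid ars I -> bounded I N -> isum N wit (eval I (iw it)) mu = eval I m mu.
  move=> vI bI; apply: isum_reindex.
  - by rewrite filter_uniq.
  - by move=> y; rewrite mem_filter => /andP[].
  - by move=> y; rewrite !mem_filter; case: (y \in ys); rewrite ?andbF //= !andbT negbK.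
  - exact: gen_uniq.
  - by move=> p; exact: gen_asg.
  - by move=> p hp; exact: gen_bounded bI hR yx hp.
  - exact: dep_eval.
  - by move=> nu' /sup; exact: gen_lkp.
set wrest := undup [seq x <- flatten (map ixs its) | x \notin h].
have hwrest x : x \in wrest = (x \in flatten (map ixs its)) && (x \notin h).
  by rewrite mem_undup mem_filter andbC.
have fits it' : List.In it' its -> subl (fv (iw it')) (flatten (map ixs its)).
  move=> hi; have [_ /and5P[_ _ /allP a _ /allP b] _ _] := ok' _ hi.
  apply/allP => x /b/a hx; apply/flattenP; exists (ixs it') => //.
  by elim: (its) hi => //= i l ihl [->|/ihl hi]; rewrite inE ?eqxx // hi orbT.
have split_sum I N nu ws : valid ars I -> bounded I N -> uniq ws ->
   (forall x, x \in ws = (x \in xs ++ flatten (map ixs its)) && (x \notin h)) ->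
   isum N ws (fun mu => \prod_(it <- it :: its) eval I (iw it) mu)%R nu =
   isum N wrest (fun mu => (\prod_(it <- its) eval I (iw it) mu) * eval I m mu)%R nu.
  move=> vI bI uw hw.
  have pw : perm_eq ws (wrest ++ wit).
    have mw x : x \in wit = [&& x \in xs, x \notin h & x \notin flatten (map ixs its)].
      rewrite mem_filter mem_filter /rest mem_cat ey mem_undup.
      by case: (x \in xs); rewrite ?andbF ?andbT //= negb_or.
    apply: uniq_perm => //.
      rewrite cat_uniq undup_uniq filter_uniq // andbT /=; apply/hasPn => x.
      by rewrite mw hwrest => /and3P[_ _ /negbTE->].
    move=> x; rewrite hw !mem_cat mw hwrest.
    by case: (x \in xs); case: (x \in flatten _); case: (x \in h).
  rewrite (isum_perm _ _ _ pw) isum_cat; apply: isum_ext => mu.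
  rewrite -(mE I N) //.
  have dp := dep_prod I fits.
  apply: etrans (isum_mull N (eval I (iw it)) mu dp (ys := wit) _).
    by apply: isum_ext => nu'; rewrite big_cons mulrC.
  move=> x hx; rewrite mem_filter mem_filter /rest mem_cat hx orbT /=.
  by case: (x \in ys).
have [ks|ks] := ltnP k (size its).
- have [l1 [l2 e]] := split_nth it ks.
  set u := nth it its k in e.
  have [u1 u2 u3 u4] : sum_item u by apply: ok'; rewrite e; apply/in_split_iff; left.
  have zu : subl zs (iys u).
    apply/allP => y; rewrite mem_filter => /andP[h1 h2].
    have hyx : y \in xs by move: h2; rewrite ey mem_undup.
    by rewrite u3 mem_undup; have := hk y hyx h1; rewrite (nth_map it).
  set its' := l1 ++ scale u m :: l2.
  have emap : map ixs its' = map ixs its by rewrite e /its' !map_cat.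
  have [] := ih its'.
  + by rewrite -sn e /its' !size_cat.
  + move=> it' /in_split_iff[->|hi]; last by apply: ok'; rewrite e; apply/in_split_iff; right.
    case/and5P: u2 => v1 v2 v3 _ v5; split=> //.
    * by apply/andP.
    * rewrite /wfgen v1 v2 v3 /=; rewrite /subl all_cat; apply/andP; split=> //.
    * by move=> I nu hne; apply: u4 => z; apply: hne; rewrite -[LHS]/(eval I (iw u) nu * eval I m nu)%R z mul0r.
  + by rewrite emap.
  move=> ms [h1 h2]; exists ms; split.
    move=> m' /h1[a1 a2 [it' hi a3]]; split=> //.
    case/in_split_iff: hi => [ei|hi].
      by exists u; [right; rewrite e; apply/in_split_iff; left|rewrite ei in a3].
    by exists it' => //; right; rewrite e; apply/in_split_iff; right.
  move=> I N nu ws vI bI uw hw; rewrite split_sum //.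
  rewrite -(h2 I N nu wrest) ?undup_uniq ?emap //.
  apply: isum_ext => mu; rewrite e /its' !big_cat !big_cons /=.
  by rewrite -!mulrA; congr (_ * _)%R; congr (_ * _)%R; rewrite mulrC.
- have zh : subl zs h.
    apply/allP => y; rewrite mem_filter => /andP[h1 h2].
    have hyx : y \in xs by move: h2; rewrite ey mem_undup.
    by have := hk y hyx h1; rewrite nth_default // size_map.
  have [ms [h1 h2]] := ih its sn ok' hr.
  exists (m :: ms); split.
    move=> m' /= [<-|/h1[a1 a2 [it' hi a3]]]; last by split=> //; exists it' => //; right.
    by split=> //; exists it => //; left.
  move=> I N nu ws vI bI uw hw; rewrite split_sum // big_cons -(h2 I N nu wrest) ?undup_uniq //.
  have dm : dep h (eval I m) by exact: dep_eval.
  apply: etrans (isum_mull N _ nu dm (ys := wrest) _).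
    by apply: isum_ext => mu; rewrite mulrC.
  by move=> x hx; rewrite hwrest hx andbF.
Qed.

End SumElim.

(** * Join trees *)

Section Trees.
Variables (E : seq (seq nat)) (e : rel 'I_(size E)).
Hypothesis jt : join_tree e.

Let ed (i : 'I_(size E)) := nth [::] E i.

(** Children come before parents: [p] absorbs whatever [v] shares with the later vertices. *)
Fixpoint tree_order (s : seq 'I_(size E)) : Prop :=
  if s is v :: s' then
    tree_order s' /\ (s' = [::] \/ exists2 p, p \in s' &
      forall x j, j \in s' -> x \in ed v -> x \in ed j -> x \in ed p)
  else True.

Lemma path_cross (A : seq 'I_(size E)) x p : path e x p -> x \in A ->
  last x p \notin A -> exists a b, [/\ a \in A, b \notin A & e a b].
Proof.
elim: p x => [|y p ih] x /=; first by move=> _ ->.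
move=> /andP[exy ep] hx hl; case yA : (y \in A); first exact: ih ep yA hl.
by exists x, y; rewrite yA.
Qed.

Definition erel (A : seq 'I_(size E)) : rel 'I_(size E) :=
  [rel a b | [&& e a b, a \in A & b \in A]].

Lemma erel_sym A : connect_sym (erel A).
Proof.
by apply: sym_connect_sym => a b; case: jt => -[se _ _ _] _; rewrite /erel /= se [(a \in A) && _]andbC.
Qed.

Lemma erel_path A x p : path (erel A) x p -> path e x p /\ {subset p <= A}.
Proof.
elim: p x => //= y p ih x /andP[/and3P[h1 h2 h3] /ih[h4 h5]].
by split; [rewrite h1|move=> z; rewrite inE => /orP[/eqP->|/h5]].
Qed.

(* In a tree, a path from a new vertex to a connected part enters it through the
   unique edge [v - p], otherwise the tree would contain a cycle. *)
Lemma unique_entry (A : seq 'I_(size E)) v p q : v \notin A -> p \in A -> e v p ->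
  {in A &, forall a b, connect (erel A) a b} ->
  path e v q -> uniq (v :: q) -> last v q \in A -> exists q', q = p :: q'.
Proof.
move=> vA pA evp cA pq uq lq.
have [[se _ _ cyc] _] := jt.
case: q pq uq lq => [|q1 q'] pq uq lq; first by rewrite /= (negbTE vA) in lq.
have [<-|ne] := eqVneq q1 p; first by exists q'.
set q := q1 :: q' in pq uq lq.
have hq : has (mem A) q.
  by apply/hasP; exists (last v q) => //; exact: (mem_last q1 q').
have fs : find (mem A) q < size q by rewrite -has_find.
set a1 := take (find (mem A) q) q; set a := nth v q (find (mem A) q).
set a2 := drop (find (mem A) q).+1 q.
have eq : q = a1 ++ a :: a2 by rewrite /a1 /a /a2 -drop_nth // cat_take_drop.
have aA : a \in A by have := nth_find v hq.
have a1A : all (fun x => x \notin A) a1.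
  apply/(all_nthP v) => i; rewrite size_take fs => hi.
  by rewrite nth_take //; have /= -> := before_find v hi.
have /connectP[c0 pc0 lc0] := cA _ _ aA pA.
case/shortenP: pc0 lc0 => c pc uc _ lc.
have [ec sc] := erel_path pc.
(* Go from [v] outside [A] to the first vertex [a] in [A], inside [A] on to [p], and back to [v].
   This cycle is too long unless [a] is [p] and comes directly after [v]. *)
have cy : ucycle e (v :: a1 ++ a :: c).
  rewrite /ucycle; apply/andP; split.
    rewrite /cycle -cats1 -catA cat_path; move: pq; rewrite eq cat_path => /andP[-> /=].
    by move=> /andP[-> _] /=; rewrite cat_path ec /= andbT -lc se.
  move: uq; rewrite eq !cons_uniq cat_uniq mem_cat negb_or => /andP[/andP[va1 _] /and3P[ua1 _ _]].
  rewrite mem_cat negb_or va1 cat_uniq ua1 uc !andTb !andbT.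
  have sub x : x \in a :: c -> x \in A by rewrite inE => /orP[/eqP->|/sc].
  apply/andP; split; first by apply: contra vA; exact: sub.
  apply/hasPn => x hx /=; apply/negP => hx1.
  by move/allP: a1A => /(_ x hx1); rewrite sub.
have := cyc _ cy; rewrite /= size_cat /= addnS !ltnS leqn0 addn_eq0.
move=> /andP[/nilP a10 /nilP c0'].
move: eq; rewrite a10 /q => -[e1 _].
by move: lc ne; rewrite c0' /= -e1 => <-; rewrite eqxx.
Qed.

(** A connected set grows from [r] by one adjacent vertex [v] at a time. If [v] shares [x] with a
    vertex of the set, some path along edges containing [x] joins them; it has to enter the set
    through the neighbour [p] of [v], so [p] contains [x]. *)
Lemma tree_orderP (r : 'I_(size E)) : exists s, [/\ tree_order (rcons s r),
  uniq (rcons s r) & forall i, i \in rcons s r].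
Proof.
have [[se irr conn _] jx] := jt.
have E0 : 0 < size E := leq_ltn_trans (leq0n _) (ltn_ord r).
suff gen m : m < size E -> exists s, [/\ tree_order (rcons s r), uniq (rcons s r),
    size s = m & {in rcons s r &, forall a b, connect (erel (rcons s r)) a b}].
  have hs : (size E).-1 < size E by rewrite prednK.
  have [s [h1 h2 h3 _]] := gen _ hs; exists s; split=> // i.
  have sub : {subset rcons s r <= enum 'I_(size E)} by move=> j _; rewrite mem_enum.
  have le : size (enum 'I_(size E)) <= size (rcons s r).
    by rewrite size_enum_ord size_rcons h3 prednK.
  by have [_ ->] := uniq_min_size h2 sub le; rewrite mem_enum.
elim: m => [|m ih] hm.
  exists [::]; split=> //=; first by split=> //; left.
  by move=> a b; rewrite !inE => /eqP-> /eqP->.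
have [s [h1 h2 h3 h4]] := ih (ltnW hm).
set A := rcons s r in h1 h2 h4.
have [y yA] : exists y, y \notin A.
  apply/existsP; rewrite -negb_forall; apply/negP => /forallP hall.
  have := @uniq_leq_size _ (enum 'I_(size E)) A (enum_uniq _) (fun i _ => hall i).
  by rewrite size_enum_ord size_rcons h3 leqNgt hm.
have rA : r \in A by rewrite mem_rcons mem_head.
have /connectP[q pq lq] := conn r y.
have [p [v [pA vA epv]]] : exists a b, [/\ a \in A, b \notin A & e a b].
  by apply: path_cross pq rA _; rewrite -lq.
have evp : e v p by rewrite se.
exists (v :: s); rewrite rcons_cons -/A; split=> /=.
- split=> //; right; exists p => // x j jA xv xj.
  have /connectP[q0 pq0 lq0] := jx x v j xv xj.
  case/shortenP: pq0 lq0 => q1 pq1 uq1 _ lq1.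
  have pe : path e v q1.
    by apply: sub_path pq1 => a b /= /and3P[].
  have [q2 eq2] := unique_entry vA pA evp h4 pe uq1 (ltac:(by rewrite -lq1)).
  by move: pq1; rewrite eq2 /= => /andP[/and3P[]].
- by rewrite vA.
- by rewrite h3.
- have sub a b : connect (erel A) a b -> connect (erel (v :: A)) a b.
    apply: connect_sub => c d /= /and3P[ecd cA dA]; apply: connect1.
    by rewrite /erel /= ecd !inE cA dA !orbT.
  have pv : connect (erel (v :: A)) p v.
    by apply: connect1; rewrite /erel /= epv !inE pA eqxx orbT.
  have toP a : a \in v :: A -> connect (erel (v :: A)) p a.
    rewrite inE => /orP[/eqP->//|aA]; exact: sub (h4 _ _ pA aA).
  move=> a b ha hb; apply: connect_trans (toP b hb).
  by rewrite erel_sym; exact: toP.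
Qed.

Lemma tree_order_rip h s r : tree_order (rcons s r) -> {subset h <= ed r} ->
  (forall x, x \in ed r -> x \in h) -> rip h (map ed s).
Proof.
move=> + hr rh; elim: s => //= v s ih [ts hv]; split; first exact: ih.
case: hv => [|[p ps hp]]; first by case: (s).
have hp' x : x \in ed v -> x \in h ++ flatten (map ed s) -> x \in ed p.
  move=> xv; rewrite mem_cat => /orP[/hr xr|/flattenP[t /mapP[j js ->] xt]].
    by apply: (hp x r) => //; rewrite mem_rcons mem_head.
  by apply: (hp x j) => //; rewrite mem_rcons inE js orbT.
move: ps; rewrite mem_rcons inE => /orP[/eqP pr|ps].
  (* The root is not in [s]; the index past the end makes [h] the parent. *)
  exists (size s) => x xv /(hp' _ xv); rewrite nth_default ?size_map // pr; exact: rh.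
exists (index p s) => x xv /(hp' _ xv).
by rewrite (nth_map p) ?index_mem // nth_index.
Qed.

Lemma tree_order_rip0 s : tree_order s -> rip [::] (map ed s).
Proof.
elim: s => //= v s ih [ts hv]; split; first exact: ih.
case: hv => [->|[p ps hp]]; first by exists 0.
exists (index p s) => x xv /flattenP[t /mapP[j js ->] xt].
by rewrite (nth_map p) ?index_mem // nth_index //; exact: hp js xv xt.
Qed.

End Trees.

Lemma map_iota_nth (T U : Type) x0 (f : T -> U) (s : seq T) :
  [seq f (nth x0 s i) | i <- iota 0 (size s)] = map f s.
Proof. by rewrite -[in RHS](mkseq_nth x0 s) /mkseq -map_comp. Qed.

(** * Conjunctive queries *)

Section Bridge.
Variables (K : comNzSemiRingType) (T C : finType) (a : T -> nat).

Definition sig_ars := [seq a R | R <- enum T].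
Definition ridx (R : T) := index R (enum T).
Definition cidx (c : option C) := if c is Some c' then (index c' (enum C)).+1 else 0.

(** The default 1 keeps all constants positive, also those beyond the range of the vocabulary. *)
Definition mkinst (l : T -> seq (seq nat * K)) (v : C -> nat) : inst K :=
  Inst (fun i => nth [::] [seq l R | R <- enum T] i)
       (fun c => nth 1 (1 :: [seq v c | c <- enum C]) c).

Lemma ridx_lt R : ridx R < size sig_ars.
Proof. by rewrite size_map index_mem mem_enum. Qed.

Lemma nth_ars R : nth 0 sig_ars (ridx R) = a R.
Proof. by rewrite (nth_map R) ?index_mem ?mem_enum // nth_index ?mem_enum. Qed.

Lemma rl_mkinst l v R : rl (mkinst l v) (ridx R) = l R.
Proof. by rewrite /= (nth_map R) ?index_mem ?mem_enum // nth_index ?mem_enum. Qed.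

Lemma cidx_lt c : cidx c < #|C|.+1.
Proof. by case: c => //= c; rewrite ltnS cardE index_mem mem_enum. Qed.

Lemma cv_mkinst l v c :
  cv (mkinst l v) (cidx c) = if c is Some c' then v c' else 1.
Proof. by case: c => //= c; rewrite (nth_map c) ?index_mem ?mem_enum // nth_index ?mem_enum. Qed.

Lemma ars_ex i : i < size sig_ars -> exists R, i = ridx R.
Proof.
rewrite size_map => hi; have [R _] : exists R : T, True.
  by case: (enum T) hi => // R; exists R.
exists (nth R (enum T) i); rewrite /ridx index_uniq ?enum_uniq //.
Qed.

Lemma word_mkinst l v : word sig_ars #|C| (mkinst l v) =
  flatten [seq rel_word (l R) | R <- enum T] ++ [seq inl (v c) | c <- enum C].
Proof.
rewrite /word; congr (_ ++ _).
  congr flatten; rewrite size_map -(size_map l).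
  by rewrite (map_iota_nth [::] (@rel_word K)) -map_comp.
rewrite -[1]addn0 iotaDl -map_comp cardE -(size_map v).
by rewrite (map_iota_nth 1 (inl : nat -> token K)) -map_comp.
Qed.

Definition encoding (L : T -> seq (seq nat * K)) (v : C -> nat) (w : seq (token K)) :=
  exists2 r : T -> seq (token K), forall R, listing (L R) (r R)
    & w = flatten [seq r R | R <- enum T] ++ [seq inl (v c) | c <- enum C].

(** The input word fixes an order of the entries, so the machine works on a permutation [l] of
    [L]. *)
Lemma encodingP L v w : encoding L v w -> exists2 l, forall R, perm_eq (l R) (L R)
  & w = word sig_ars #|C| (mkinst l v).
Proof.
case=> r hr ->.
pose l R := projT1 (cid2 (hr R)).
exists l => [R|]; first by rewrite /l; case: (cid2 _).
rewrite word_mkinst; congr (flatten _ ++ _); apply: eq_map => R.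
by rewrite /l; case: (cid2 _).
Qed.

Definition positive_inst (I : inst K) := proper_inst sig_ars I /\ exists N, bounded sig_ars I N.

Lemma mkinst_positive L l v : (forall R, perm_eq (l R) (L R)) ->
  (forall R e, e \in L R -> size e.1 = a R /\ forall x, x \in e.1 -> 0 < x) ->
  (forall c, 0 < v c) -> positive_inst (mkinst l v).
Proof.
move=> pl hL hv; split; first split.
- move=> i /ars_ex[R ->] e; rewrite rl_mkinst nth_ars (perm_mem (pl R)).
  by move=> /hL[].
- case=> // c /=; have [h|h] := ltnP c (size (map v (enum C))).
    by have /mapP[c' _ ->] := mem_nth 1 h.
  by rewrite nth_default.
(* Any bound would do; the sum of all components of all tuples dominates each of them. *)
- exists (\sum_(R : T) \sum_(e <- l R) \sum_(x <- e.1) x).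
  move=> i /ars_ex[R ->] e; rewrite rl_mkinst => he x hx.
  have [_ h] := hL R e (ltac:(by rewrite -(perm_mem (pl R)))).
  rewrite h //= (bigD1 R) //= (big_rem e) //= (big_rem x) //= -!addnA leq_addr //.
Qed.

Theorem from_plan hd F ls chk P :
  plan (K := K) sig_ars #|C|.+1 ls chk P -> wf sig_ars #|C|.+1 F ->
  bnd [::] ls =i hd -> subl (fv F) hd ->
  (forall I nu, positive_inst I ->
     (P I nu <-> eval I F nu <> 0%R /\ forall x, x \in hd -> 0 < nu x)) ->
  exists (p : seq instr) (c : nat), forall L v w,
    (forall R e, e \in L R -> size e.1 = a R /\ forall x, x \in e.1 -> 0 < x) ->
    (forall c, 0 < v c) -> encoding L v w ->
    exists l ans, [/\ forall R, perm_eq (l R) (L R), uniq ans,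
      forall x, x \in ans <-> exists mu, [/\ eval (mkinst l v) F mu <> 0%R,
         forall y, y \in hd -> 0 < mu y
         & x = (map mu hd, eval (mkinst l v) F mu)]
      & enumerates_within p w ans (c * (\sum_(R : T) size (L R)).+1) c].
Proof.
move=> pl wfF hb fF hP.
have [[wc fc] wl _ h] := pl.
have wlF : wfl sig_ars #|C|.+1 hd F [::] ls.
  apply: wfl_any => //; apply/allP => x; first by rewrite hb.
  by move=> hx; rewrite hb; exact: (allP fF).
have [p [c hp]] := machine_enumerates K wfF wc fc wlF.
exists p, c => L v w hL hv /encodingP[l pl' ew].
set I := mkinst l v in ew *.
have pI : positive_inst I by exact: mkinst_positive hL hv.
have [h1 h2] := h I pI.1 nu0.
(* The printed head determines the valuation of the looped variables, so distinct valuations give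
   distinct answers even if the head repeats variables. *)
have bndE nu : map nu (bnd [::] ls) = map (asg hd (map nu hd)) (bnd [::] ls).
  by apply/eq_in_map => y; rewrite hb => hy; rewrite asg_map.
exists l, (if eval I chk nu0 == 0%R then [::] else outs I hd F (loops I ls nu0)).
split=> //.
- case: eqP => // /h2[_ _ _ u].
  rewrite (@map_uniq _ _ (fun x => map (asg hd x.1) (bnd [::] ls))) //.
  rewrite -map_comp; move: u; congr uniq; apply: eq_map => nu /=.
  exact: bndE.
- move=> x; case: eqP => [z|nz].
    split=> // -[mu [m1 m2 _]]; have [h1' _] := h I pI.1 mu.
    have e0 : eval I chk mu = eval I chk nu0 by apply: eval_fv => y; rewrite fc.
    by case: (h1' (etrans e0 z) mu); apply/hP.
  have [_ g2 g3 _] := h2 nz; split.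
    move=> /mapP[nu /g2 pn ->]; exists nu.
    by have /hP[//|m1 m2] := pn; split.
  move=> [mu [m1 m2 ->]]; have pm : P I mu by apply/hP.
  have [nu hnu e] := g3 _ pm; apply/mapP; exists nu => //.
  have eh y : y \in hd -> mu y = nu y by move=> hy; rewrite e // hb.
  congr pair; first exact/eq_in_map.
  by apply: eval_fv => y /(allP fF); exact: eh.
- have -> : (\sum_(R : T) size (L R)).+1 = isz sig_ars I.
    rewrite /isz; congr _.+1; rewrite -(big_mkord xpredT (fun i => size (rl I i))).
    rewrite /index_iota subn0 -(big_map (rl I) xpredT size) size_map -(size_map l).
    rewrite (map_iota_nth [::] id) map_id big_map big_enum /=.
    by apply: eq_bigr => R _; rewrite (perm_size (pl' R)).
  by apply: hp => //; [case: pI => -[] | move=> /h2[]].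
Qed.

End Bridge.

(** * Plans for queries over numbered relations and constants *)

Definition natom : eqType := ((nat * seq nat) + (nat * nat))%type.

Definition natom_vars (a : natom) : seq nat :=
  match a with inl p => p.2 | inr p => [:: p.1] end.

Definition natom_term (a : natom) : tm :=
  match a with inl p => TRel p.1 p.2 | inr p => TLe p.1 p.2 end.

Definition prodT (ts : seq tm) : tm := foldr TMul TOne ts.

Definition lesT (les : seq (nat * nat)) : tm := prodT [seq TLe p.1 p.2 | p <- les].

Definition rels_of (b : seq natom) : seq (nat * seq nat) :=
  pmap (fun a : natom => if a is inl p then Some p else None) b.

Definition les_of (b : seq natom) : seq (nat * nat) :=
  pmap (fun a : natom => if a is inr p then Some p else None) b.

(** With the parent given by membership instead of an index, a parent can be exchanged while atoms
    are being removed from the list. *)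
Lemma ripP h v s : rip h (v :: s) <-> rip h s /\
  exists2 u, u \in h :: s & forall x, x \in v -> x \in h ++ flatten s -> x \in u.
Proof.
split=> /= -[hr]; last first.
  case=> u; rewrite inE => /orP[/eqP->|us] hu; split=> //.
    by exists (size s); rewrite nth_default.
  by exists (index u s); rewrite nth_index.
case=> k hk; split=> //; exists (nth h s k) => //.
have [ks|ks] := ltnP k (size s); first by rewrite inE mem_nth ?orbT.
by rewrite nth_default // mem_head.
Qed.

(* Removing the unary edges of the comparison atoms: if such an edge [{x}] is the
   parent of [v], any other edge containing [x] can replace it, and if there is
   none then [v] meets none of the remaining edges. *)
Lemma rip_rels h b : rip h (map natom_vars b) -> rip h (map snd (rels_of b)).
Proof.
elim: b => // a b ih; rewrite [map _ _]/= => /ripP[/ih hr [u uin hu]].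
case: a hu => [[R xs]|//] /= hu; apply/ripP; split=> //.
have sub x : x \in flatten (map snd (rels_of b)) -> x \in flatten (map natom_vars b).
  move=> /flattenP[t /mapP[p]]; rewrite /rels_of mem_pmap => /mapP[a ab ea] -> hx.
  apply/flattenP; exists (natom_vars a); first exact: map_f.
  by case: a {ab} ea hx => // q [->].
have hu' x : x \in xs -> x \in h ++ flatten (map snd (rels_of b)) -> x \in u.
  by move=> hx; rewrite mem_cat => hx'; apply: hu => //; rewrite mem_cat; case/orP: hx' => [->//|/sub->]; rewrite orbT.
move: uin; rewrite inE => /orP[/eqP uh|/mapP[a ab ua]].
  by exists u; [rewrite uh mem_head|exact: hu'].
case: a ab ua => [p|[x c]] ab /= ua.
  exists u => //; rewrite inE; apply/orP; right; rewrite ua; apply: map_f.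
  by rewrite /rels_of mem_pmap; apply/mapP; exists (inl p).
have hx y : y \in xs -> y \in h ++ flatten (map snd (rels_of b)) -> y = x.
  by move=> h1 h2; have := hu' y h1 h2; rewrite ua inE => /eqP.
case: (boolP (x \in h ++ flatten (map snd (rels_of b)))) => [|nx].
  rewrite mem_cat => /orP[xh|/flattenP[t ht xt]].
    by exists h; [exact: mem_head|move=> y h1 h2; rewrite (hx y)].
  by exists t; [rewrite inE ht orbT|move=> y h1 h2; rewrite (hx y)].
exists h; first exact: mem_head.
by move=> y h1 h2; rewrite -(hx y h1 h2) h2 in nx.
Qed.

Lemma rip_filter (A : pred nat) s : rip [::] s -> rip [::] (map (filter A) s).
Proof.
elim: s => //= v s ih [hr [k hk]]; split; first exact: ih.
exists k => x; rewrite mem_filter => /andP[Ax xv] /flattenP[t /mapP[t' ht' ->]].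
rewrite mem_filter => /andP[_ xt'].
have xk : x \in nth [::] s k by apply: hk => //; apply/flattenP; exists t'.
have [ks|ks] := ltnP k (size s); last by rewrite nth_default in xk.
by rewrite (nth_map [::]) // mem_filter Ax.
Qed.

Section CqPlan.
Variables (K : comNzSemiRingType) (ars : seq nat) (nc : nat).
Hypothesis hK : semi_integral K.
Implicit Types (I : inst K).

Lemma eval_prodT I ts nu : eval I (prodT ts) nu = (\prod_(t <- ts) eval I t nu)%R.
Proof. by elim: ts => /= [|t ts ->]; rewrite ?big_nil ?big_cons. Qed.

Lemma fv_prodT ts X : all (fun t => subl (fv t) X) ts -> subl (fv (prodT ts)) X.
Proof. by elim: ts => //= t ts ih /andP[h /ih h']; rewrite /subl all_cat; apply/andP. Qed.

Lemma wf_prodT ts : wf ars nc (prodT ts) = all (wf ars nc) ts.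
Proof. by elim: ts => //= t ts ->. Qed.

Lemma prodT_neq0 I ts nu : eval I (prodT ts) nu <> 0%R <->
  forall t, List.In t ts -> eval I t nu <> 0%R.
Proof.
elim: ts => /= [|t ts ih]; first by split=> // _; apply/eqP; rewrite oner_eq0.
split=> [h t' [<-|hi] z|h /hK[]].
- by apply: h; rewrite z mul0r.
- have h' : eval I (prodT ts) nu <> 0%R by move=> z'; apply: h; rewrite z' mulr0.
  exact: (proj1 ih h' t' hi z).
- by apply: h; left.
- by apply: (proj2 ih) => t' hi; apply: h; right.
Qed.

Definition le_ok I nu (p : nat * nat) := nu p.1 <= cv I p.2.

Lemma eval_lesT I les nu : eval I (lesT les) nu = ((all (le_ok I nu) les : nat)%:R)%R.
Proof.
rewrite eval_prodT big_map; elim: les => [|p les ih]; first by rewrite big_nil.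
rewrite big_cons ih /= /le_ok; case: (_ <= _); first by rewrite mul1r.
by rewrite mul0r.
Qed.

Lemma prod_bool (T : Type) (s : seq T) (f : T -> bool) :
  (\prod_(x <- s) ((f x : nat)%:R) = ((all f s : nat)%:R) :> K)%R.
Proof.
elim: s => [|x s ih]; first by rewrite big_nil.
by rewrite big_cons ih /=; case: (f x); rewrite ?mul1r ?mul0r.
Qed.

Lemma in_filter_list (T : Type) (f : T -> bool) (s : seq T) x :
  List.In x (filter f s) <-> List.In x s /\ f x.
Proof.
elim: s => /= [|y s ih]; first by split=> // -[].
case fy: (f y) => /=; split.
- by move=> [<-|/(proj1 ih)[h1 h2]]; split=> //; [left|right].
- by move=> [[->|h] fx]; [left|right; apply: (proj2 ih)].
- by move=> /(proj1 ih)[h1 h2]; split=> //; right.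
- by move=> [[e|h] fx]; [rewrite -e fy in fx|apply: (proj2 ih)].
Qed.

Lemma wf_lesT les : wf ars nc (lesT les) = all (fun p => p.2 < nc) les.
Proof. by rewrite wf_prodT all_map. Qed.

Lemma fv_lesT les X : all (fun p => p.1 \in X) les -> subl (fv (lesT les)) X.
Proof.
move=> h; apply: fv_prodT; rewrite all_map; apply: sub_all h => p hp /=.
by rewrite /subl /= hp.
Qed.

Lemma prod_natm I b nu : (\prod_(a <- b) eval I (natom_term a) nu)%R =
  ((\prod_(p <- rels_of b) lkp (rl I p.1) (map nu p.2)) *
   (all (le_ok I nu) (les_of b) : nat)%:R)%R.
Proof.
elim: b => [|[p|p] b ih]; rewrite ?big_nil ?mulr1 // big_cons ih /=.
  by rewrite big_cons mulrA.
by rewrite mulrCA /le_ok; case: (_ <= _); rewrite ?mul1r // !mul0r.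
Qed.

(* Constants bounding a variable that occurs in comparison atoms only. *)
Definition bounds (les : seq (nat * nat)) x := [seq p.2 | p <- les & p.1 == x].

Definition xmin I les x := vmin I (head 0 (bounds les x)) (behead (bounds les x)).

Lemma leq_vmin I c cs n : (n <= vmin I c cs) = all (fun c => n <= cv I c) (c :: cs).
Proof.
rewrite /vmin /=; elim: cs (cv I c) => [|c' cs ih] a /=; first by rewrite andbT.
by rewrite ih leq_min andbA.
Qed.

Lemma leq_xmin I les x n : has (fun p => p.1 == x) les ->
  (n <= xmin I les x) = all (fun p => (p.1 == x) ==> (n <= cv I p.2)) les.
Proof.
move=> hx; have -> : all (fun p => (p.1 == x) ==> (n <= cv I p.2)) les =
    all (fun c => n <= cv I c) (bounds les x).
  by rewrite /bounds all_map all_filter.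
have : bounds les x != [::].
  by move: hx; rewrite has_filter /bounds; case: (filter _ _).
by rewrite /xmin; case: (bounds les x) => // c cs _; rewrite leq_vmin.
Qed.

(** The sum factors over the coordinates, and each coordinate counts its admissible values. *)
Lemma isum_box N ws (v : nat -> nat) nu : uniq ws -> (forall x, x \in ws -> v x <= N) ->
  isum N ws (fun mu => \prod_(x <- ws) ((mu x <= v x)%N : nat)%:R)%R nu =
  (\prod_(x <- ws) (v x)%:R : K)%R.
Proof.
elim: ws nu => [|w ws ih] nu /=; first by rewrite !big_nil.
move=> /andP[hw uw] hv.
have one : (\sum_(d <- iota 1 N) ((d <= v w)%N : nat)%:R = (v w)%:R :> K)%R.
  rewrite -natr_sum; congr (_%:R)%R.
  rewrite -big_mkcond sum1_count.
  have := hv w (mem_head _ _) => le.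
  rewrite -(subnKC le) iotaD count_cat.
  have -> : count (fun i => i <= v w) (iota 1 (v w)) = v w.
    rewrite -[RHS](size_iota 1); apply/eqP; rewrite -all_count; apply/allP => d.
    by rewrite mem_iota; lia.
  have -> : count (fun i => i <= v w) (iota (1 + v w) (N - v w)) = 0.
    apply/eqP; rewrite eqn0Ngt -has_count; apply/hasPn => d; rewrite mem_iota; lia.
  by rewrite addn0.
rewrite big_cons -one big_distrl; apply: eq_bigr => d _ /=.
pose g (mu : nat -> nat) : K := ((mu w <= v w)%N : nat)%:R%R.
have dg : dep [:: w] g by move=> m1 m2 e; rewrite /g e ?mem_head.
rewrite -(ih (updn nu w d)) //; last by move=> x hx; apply: hv; rewrite inE hx orbT.
have -> : ((d <= v w)%N : nat)%:R%R = g (updn nu w d) by rewrite /g /updn eqxx.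
apply: etrans (isum_mull N _ _ dg (ys := ws) _); first by apply: isum_ext => mu; rewrite big_cons.
by move=> x; rewrite inE => /eqP->.
Qed.

(** A comparison is attached to every relational atom containing its variable; the repetition does
    no harm because indicators are idempotent. *)
Definition mk_item les (p : nat * seq nat) := Item p.1 p.2 (undup p.2)
  (TMul (TRel p.1 p.2) (lesT [seq q <- les | q.1 \in p.2])).

Lemma in_map_list (T : eqType) (U : Type) (f : T -> U) (s : seq T) u :
  List.In u (map f s) <-> exists2 t, t \in s & u = f t.
Proof.
elim: s => /= [|t s ih]; first by split=> // -[].
split=> [[<-|hi]|[t']].
- by exists t; rewrite ?mem_head.
- by have [t' ht' ->] := proj1 ih hi; exists t'; rewrite // inE ht' orbT.
- by rewrite inE => /orP[/eqP->|h] e; [left; rewrite e|right; apply: (proj2 ih); exists t'].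
Qed.

(** [b1] orders the body towards the head and serves the elimination; [b2] orders the body by itself
    and, restricted to [H], serves the loops. The value is the product of three parts: the factors
    left by the elimination, the counts of quantified variables that occur in comparisons only, and
    the comparisons on head variables of that kind. *)
Theorem cq_plan (b b1 b2 : seq natom) (H : seq nat) :
  (forall p, inl p \in b -> p.1 < size ars /\ size p.2 = nth 0 ars p.1) ->
  (forall p, inr p \in b -> p.2 < nc) -> 0 < nc ->
  {subset H <= flatten (map natom_vars b)} ->
  perm_eq b1 b -> perm_eq b2 b ->
  rip H (map natom_vars b1) -> rip [::] (map natom_vars b2) ->
  exists F ls chk P, [/\ plan (K := K) ars nc ls chk P, wf ars nc F,
     bnd [::] ls =i H, subl (fv F) H &
     (forall I nu, proper_inst ars I -> (exists N, bounded ars I N) ->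
       (P I nu <-> eval I F nu <> 0%R /\ forall x, x \in H -> 0 < nu x)) /\
     forall I N nu, valid ars I -> bounded ars I N ->
       (forall c, c < nc -> cv I c <= N) ->
       isum N (undup [seq y <- flatten (map natom_vars b) | y \notin H])
         (fun mu => \prod_(a <- b) eval I (natom_term a) mu)%R nu = eval I F nu].
Proof.
move=> hrel hle nc0 Hsub p1 p2 rip1 rip2.
set les := les_of b.
have lesP p : p \in les -> inr p \in b.
  by rewrite mem_pmap => /mapP[[q|q] // hq [->]].
have lesnc : all (fun p => p.2 < nc) les by apply/allP => p /lesP /hle.
have relsP b' p : perm_eq b' b -> (p \in rels_of b') = (inl p \in b).
  move=> /perm_mem <-; rewrite mem_pmap; apply/mapP/idP => [[[q|q] // hq [->]] //|h].
  by exists (inl p).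
set V := flatten (map snd (rels_of b)).
have Vp b' x : perm_eq b' b -> (x \in flatten (map snd (rels_of b'))) = (x \in V).
  move=> pb; rewrite /V; apply/flattenP/flattenP => -[t /mapP[p hp ->] xp];
    exists p.2 => //; apply: map_f; move: hp; rewrite !relsP //.
(* Variables that occur in comparison atoms only. *)
set IV := undup [seq p.1 | p <- les & p.1 \notin V].
have allV x : (x \in flatten (map natom_vars b)) = (x \in V) || (x \in IV).
  apply/flattenP/orP.
    move=> [t /mapP[[p|p] hp ->]] /= hx.
      by left; apply/flattenP; exists p.2 => //; apply: map_f; rewrite relsP.
    move: hx; rewrite inE => /eqP->; case xV : (p.1 \in V); [by left|right].
    rewrite mem_undup; apply/mapP; exists p => //; rewrite mem_filter xV /=.
    by rewrite mem_pmap; apply/mapP; exists (inr p).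
  case=> [/flattenP[t /mapP[p hp ->] hx]|].
    by exists p.2 => //; apply/mapP; exists (inl p); rewrite // -(relsP b) .
  rewrite mem_undup => /mapP[p]; rewrite mem_filter => /andP[_ /lesP hp] ->.
  by exists [:: p.1]; rewrite ?mem_head //; apply/mapP; exists (inr p).
have IVV x : x \in IV -> x \notin V.
  by rewrite mem_undup => /mapP[p]; rewrite mem_filter => /andP[h _] ->.
have hasIV x : x \in IV -> has (fun p => p.1 == x) les.
  rewrite mem_undup => /mapP[p]; rewrite mem_filter => /andP[_ h] ->.
  by apply/hasP; exists p.
set its1 := map (mk_item les) (rels_of b1).
have ixs1 : map ixs its1 = map snd (rels_of b1) by rewrite -map_comp.
have wfit p : inl p \in b -> wf ars nc (iw (mk_item les p)).
  move=> /hrel[h1 h2] /=; rewrite h1 h2 eqxx /= wf_lesT.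
  by apply/allP => q; rewrite mem_filter => /andP[_ /(allP lesnc)].
have fvit p : subl (fv (iw (mk_item les p))) (undup p.2).
  rewrite /= /subl all_cat; apply/andP; split.
    by apply/allP => x; rewrite mem_undup.
  by apply: fv_lesT; apply/allP => q; rewrite mem_filter mem_undup => /andP[].
have ok1 it : List.In it its1 -> sum_item K ars nc it.
  move=> /in_map_list[p]; rewrite relsP // => hp ->.
  have [h1 h2] := hrel p hp; split=> //.
  - exact: wfit.
  - rewrite /wfgen h1 h2 eqxx fvit /= andbT; apply/allP => x; by rewrite mem_undup.
  - move=> I nu hne; apply/eqP => z; apply: hne.
    by rewrite -[LHS]/(lkp _ _ * _)%R z mul0r.
have [ms [hms msE]] := sum_elim erefl ok1 (ltac:(by rewrite ixs1; exact: (rip_rels rip1))).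
set ws2 := [seq x <- IV | x \notin H].
set xs2 := [seq x <- IV | x \in H].
(* A quantified variable of [IV] contributes its number of values, a head variable of [IV] its
   comparisons. *)
pose sc := prodT [seq TCount (head 0 (bounds les x)) (behead (bounds les x)) | x <- ws2].
pose box := lesT [seq p <- les | p.1 \in xs2].
pose F := TMul (prodT ms) (TMul sc box).
have wfb x : head 0 (bounds les x) < nc /\ all (fun c => c < nc) (behead (bounds les x)).
  have : all (fun c => c < nc) (bounds les x).
    by apply/allP => c /mapP[p]; rewrite mem_filter => /andP[_ hp] ->; exact: (allP lesnc).
  by case: (bounds les x) => //= c cs /andP.
have wfms : wf ars nc (prodT ms).
  rewrite wf_prodT; elim: (ms) hms => //= m l ih h; rewrite ih ?andbT.
    by have [] := h m (or_introl erefl).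
  by move=> m' hi; apply: h; right.
have wfsc : wf ars nc sc.
  by rewrite wf_prodT all_map; apply/allP => x _ /=; have [-> ->] := wfb x.
have wfbox : wf ars nc box.
  by rewrite wf_lesT; apply/allP => p; rewrite mem_filter => /andP[_ /(allP lesnc)].
have fvms : subl (fv (prodT ms)) H.
  apply: fv_prodT; elim: (ms) hms => //= m l ih h; rewrite ih ?andbT.
    by have [] := h m (or_introl erefl).
  by move=> m' hi; apply: h; right.
have fvsc : fv sc = [::].
  by rewrite /sc; elim: (ws2) => //= x l ->.
have fvbox : subl (fv box) xs2.
  by apply: fv_lesT; apply/allP => p; rewrite mem_filter => /andP[].
have scE I nu : eval I sc nu = (\prod_(x <- ws2) (xmin I les x)%:R)%R.
  by rewrite eval_prodT big_map.
set inH := fun x => x \in H.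
(* An item carries every factor whose variables it contains. A factor may thus occur in several
   items, which is harmless as the weights of the loops are only tested for being nonzero; the
   printed value comes from [F]. *)
set its2 := [seq Item p.1 p.2 (filter inH (undup p.2))
   (prodT [seq m <- ms | subl (fv m) (filter inH (undup p.2))]) | p <- rels_of b2].
have iys2 : map iys its2 = map (filter inH) (map (fun p => undup p.2) (rels_of b2)).
  by rewrite -!map_comp.
have rip_undup s : rip [::] s -> rip [::] (map undup s).
  elim: s => //= v s ih [hr [k hk]]; split; first exact: ih.
  exists k => x; rewrite mem_undup => xv /flattenP[t /mapP[t' ht' ->]]; rewrite mem_undup => xt'.
  have xk : x \in nth [::] s k by apply: hk => //; apply/flattenP; exists t'.
  have [ks|ks] := ltnP k (size s); last by rewrite nth_default in xk.
  by rewrite (nth_map [::]) // mem_undup.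
have ripits2 : rip [::] (map iys its2).
  rewrite iys2; apply: rip_filter; rewrite (map_comp undup snd); apply: rip_undup.
  exact: (rip_rels rip2).
have ok2 it : List.In it its2 -> item_ok ars nc it.
  move=> /in_map_list[p]; rewrite relsP // => hp ->.
  have [h1 h2] := hrel p hp; apply/and3P; split.
  - rewrite /= wf_prodT all_filter; move: wfms; rewrite wf_prodT.
    by apply: sub_all => m hm; apply/implyP.
  - rewrite /wfgen /= h1 h2 eqxx /=; apply/andP; split.
      by apply/allP => x; rewrite mem_filter mem_undup => /andP[].
    by apply: fv_prodT; elim: (ms) => //= m l ih; case: ifP => //= ->.
  - by rewrite /= filter_uniq // undup_uniq.
have [ls0 [chk0 [pl0 b0]]] := join_plan (K := K) hK erefl ok2 ripits2.
(* The counts can vanish in positive characteristic, so their product is tested in advance. *)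
have pl1 := plan_closed hK pl0 wfsc fvsc.
have b0V x : (x \in bnd [::] ls0) = (x \in V) && (x \in H).
  rewrite b0 iys2; apply/flattenP/andP.
    move=> [t /mapP[t' /mapP[p hp ->] ->]]; rewrite mem_filter mem_undup => /andP[xH xp].
    by split=> //; apply/flattenP; exists p.2 => //; apply: map_f; rewrite relsP // -(relsP b2).
  move=> [/flattenP[t /mapP[p hp ->] xp] xH].
  exists (filter inH (undup p.2)); last by rewrite mem_filter mem_undup xp andbT.
  apply: map_f; apply: (map_f (fun p => undup p.2)); by rewrite relsP // -(relsP b).
have addint l : uniq l -> {subset l <= IV} -> exists ls, plan (K := K) ars nc ls (TMul chk0 sc)
    (fun I nu => (sat its2 I nu /\ eval I sc nu <> 0%R) /\
       forall x, x \in l -> 0 < nu x <= xmin I les x) /\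
    bnd [::] ls =i l ++ bnd [::] ls0.
  elim: l => [|x l ih] /=.
    move=> _ _; exists ls0; split=> //; apply: plan_eq pl1 _ => I nu; split; first by split.
    by case.
  case/andP=> xl /ih{}ih sub; have [|ls [pl bls]] := ih.
    by move=> y hy; apply: sub; rewrite inE hy orbT.
  have [wx1 wx2] := wfb x.
  exists (rcons ls (LInt x (head 0 (bounds les x)) (behead (bounds les x)))); split.
    apply: plan_eq (plan_int pl _ wx1 wx2) _.
      rewrite bls mem_cat negb_or xl b0V negb_and IVV //.
      by apply: sub; exact: mem_head.
    move=> I nu; split.
      move=> [[h1 h2] h3]; split=> // y; rewrite inE => /orP[/eqP->|] //; exact: h2.
    move=> [h1 h2]; split; last by apply: h2; exact: mem_head.
    by split=> // y hy; apply: h2; rewrite inE hy orbT.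
  by move=> y; rewrite bnd_rcons /= !inE bls.
have [||ls [pl bls]] := addint xs2.
- by rewrite filter_uniq // undup_uniq.
- by move=> x; rewrite mem_filter => /andP[].
exists F, ls, (TMul chk0 sc); eexists; split; [exact: pl| | | | ].
- by rewrite /= wfms wfsc wfbox.
- move=> x; rewrite bls mem_cat b0V mem_filter.
  case xH : (x \in H) => /=; last by rewrite andbF.
  by rewrite andbT orbC -allV Hsub.
- rewrite /F /= fvsc /subl all_cat; apply/andP; split=> //=.
  by apply/allP => x /(allP fvbox); rewrite mem_filter => /andP[].
split; last first.
  move=> I N nu vI bI cI.
  set ws1 := undup [seq x <- V | x \notin H].
  have w1 x : x \in ws1 = (x \in V) && (x \notin H) by rewrite mem_undup mem_filter andbC.
  have w2 x : x \in ws2 = (x \in IV) && (x \notin H) by rewrite mem_filter andbC.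
  have pw : perm_eq (undup [seq y <- flatten (map natom_vars b) | y \notin H]) (ws1 ++ ws2).
    apply: uniq_perm; first exact: undup_uniq.
      rewrite cat_uniq undup_uniq filter_uniq ?undup_uniq // andbT /=.
      by apply/hasPn => x; rewrite w1 w2 => /andP[/IVV/negbTE->].
    move=> x; rewrite mem_undup mem_filter mem_cat allV w1 w2.
    by case: (x \in V); case: (x \in IV); case: (x \in H).
  pose A mu := (\prod_(it <- its1) eval I (iw it) mu)%R.
  pose B mu : K := (\prod_(x <- ws2) ((mu x <= xmin I les x)%N : nat)%:R)%R.
  have xs2p x : x \in xs2 = (x \in IV) && (x \in H) by rewrite mem_filter andbC.
  have AB mu : (\prod_(a <- b) eval I (natom_term a) mu = A mu * eval I box mu * B mu)%R.
    rewrite prod_natm -/les /A big_map eval_lesT /B prod_bool.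
    have prels : perm_eq (rels_of b1) (rels_of b) by exact: perm_pmap.
    rewrite (perm_big _ prels) /=.
    have -> : (\prod_(p <- rels_of b) (lkp (rl I p.1) (map mu p.2) *
        eval I (lesT [seq q <- les | q.1 \in p.2]) mu) =
      (\prod_(p <- rels_of b) lkp (rl I p.1) (map mu p.2)) *
       ((all (fun p => all (le_ok I mu) [seq q <- les | q.1 \in p.2]) (rels_of b) : nat)%:R))%R.
      by rewrite big_split -prod_bool /=; congr (_ * _)%R; apply: eq_bigr => p _; rewrite eval_lesT.
    rewrite -!mulrA; congr (_ * _)%R.
    rewrite -!natrM !mulnb; congr (_%:R)%R; congr nat_of_bool.
    apply/allP/and3P => [h|[/allP h1 /allP h2 /allP h3] q hq].
      split; apply/allP.
      - by move=> p _; apply/allP => q; rewrite mem_filter => /andP[_ /h].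
      - by move=> q; rewrite mem_filter => /andP[_ /h].
      - move=> x; rewrite w2 => /andP[xI _]; rewrite leq_xmin ?hasIV //.
        by apply/allP => q hq; apply/implyP => /eqP <-; exact: h.
    case qV : (q.1 \in V).
      move: qV => /flattenP[t /mapP[p hp ->] qp].
      by move: (h1 p hp) => /allP; apply; rewrite mem_filter qp.
    have qI : q.1 \in IV by rewrite mem_undup; apply: map_f; rewrite mem_filter qV.
    case qH : (q.1 \in H); first by apply: h2; rewrite mem_filter xs2p qI qH.
    have := h3 q.1; rewrite w2 qI qH => /(_ isT).
    by rewrite leq_xmin ?hasIV // => /allP /(_ q hq); rewrite eqxx.
  have dA : dep V A.
    apply: dep_prod => it /in_map_list[p]; rewrite relsP // => hp ->.
    apply/allP => x /(allP (fvit p)); rewrite mem_undup => xp.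
    by apply/flattenP; exists p.2 => //; apply: map_f; rewrite relsP.
  have dbox : dep xs2 (eval I box) by exact: dep_eval.
  pose c : K := (\prod_(x <- ws2) (xmin I les x)%:R)%R.
  have xN x : x \in ws2 -> xmin I les x <= N.
    move=> _; have [wx _] := wfb x; apply: leq_trans (cI _ wx).
    by have := leqnn (xmin I les x); rewrite {2}/xmin leq_vmin /= => /andP[].
  have inner mu : isum N ws2 (fun mu => A mu * eval I box mu * B mu)%R mu =
     (A mu * (eval I box mu * c))%R.
    have dAb : dep (V ++ xs2) (fun mu => A mu * eval I box mu)%R.
      move=> m1 m2 e; rewrite (dA m1 m2) ?(dbox m1 m2) // => x hx; apply: e;
        by rewrite mem_cat hx ?orbT.
    apply: etrans (isum_mull N _ _ dAb (ys := ws2) _) _.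
      move=> x; rewrite mem_cat w2 xs2p => /orP[xV|/andP[_ ->]]; last by rewrite andbF.
      by apply/negP => /andP[/IVV]; rewrite xV.
    by rewrite isum_box ?mulrA // filter_uniq // undup_uniq.
  rewrite (isum_perm _ _ _ pw) isum_cat.
  apply: etrans (isum_ext N ws1 nu (g' := fun mu => eval I box mu * c * A mu)%R _) _.
    move=> mu; rewrite -[RHS]mulrC -inner; exact: isum_ext.
  have dbc : dep xs2 (fun mu => eval I box mu * c)%R by move=> m1 m2 e; rewrite (dbox m1 m2).
  apply: etrans (isum_mull N A nu dbc (ys := ws1) _) _.
    by move=> x; rewrite w1 xs2p => /andP[_ ->]; rewrite andbF.
  rewrite /A (msE I N) ?undup_uniq //; last first.
    by move=> x; rewrite ixs1 w1 (Vp b1).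
  by rewrite /F /= scE -/c eval_prodT mulrC; congr (_ * _)%R; rewrite mulrC.
move=> I nu pI [N bI].
have vI : valid ars I by case: pI.
have FE : eval I F nu <> 0%R <-> [/\ eval I (prodT ms) nu <> 0%R, eval I sc nu <> 0%R
    & eval I box nu <> 0%R].
  split=> [h|[h1 h2 h3] /hK[//|/hK[]//]].
  split=> z; apply: h; rewrite /F -[LHS]/(eval I (prodT ms) nu * (eval I sc nu * eval I box nu))%R z;
    by rewrite ?mul0r ?mulr0 ?mul0r.
have boxE : eval I box nu <> 0%R <-> forall x, x \in xs2 -> nu x <= xmin I les x.
  rewrite eval_lesT (_ : (_ <> 0%R) = (all (le_ok I nu) [seq p <- les | p.1 \in xs2])); last first.
    by apply/propext; case: (all _ _); split=> // _; apply/eqP; rewrite oner_eq0.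
  split=> [/allP h x hx|h].
    rewrite leq_xmin; last by apply: hasIV; move: hx; rewrite mem_filter => /andP[].
    apply/allP => q hq; apply/implyP => /eqP e.
    by have := h q; rewrite mem_filter e hx hq /le_ok e => /(_ isT).
  apply/allP => q; rewrite mem_filter => /andP[qx hq]; have := h _ qx.
  rewrite leq_xmin; last by apply: hasIV; move: qx; rewrite mem_filter => /andP[].
  by move=> /allP /(_ q hq); rewrite eqxx.
have genpos p x : inl p \in b -> x \in filter inH (undup p.2) ->
    map nu (filter inH (undup p.2)) \in gen (rl I p.1) p.2 (filter inH (undup p.2)) -> 0 < nu x.
  move=> hp hx hg; have [h1 h2] := hrel p hp.
  have sub : subl (filter inH (undup p.2)) p.2.
    by apply/allP => y; rewrite mem_filter mem_undup => /andP[].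
  by have /andP[] := gen_bounded bI h1 sub hg (map_f nu hx).
split.
- move=> [[hs hsc] hx]; split.
    apply/FE; split=> //; last by apply/boxE => x /hx /andP[].
    (* Every factor is carried by at least one item, namely the projection of an atom that covers
       its variables. *)
    apply/prodT_neq0 => m hm; have [_ mH [it hit mit]] := hms m hm.
    move: hit => /in_map_list[p hp eit]; rewrite relsP // in hp.
    set it2 := Item p.1 p.2 (filter inH (undup p.2))
      (prodT [seq m <- ms | subl (fv m) (filter inH (undup p.2))]).
    have hit2 : List.In it2 its2.
      by apply/in_map_list; exists p; rewrite // relsP.
    have [_ /prodT_neq0 h] := hs it2 hit2; apply: h.
    apply/in_filter_list; split=> //; apply/allP => y ym; rewrite mem_filter.
    rewrite /inH (allP mH) //= -[undup p.2]/(iys (mk_item les p)) -eit.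
    exact: (allP mit).
  move=> x xH; have := Hsub x xH; rewrite allV => /orP[/flattenP[t /mapP[p hp ->] xp]|xI].
    rewrite relsP // in hp.
    set it2 := Item p.1 p.2 (filter inH (undup p.2))
      (prodT [seq m <- ms | subl (fv m) (filter inH (undup p.2))]).
    have hit2 : List.In it2 its2.
      by apply/in_map_list; exists p; rewrite // relsP.
    have [hg _] := hs it2 hit2; apply: (genpos p) hg => //.
    by rewrite mem_filter mem_undup xp andbT.
  by have /andP[] := hx x (ltac:(by rewrite mem_filter xI andbT)).
- move=> [/FE[h1 h2 h3] hpos]; split; last first.
    move=> x hx; rewrite hpos; last by move: hx; rewrite mem_filter => /andP[].
    by move/boxE: h3; apply.
  split=> // it /in_map_list[p hp ->] /=; split; last first.
    apply/prodT_neq0 => m hm; move/prodT_neq0: h1; apply.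
    by case/in_filter_list: hm.
  (* A nonzero value has a nonzero summand. Its valuation [mu] agrees with [nu] on the head and
     matches every relational atom, which gives the required projections. *)
  have hs : isum N (undup [seq x <- V | x \notin H]) (fun mu => \prod_(it <- its1) eval I (iw it) mu)%R nu <> 0%R.
    rewrite (msE I N) ?undup_uniq //; first by rewrite -eval_prodT.
    by move=> x; rewrite mem_undup mem_filter ixs1 (Vp b1) // andbC.
  have [mu hmu emu] := isum_neq0 hs.
  rewrite relsP // in hp.
  have hl : lkp (rl I p.1) (map mu p.2) != 0%R.
    apply/eqP => z; apply: hmu; rewrite big_map.
    have hp1 : p \in rels_of b1 by rewrite relsP.
    by rewrite (big_rem p) //= z !mul0r.
  have sub : subl (filter inH (undup p.2)) p.2.
    by apply/allP => y; rewrite mem_filter mem_undup => /andP[].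
  have := gen_lkp sub hl; rewrite (_ : map mu _ = map nu (filter inH (undup p.2))) //.
  apply/eq_in_map => y; rewrite mem_filter => /andP[yH _]; apply: emu.
  by rewrite mem_undup mem_filter negb_and negbK [y \in H]yH.
Qed.

End CqPlan.

(** * From acyclicity to join orders of the atoms *)

Lemma acyclic_perm (E : seq (seq nat)) : 0 < size E -> acyclic E ->
  exists2 s, perm_eq s (iota 0 (size E)) & rip [::] (map (nth [::] E) s).
Proof.
move=> hE [e jt]; have [s [h1 h2 h3]] := tree_orderP jt (Ordinal hE).
exists (map val (rcons s (Ordinal hE))); last by rewrite -map_comp; exact: tree_order_rip0.
rewrite -val_enum_ord; apply: perm_map; apply: uniq_perm => //; first exact: enum_uniq.
by move=> i; rewrite h3 mem_enum.
Qed.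

(** The tree is rooted at the head, which has index 0; once it is removed, the indices of the body
    are one less. *)
Lemma acyclic_perm_head (H : seq nat) (E : seq (seq nat)) : acyclic (H :: E) ->
  exists2 s, perm_eq s (iota 0 (size E)) & rip H (map (nth [::] E) s).
Proof.
move=> [e jt]; have [s [h1 h2 h3]] := tree_orderP jt ord0.
have s0 i : i \in s -> nat_of_ord i = (i.-1).+1.
  move=> hi; rewrite prednK // lt0n; apply/negP => /eqP e0.
  move: h2; rewrite rcons_uniq => /andP[/negP[]].
  by have -> : ord0 = i by apply: val_inj.
exists [seq (nat_of_ord i).-1 | i <- s].
  apply: uniq_perm; last first.
  - move=> i; rewrite mem_iota add0n; apply/mapP/idP => [[j hj ->]|hi].
      by have := ltn_ord j; rewrite (s0 j hj).
    have hi' : i.+1 < size (H :: E) by [].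
    exists (Ordinal hi') => //; have := h3 (Ordinal hi').
    by rewrite mem_rcons inE => /orP[/eqP[]|].
  - exact: iota_uniq.
  - rewrite map_inj_in_uniq; first by move: h2; rewrite rcons_uniq => /andP[].
    move=> i j hi hj eij; apply: val_inj => /=; by rewrite (s0 i hi) (s0 j hj) eij.
have := tree_order_rip h1 (h := H) (fun x hx => hx) (fun x hx => hx).
rewrite -map_comp; congr rip; apply/eq_in_map => i /s0 /= ->; by [].
Qed.

Lemma perm_nth_iota (T : eqType) (x0 : T) (b : seq T) s :
  perm_eq s (iota 0 (size b)) -> perm_eq [seq nth x0 b i | i <- s] b.
Proof.
move=> h; rewrite -{2}[b](map_id) -(map_iota_nth x0 id b); exact: perm_map.
Qed.

Lemma map_nth_perm (T : eqType) (f : T -> seq nat) (x0 : T) (b : seq T) s :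
  perm_eq s (iota 0 (size b)) ->
  map f [seq nth x0 b i | i <- s] = map (nth [::] (map f b)) s.
Proof.
move=> /perm_mem h; rewrite -map_comp; apply/eq_in_map => i.
by rewrite h mem_iota add0n => /= hi; rewrite (nth_map x0).
Qed.

(** * Quantifiers as bounded sums *)

Section ExSem.
Variable K : comNzSemiRingType.

Definition nval (nu : nat -> posnat) : nat -> nat := fun x => val (nu x).

Definition pos_of (i : nat) : posnat := exist (fun n => 0 < n) i.+1 isT.

Lemma nval_upd nu y d : nval (upd nu y d) = updn (nval nu) y (val d).
Proof. by apply/funext => x; rewrite /nval /upd /updn; case: eqP. Qed.

Lemma ex_sem_neq0 ys (f : (nat -> posnat) -> K) nu : ex_sem ys f nu <> 0%R ->
  exists2 nu', f nu' <> 0%R & forall x, x \notin ys -> nu' x = nu x.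
Proof.
elim: ys nu => [|y ys ih] nu /= h; first by exists nu.
have [d hd] : exists d, ex_sem ys f (upd nu y d) <> 0%R.
  apply: contrapT => nex; apply: h; apply: fsbig1 => d _.
  by apply: contrapT => hd; apply: nex; exists d.
have [nu' h1 h2] := ih _ hd; exists nu' => // x.
by rewrite inE negb_or => /andP[/negbTE xy /h2->]; rewrite /upd xy.
Qed.

Lemma ex_sem_isum N ys f (g : (nat -> nat) -> K) nu : uniq ys ->
  (forall nu, f nu = g (nval nu)) ->
  (forall nu, f nu <> 0%R -> forall y, y \in ys -> val (nu y) <= N) ->
  ex_sem ys f nu = isum N ys g (nval nu).
Proof.
move=> + fg; elim: ys nu => [|y ys ih] nu /=; first by rewrite fg.
move=> /andP[yn uy] hN.
rewrite (@fsbigE _ _ _ _ _ [seq pos_of i | i <- iota 0 N]).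
- rewrite big_map (eq_bigl xpredT); last by move=> i; rewrite in_setT.
  rewrite -[1]addn0 iotaDl big_map; apply: eq_bigr => i _.
  rewrite ih // => [|nu' hf z hz]; last by apply: hN; rewrite // inE hz orbT.
  by rewrite nval_upd.
- by rewrite map_inj_uniq ?iota_uniq // => i j [].
- by [].
- move=> d _ hd; apply: contrapT => hne.
  have [nu' h1 h2] := ex_sem_neq0 hne.
  have := hN nu' h1 y (mem_head _ _); rewrite h2 // /upd eqxx => dN.
  move/negP: hd; apply; apply/mapP; exists (val d).-1.
    by rewrite mem_iota; case: (d) dN => n; case: n.
  by apply: val_inj; rewrite /= prednK //; case: (d).
Qed.

End ExSem.

Section Entries.
Variable K : comNzSemiRingType.

Lemma lkp_perm (L L' : seq (seq nat * K)) t : perm_eq L L' -> lkp L t = lkp L' t.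
Proof. exact: perm_big. Qed.

Lemma map_val_inj (n : nat) : injective (fun d : n.-tuple posnat => [seq val x | x <- d]).
Proof. by move=> d d' e; apply: val_inj; apply: (inj_map val_inj). Qed.

Lemma lkp_entries n (f : {fsfun n.-tuple posnat -> K with 0%R}) t :
  lkp (rel_entries f) [seq val x | x <- val t] = f t.
Proof.
rewrite /lkp /rel_entries big_map /=.
rewrite (eq_bigl (pred1 t)); last first.
  by move=> d /=; apply/eqP/eqP => [/(@map_val_inj n)|->].
have [ht|ht] := boolP (t \in finsupp f).
  by rewrite -big_filter filter_pred1_uniq ?fset_uniq // big_seq1.
rewrite big_seq_cond big1; first by rewrite fsfun_dflt.
by move=> d /andP[hd /eqP e]; rewrite e in hd; rewrite hd in ht.
Qed.

End Entries.

(** * Evaluation of free-connex conjunctive queries *)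

Section CQ.
Variables (K : comNzSemiRingType) (hK : semi_integral K) (S : vocab) (Q : cq S).

Definition atom_code (at_ : atom S) : natom :=
  match at_ with
  | RelAtom R xs => inl (ridx R, val xs)
  | LeAtom x c => inr (x, cidx c)
  end.

Lemma natom_vars_code at_ : natom_vars (atom_code at_) = atom_vars at_.
Proof. by case: at_. Qed.

Lemma in_map_atom_code p (s : seq (atom S)) : p \in map atom_code s -> exists2 at_, List.In at_ s & p = atom_code at_.
Proof.
elim: s => //= at_ s ih; rewrite inE => /orP[/eqP->|/ih[a' h ->]].
  by exists at_; [left|].
by exists a'; [right|].
Qed.

Lemma atom_sem_eval (db : database K S) (l : rsym S -> seq (seq nat * K)) nu at_ :
  (forall R, perm_eq (l R) (rel_entries (db_rel db R))) ->
  atom_sem db nu at_ =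
  eval (mkinst l (fun c => val (db_cst db c))) (natom_term (atom_code at_)) (nval nu).
Proof.
move=> pl; case: at_ => [R xs|x c].
  rewrite -[RHS]/(lkp (rl (mkinst l _) (ridx R)) (map (nval nu) xs)) rl_mkinst.
  rewrite (lkp_perm _ (pl R)).
  apply: etrans (esym (lkp_entries (db_rel db R) (map_tuple nu xs))) _.
  by rewrite /= -map_comp.
rewrite -[RHS]/(((nval nu x <= cv (mkinst l _) (cidx c))%N : nat)%:R)%R cv_mkinst.
rewrite /atom_sem /cst_val /nval.
by case: c => [c|] /=; case: leqP.
Qed.

Theorem eval_cq_linear_prep : free_connex Q -> linear_prep_const_delay (@eval_cq K S Q).
Proof.
move=> [ac1 ac2].
set b := map atom_code (body Q).
set H := val (hvars Q).
have Eb : [seq atom_vars a | a <- body Q] = map natom_vars b.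
  by rewrite -map_comp; apply: eq_map => a /=; rewrite natom_vars_code.
rewrite Eb in ac1 ac2.
have szb : 0 < size b by rewrite size_map body_neq0.
have [s2 ps2 rip2] := acyclic_perm (E := map natom_vars b) (ltac:(by rewrite size_map)) ac1.
have [s1 ps1 rip1] := acyclic_perm_head ac2.
rewrite size_map in ps1 ps2.
set a0 : natom := inr (0, 0).
have Hsub : {subset H <= flatten (map natom_vars b)}.
  by move=> x /head_safe; rewrite /atoms_vars Eb.
have hrel p : inl p \in b -> p.1 < size (sig_ars (@ar S)) /\
    size p.2 = nth 0 (sig_ars (@ar S)) p.1.
  case/in_map_atom_code=> -[R xs|//] _ [->] /=.
  by rewrite ridx_lt nth_ars size_tuple.
have hle p : inr p \in b -> p.2 < #|cst S|.+1.
  by case/in_map_atom_code=> -[//|x c] _ [->] /=; exact: cidx_lt.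
have [F [ls [chk [P [pl wfF hb fF [hP hsum]]]]]] :=
  cq_plan (b1 := [seq nth a0 b i | i <- s1]) (b2 := [seq nth a0 b i | i <- s2])
    hK hrel hle isT Hsub (perm_nth_iota a0 ps1) (perm_nth_iota a0 ps2)
    (ltac:(by rewrite map_nth_perm)) (ltac:(by rewrite map_nth_perm)).
have [p [c hp]] := from_plan pl wfF hb fF (fun I nu pI => hP I nu pI.1 pI.2).
exists p, c => db w hw.
set L := fun R => rel_entries (db_rel db R).
set v := fun c => val (db_cst db c).
have hL R e : e \in L R -> size e.1 = ar R /\ forall x, x \in e.1 -> 0 < x.
  case/mapP=> d _ -> /=; split; first by rewrite size_map size_tuple.
  by move=> x /mapP[[n hn] _ ->].
have hv cc : 0 < v cc by rewrite /v; case: (db_cst db cc).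
have [l [ans [pl' ua hans en]]] := hp L v w hL hv hw.
exists ans; split=> //; last first.
  have [t [t1 t2 t3 t4]] := en; exists t; split=> //.
  apply: leq_trans t1 _; rewrite leq_mul2l; apply/orP; right.
  by rewrite /= /db_size -addn1 leq_add2l card_option.
set I := mkinst l v in hans.
have pI : positive_inst (@ar S) I by exact: mkinst_positive hL hv.
have [N0 bN0] := pI.2.
(* One bound for the entries of the relations and for the constants. *)
pose N := N0 + \sum_(c < #|cst S|.+1) cv I c.
have bN : bounded (sig_ars (@ar S)) I N.
  by move=> R hR e he x hx; have /andP[-> h] := bN0 R hR e he x hx; rewrite (leq_trans h) ?leq_addr.
have cN k : k < #|cst S|.+1 -> cv I k <= N.
  by move=> hk; rewrite /N (bigD1 (Ordinal hk)) //=; lia.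
have semE (d : (head_ar Q).-tuple posnat) : respects d ->
    cq_sem db d = eval I F (nval (head_val d)).
  move=> hd; rewrite /cq_sem hd -(hsum I N) //; last by case: pI => -[].
  have ebv : bound_vars Q = undup [seq y <- flatten (map natom_vars b) | y \notin H].
    by rewrite /bound_vars /atoms_vars Eb.
  rewrite -ebv; apply: ex_sem_isum.
  - by rewrite undup_uniq.
  - move=> nu; rewrite big_map; apply: eq_bigr => a _.
    exact: (atom_sem_eval nu a pl').
  (* Every quantified variable occurs in some atom, whose nonzero value bounds it by an entry of a
     relation or by a constant. *)
  - move=> nu hne y; rewrite ebv mem_undup mem_filter => /andP[_ /flattenP[t /mapP[q hq ->] yq]].
    have [a ha eq] := in_map_atom_code hq.
    have ane : atom_sem db nu a <> 0%R.
      move=> z; apply: hne; elim: (body Q) ha => //= a' s ih [e|hi].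
        by rewrite big_cons e z mul0r.
      by rewrite big_cons ih // mulr0.
    rewrite (atom_sem_eval nu a pl') in ane.
    case: a eq {ha} ane => [R xs|x cc] eq ane; rewrite eq /= in yq.
      move: ane => /eqP /lkp_neq0[e he ee].
      have := bN (ridx R) (ridx_lt _ _) e he (val (nu y)).
      by rewrite ee => /(_ (map_f (nval nu) yq)) /andP[].
    move: yq; rewrite inE => /eqP->.
    move: ane => /=; case: leqP => // h _; exact: leq_trans h (cN _ (cidx_lt cc)).
have FH nu mu : {in H, nu =1 mu} -> eval I F nu = eval I F mu.
  by move=> e; apply: eval_fv => x /(allP fF); exact: e.
move=> x; rewrite hans; split.
- move=> [mu [m1 m2 ->]].
  pose d : (head_ar Q).-tuple posnat := map_tuple (fun y => pos_of (mu y).-1) (hvars Q).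
  have hvd : {in H, nval (head_val d) =1 mu}.
    move=> y hy; rewrite /nval /head_val (nth_map 0) ?index_mem // nth_index //=.
    by rewrite prednK // m2.
  have rd : respects d.
    apply/forallP => i; apply/forallP => j; apply/implyP => /eqP e.
    by rewrite !tnth_map e.
  exists d; rewrite semE // (FH _ _ hvd); first exact/eqP.
  congr pair; rewrite /= -map_comp; apply/eq_in_map => y hy /=.
  by rewrite prednK // m2.
- move=> [d hne ->].
  have rd : respects d by move: hne; rewrite /cq_sem; case: ifP; rewrite ?eqxx.
  exists (nval (head_val d)); rewrite semE // in hne *; split; first exact/eqP.
    by move=> y _; rewrite /nval; case: (head_val d y).
  congr pair; apply: (@eq_from_nth _ 0); first by rewrite !size_map !size_tuple.
  move=> i; rewrite size_map size_tuple => hi.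
  rewrite (nth_map pos1) ?size_tuple // (nth_map 0) ?size_tuple //.
  rewrite /nval /head_val; congr (val _).
  set j := index _ _.
  have hj : j < head_ar Q by rewrite -(size_tuple (hvars Q)) index_mem mem_nth // size_tuple.
  have /forallP/(_ (Ordinal hi))/forallP/(_ (Ordinal hj))/implyP := rd.
  rewrite !(tnth_nth 0) !(tnth_nth pos1) /= => hh; apply/eqP; apply: hh.
  by rewrite nth_index // mem_nth // size_tuple.
Qed.

End CQ.

(** * fc-MATLANG *)

Fixpoint tren (r : nat -> nat) (t : tm) : tm :=
  match t with
  | TOne => TOne
  | TMul f g => TMul (tren r f) (tren r g)
  | TLe x c => TLe (r x) c
  | TEq x y => TEq (r x) (r y)
  | TRel R xs => TRel R (map r xs)
  | TCount c cs => TCount c cs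
  | TSum R xs ys f zs us => TSum R xs ys f zs (map r us)
  | TAny R xs ys f zs us => TAny R xs ys f zs (map r us)
  end.

Lemma eval_tren (K : comNzSemiRingType) (I : inst K) r t nu :
  eval I (tren r t) nu = eval I t (nu \o r).
Proof.
elim: t => //=; first by move=> f -> g ->.
- by move=> R xs; rewrite -map_comp.
- by move=> R xs ys f _ zs us; rewrite -map_comp.
- by move=> R xs ys f _ zs us; rewrite -map_comp.
Qed.

Lemma fv_tren r t : fv (tren r t) = map r (fv t).
Proof. by elim: t => //= f -> g ->; rewrite map_cat. Qed.

Lemma wf_tren ars nc r t : wf ars nc (tren r t) = wf ars nc t.
Proof.
elim: t => //=; first by move=> f -> g ->.
all: by move=> *; rewrite size_map.
Qed.

(* A vector is a function of variable 0: a constant on an initial interval, or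
   supported by a projection of an input matrix whose indices are bound to [xs]. *)
Inductive vec :=
| VInt of nat & seq nat & tm
| VRel of nat & seq nat & tm.

(* A matrix is a function of the row 0 and the column 1: supported by an input
   matrix, a product of vectors, or a diagonal matrix. *)
Inductive mrep :=
| MS of nat & seq nat & tm
| MP of vec & vec
| MD of vec.

Definition vtm u := match u with
  | VInt c cs s => TMul s (lesT [seq (0, c') | c' <- c :: cs])
  | VRel _ _ f => f end.

Definition to1 (x : nat) := 1.
Definition swap01 (x : nat) := 1 - x.

Definition mtm m := match m with
  | MS _ _ f => f
  | MP u v => TMul (vtm u) (tren to1 (vtm v))
  | MD u => TMul (TEq 0 1) (vtm u) end.

(* Scaling and the entrywise product keep the supporting matrix of one factor and
   move the other factor into the weight. *)
Definition vscale t u := match u with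
  | VInt c cs s => VInt c cs (TMul s t)
  | VRel R xs f => VRel R xs (TMul f t) end.

Definition vhad u v := match u, v with
  | VRel R xs f, _ => VRel R xs (TMul f (vtm v))
  | _, VRel R xs f => VRel R xs (TMul (vtm u) f)
  | VInt c cs s, VInt c' cs' s' => VInt c (cs ++ c' :: cs') (TMul s s') end.

(* Total sum of a vector; below, [rsum] is the vector of the row sums. *)
Definition vtot u := match u with
  | VInt c cs s => TMul s (TCount c cs)
  | VRel R xs f => TSum R xs [:: 0] f [::] [::] end.

Definition mtr m := match m with
  | MS R xs f => MS R (map swap01 xs) (tren swap01 f)
  | MP u v => MP v u
  | MD u => MD u end.

Definition mscale t m := match m with
  | MS R xs f => MS R xs (TMul f t)
  | MP u v => MP (vscale t u) v
  | MD u => MD (vscale t u) end.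

(** The more restrictive support is kept: an input matrix if there is one, otherwise a diagonal;
    only two products of vectors remain a product of vectors. *)
Definition mhad m1 m2 := match m1, m2 with
  | MS R xs f, _ => MS R xs (TMul f (mtm m2))
  | _, MS R xs f => MS R xs (TMul (mtm m1) f)
  | MP u v, MP u' v' => MP (vhad u u') (vhad v v')
  | MP u v, MD w | MD w, MP u v => MD (vhad w (vhad u v))
  | MD u, MD v => MD (vhad u v) end.

Definition rsum m := match m with
  | MS R xs f => VRel R xs (TSum R xs [:: 0; 1] f [:: 0] [:: 0])
  | MP u v => vscale (vtot v) u
  | MD u => u end.

Definition at1 x : nat -> nat := fun=> x.
Definition at2 x y : nat -> nat := fun z => if z == 0 then x else y.

(** * Operations on sparse representations of vectors and matrices *)

Section Matlang.
Variables (K : comNzSemiRingType) (ars : seq nat) (nc : nat).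
Hypothesis hK : semi_integral K.
Implicit Types (I : inst K).

(** In the relational case the entry witnessing the support is only required to project to [nu 0],
    since its other index may have been summed out. *)
Definition vok u : Prop := match u with
  | VInt c cs s => [/\ c < nc, all (fun c => c < nc) cs, wf ars nc s & fv s = [::]]
  | VRel R xs f => [/\ wf ars nc f, wfgen ars R xs [:: 0] [::] f, subl xs [:: 0; 1] &
      forall I nu, eval I f nu <> 0%R -> exists2 nu', nu' 0 = nu 0 &
        lkp (rl I R) (map nu' xs) != 0%R] end.

Definition mok m : Prop := match m with
  | MS R xs f => [/\ wf ars nc f, wfgen ars R xs [:: 0; 1] [::] f, subl xs [:: 0; 1] &
      forall I nu, eval I f nu <> 0%R -> lkp (rl I R) (map nu xs) != 0%R]
  | MP u v => vok u /\ vok v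
  | MD u => vok u end.

Lemma mulK0 (a b : K) : (a * b)%R <> 0%R -> a <> 0%R /\ b <> 0%R.
Proof. by move=> h; split=> z; apply: h; rewrite z ?mul0r ?mulr0. Qed.

Lemma vtm_fv u : vok u -> subl (fv (vtm u)) [:: 0] /\ wf ars nc (vtm u).
Proof.
case: u => [c cs s [hc hcs ws fs]|R xs f [w /and5P[_ _ _ _ h] _ _]] //.
rewrite [fv _]/= fs; split.
  by apply: fv_lesT; rewrite all_map; apply/allP.
rewrite -[wf _ _ _]/(wf ars nc s && wf ars nc (lesT [seq (0, c') | c' <- c :: cs])) ws.
by rewrite wf_lesT all_map /= hc.
Qed.

Lemma vtm_eq I u nu mu : vok u -> nu 0 = mu 0 -> eval I (vtm u) nu = eval I (vtm u) mu.
Proof.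
move=> /vtm_fv[/allP h _] e; apply: eval_fv => x /h.
by rewrite inE => /eqP->.
Qed.

Lemma eval_VInt I c cs s nu : eval I (vtm (VInt c cs s)) nu =
  (eval I s nu * ((nu 0 <= vmin I c cs)%N : nat)%:R)%R.
Proof.
rewrite -[LHS]/(eval I s nu * eval I (lesT [seq (0, c') | c' <- c :: cs]) nu)%R.
by rewrite eval_lesT all_map leq_vmin.
Qed.

Lemma mtm_fv m : mok m -> subl (fv (mtm m)) [:: 0; 1] /\ wf ars nc (mtm m).
Proof.
case: m => [R xs f [w /and5P[_ _ _ _ h] _ _]|u v [hu hv]|u hu] //.
  have [/allP u1 u2] := vtm_fv hu; have [/allP v1 v2] := vtm_fv hv; split.
    apply/allP => x; rewrite /= mem_cat fv_tren => /orP[/u1|/mapP[y _ ->]]; last by [].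
    by rewrite !inE => ->.
  rewrite -[wf _ _ _]/(wf ars nc (vtm u) && wf ars nc (tren to1 (vtm v))).
  by rewrite wf_tren u2.
have [/allP u1 u2] := vtm_fv hu; split=> //.
by apply/allP => x; rewrite /= !inE => /orP[->//|/orP[->|/u1]]; rewrite ?orbT // inE => ->.
Qed.

Lemma mtm_eq I m nu mu : mok m -> nu 0 = mu 0 -> nu 1 = mu 1 ->
  eval I (mtm m) nu = eval I (mtm m) mu.
Proof.
move=> /mtm_fv[/allP h _] e0 e1; apply: eval_fv => x /h.
by rewrite !inE => /orP[]/eqP->.
Qed.

Lemma eval_MP I u v nu : eval I (mtm (MP u v)) nu =
  (eval I (vtm u) nu * eval I (vtm v) (nu \o to1))%R.
Proof. by rewrite /= eval_tren. Qed.

Lemma vok_scale t u : vok u -> wf ars nc t -> fv t = [::] -> vok (vscale t u).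
Proof.
case: u => [c cs s [h1 h2 h3 h4]|R xs f [h1 /and5P[a1 a2 a3 a4 a5] h3 h4]] wt ft.
  by split=> //=; rewrite ?h3 ?h4.
split=> //; first by apply/andP.
  by rewrite /wfgen a1 a2 a3 /= ft cats0.
by move=> I nu /mulK0[/h4].
Qed.

Lemma eval_scale I t u nu : eval I (vtm (vscale t u)) nu =
  (eval I (vtm u) nu * eval I t nu)%R.
Proof. by case: u => [c cs s|R xs f] //=; rewrite mulrAC. Qed.

Lemma vok_had u v : vok u -> vok v -> vok (vhad u v).
Proof.
move=> hu hv; have [fu wu] := vtm_fv hu; have [fv_ wv] := vtm_fv hv.
case: u hu fu wu => [c cs s|R xs f] hu fu wu.
  case: v hv fv_ wv => [c' cs' s'|R xs f] hv fv_ wv.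
    case: hu hv => [h1 h2 h3 h4] [g1 g2 g3 g4]; split=> //=.
    - by rewrite all_cat h2 /= g1.
    - by rewrite h3.
    - by rewrite h4.
  case: hv => [h1 /and5P[a1 a2 a3 a4 a5] h3 h4]; split=> //.
  - by apply/andP.
  - by apply/and5P; split=> //; rewrite /subl [fv _]/= all_cat; apply/andP.
  - by move=> I nu /mulK0[_ /h4].
case: hu => [h1 /and5P[a1 a2 a3 a4 a5] h3 h4].
have goal w : subl (fv w) [:: 0] -> wf ars nc w -> vok (VRel R xs (TMul f w)).
  move=> fw ww; split=> //.
  - by apply/andP.
  - by apply/and5P; split=> //; rewrite /subl [fv _]/= all_cat; apply/andP.
  - by move=> I nu /mulK0[/h4].
by case: v hv fv_ wv => *; exact: goal.
Qed.

Lemma eval_had I u v nu : vok u -> vok v -> eval I (vtm (vhad u v)) nu =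
  (eval I (vtm u) nu * eval I (vtm v) nu)%R.
Proof.
case: u => [c cs s|R xs f]; case: v => [c' cs' s'|R' xs' f'] hu hv //.
rewrite !eval_VInt leq_vmin /= all_cat /= -/(all _ (c :: cs)).
have -> : [&& nu 0 <= cv I c, all (fun c0 => nu 0 <= cv I c0) cs,
    nu 0 <= cv I c' & all (fun c0 => nu 0 <= cv I c0) cs'] =
   (nu 0 <= vmin I c cs) && (nu 0 <= vmin I c' cs').
  by rewrite !leq_vmin /= andbA.
by rewrite -mulnb natrM !mulrA; congr (_ * _)%R; rewrite mulrAC.
Qed.

Definition big_bound I N := bounded ars I N /\ forall c, c < nc -> cv I c <= N.

Lemma vmin_le I c cs N : cv I c <= N -> vmin I c cs <= N.
Proof.
move=> h; apply: leq_trans h.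
by have := leqnn (vmin I c cs); rewrite leq_vmin /= => /andP[].
Qed.

Lemma lkp_bound I N R (xs : seq nat) nu x : bounded ars I N -> R < size ars ->
  lkp (rl I R) (map nu xs) != 0%R -> x \in xs -> 0 < nu x <= N.
Proof.
move=> b hR /lkp_neq0[e he ee] hx; apply: (b R hR e he); rewrite ee; exact: map_f.
Qed.

Lemma v_supp I N u nu : vok u -> big_bound I N -> eval I (vtm u) nu <> 0%R -> nu 0 <= N.
Proof.
case: u => [c cs s [hc _ _ _]|R xs f [_ /and5P[hR _ /allP h0 _ _] _ h]] [b cN] hne.
  move: hne; rewrite eval_VInt; case: leqP; last by rewrite mulr0.
  by move=> le _; apply: leq_trans le (vmin_le _ (cN _ hc)).
have [nu' e hl] := h I nu hne.
by rewrite -e; have /andP[] := lkp_bound b hR hl (h0 0 isT).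
Qed.

Lemma vtot_ok I N u mu : proper_inst ars I -> vok u -> big_bound I N ->
  eval I (vtot u) mu = (\sum_(d <- iota 1 N) eval I (vtm u) (at1 d))%R.
Proof.
move=> pI; case: u => [c cs s [hc _ _ fs]|R xs f [_ /and5P[hR sx h0 _ fy] _ h]] [b cN].
  have es nu : eval I s nu = eval I s mu by apply: eval_fv => x; rewrite fs.
  rewrite (eq_bigr (fun d => eval I s mu * ((d <= vmin I c cs)%N : nat)%:R)%R); last first.
    by move=> d _; rewrite eval_VInt es.
  rewrite -big_distrr /=; congr (_ * _)%R.
  have := @isum_box K N [:: 0] (fun=> vmin I c cs) mu isT (fun x _ => vmin_le cs (cN _ hc)).
  rewrite /= big_seq1 => <-; apply: eq_bigr => d _; by rewrite big_seq1 /updn.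
have -> : eval I (vtot (VRel R xs f)) mu = isum N [:: 0] (eval I f) mu.
  apply/esym/isum_reindex => //.
  - by move=> y; rewrite !inE; case: eqP.
  - exact: gen_uniq.
  - by move=> p; exact: gen_asg.
  - by move=> p hp; exact: gen_bounded b hR h0 hp.
  - exact: dep_eval.
  - move=> nu /h[nu' e hl]; rewrite /= -e; exact: (gen_lkp h0 hl).
apply: eq_bigr => d _ /=; apply: eval_fv => x /(allP fy).
by rewrite inE => /eqP->.
Qed.

Lemma rsum_ok I N m x : proper_inst ars I -> mok m -> big_bound I N -> 0 < x ->
  eval I (vtm (rsum m)) (at1 x) = (\sum_(d <- iota 1 N) eval I (mtm m) (at2 x d))%R.
Proof.
move=> pI hm bN x0; case: m hm => [R xs f|u v [hu hv]|u hu].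
- case=> [_ /and5P[hR sx h01 _ fy] _ h]; case: bN => b _.
  have -> : eval I (vtm (rsum (MS R xs f))) (at1 x) = isum N [:: 1] (eval I f) (at1 x).
    apply/esym/isum_reindex => //.
    - by move=> y; rewrite !inE => ->; rewrite orbT.
    - by move=> y; rewrite !inE; case: y => [|[|y]].
    - exact: gen_uniq.
    - by move=> p; exact: gen_asg.
    - by move=> p hp; exact: gen_bounded b hR h01 hp.
    - exact: dep_eval.
    - move=> nu /h hl; exact: (gen_lkp h01 hl).
  apply: eq_bigr => d _ /=; apply: eval_fv => y /(allP fy).
  by rewrite !inE => /orP[]/eqP->.
- rewrite eval_scale (vtot_ok (N := N)) // big_distrr.
  apply: eq_bigr => d _; rewrite eval_MP; congr (_ * _)%R; exact: vtm_eq.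
- rewrite /=; have e d : eval I (vtm u) (at2 x d) = eval I (vtm u) (at1 x) by exact: vtm_eq.
  rewrite (eq_bigr (fun d => ((x == d) : nat)%:R * eval I (vtm u) (at1 x))%R); last first.
    by move=> d _; rewrite e.
  have [z|nz] := eqVneq (eval I (vtm u) (at1 x)) 0%R.
    by rewrite z big1 // => d _; rewrite mulr0.
  (* The summation range has to reach the diagonal position [x]; a nonzero value guarantees this. *)
  have xN : x <= N by exact: (v_supp hu bN (elimN eqP nz)).
  rewrite (bigD1_seq x) ?iota_uniq //=; last by rewrite mem_iota; lia.
  rewrite eqxx mul1r big1 ?addr0 // => d hd.
  by rewrite eq_sym (negbTE hd) mul0r.
Qed.

Lemma vtot_wf u : vok u -> wf ars nc (vtot u) /\ fv (vtot u) = [::].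
Proof.
case: u => [c cs s [h1 h2 h3 h4]|R xs f [h1 h2 h3 h4]] /=; last by rewrite h1 h2.
by rewrite h3 h1 h2 h4.
Qed.

Lemma rsum_vok m : mok m -> vok (rsum m).
Proof.
case: m => [R xs f|u v [hu hv]|u hu] //.
- case=> [wf_ wg sx h]; have /and5P[hR sz h01 _ fy] := wg; split=> //.
  + by rewrite /= wf_ /= /wfgen hR sz h01 fy.
  + by apply/and5P; split=> //; case/andP: h01 => h0 _; apply/andP.
  + move=> I nu /= hne.
    have [p hp] : exists2 p, keyed [:: 0; 1] [:: 0] [:: nu 0] p & eval I f (asg [:: 0; 1] p) <> 0%R.
      apply: contrapT => nex; apply: hne; rewrite big1 // => p kp.
      by apply: contrapT => hp; apply: nex; exists p.
    move=> /h hl; exists (asg [:: 0; 1] p) => //.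
    by move: hp => /eqP [].
- by have [? ?] := vtot_wf hv; exact: vok_scale.
Qed.

Lemma mtr_ok m : mok m -> mok (mtr m).
Proof.
case: m => [R xs f|u v [hu hv]|u hu] //; case=> [w /and5P[a1 a2 a3 a4 a5] h3 h4].
split.
- by rewrite wf_tren.
- rewrite /wfgen a1 size_map a2 /= fv_tren; apply/andP; split.
    have := allP a3; move=> h; apply/and3P; split=> //; apply/mapP.
      by exists 1 => //; exact: h.
    by exists 0 => //; exact: h.
  by apply/allP => x /mapP[y /(allP a5)]; rewrite !inE => /orP[]/eqP-> ->.
- by apply/allP => x /mapP[y /(allP h3)]; rewrite !inE => /orP[]/eqP-> ->.
- by move=> I nu; rewrite eval_tren => /h4; rewrite -map_comp.
Qed.

Lemma mtr_eval I m x y : mok m -> eval I (mtm (mtr m)) (at2 x y) = eval I (mtm m) (at2 y x).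
Proof.
move=> hm; case: m hm => [R xs f|u v|u] hm.
- by rewrite /= eval_tren; apply: (@mtm_eq I (MS R xs f)).
- case: hm => hu hv; rewrite -[mtr _]/(MP v u) !eval_MP mulrC.
  by congr (_ * _)%R; exact: vtm_eq.
- rewrite /= /at2 /= eq_sym; case: eqP => [->//|]; by rewrite ?mul0r.
Qed.

Lemma mscale_ok t m : mok m -> wf ars nc t -> fv t = [::] -> mok (mscale t m).
Proof.
case: m => [R xs f [h1 /and5P[a1 a2 a3 a4 a5] h3 h4]|u v [hu hv]|u hu] wt ft.
- split=> //; first by apply/andP.
    by rewrite /wfgen a1 a2 a3 /= ft cats0.
  by move=> I nu /mulK0[/h4].
- by split=> //; exact: vok_scale.
- exact: vok_scale.
Qed.

Lemma mscale_eval I t m nu : eval I (mtm (mscale t m)) nu =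
  (eval I (mtm m) nu * eval I t nu)%R.
Proof.
case: m => [R xs f|u v|u] //; first by rewrite !eval_MP eval_scale mulrAC.
by rewrite /= eval_scale mulrA.
Qed.

Lemma mhad_ok m1 m2 : mok m1 -> mok m2 -> mok (mhad m1 m2).
Proof.
move=> h1 h2; have [f1 w1] := mtm_fv h1; have [f2 w2] := mtm_fv h2.
have ms R xs f g : mok (MS R xs f) -> subl (fv g) [:: 0; 1] -> wf ars nc g ->
   mok (MS R xs (TMul f g)) /\ mok (MS R xs (TMul g f)).
  case=> [h3 /and5P[a1 a2 a3 a4 a5] h4 h5] fg wg.
  split; split=> //; first [by apply/andP | by apply/and5P; split=> //; rewrite /subl [fv _]/= all_cat; apply/andP
    | by move=> I nu /mulK0[/h5] | by move=> I nu /mulK0[_ /h5]].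
case: m1 h1 f1 w1 => [R xs f|u v|u] h1 f1 w1.
- by case: m2 h2 f2 w2 => *; apply: (proj1 (ms _ _ _ _ h1 _ _)).
- case: m2 h2 f2 w2 => [R xs f|u' v'|u'] h2 f2 w2.
  + exact: (proj2 (ms _ _ _ _ h2 _ _)).
  + by case: h1 h2 => [? ?] [? ?]; split; exact: vok_had.
  + by case: h1 => [? ?]; do 2 apply: vok_had => //.
- case: m2 h2 f2 w2 => [R xs f|u' v'|u'] h2 f2 w2.
  + exact: (proj2 (ms _ _ _ _ h2 _ _)).
  + by case: h2 => [? ?]; do 2 apply: vok_had => //.
  + exact: vok_had.
Qed.

Lemma mhad_eval I m1 m2 x y : mok m1 -> mok m2 ->
  eval I (mtm (mhad m1 m2)) (at2 x y) =
  (eval I (mtm m1) (at2 x y) * eval I (mtm m2) (at2 x y))%R.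
Proof.
have pd u v w : vok u -> vok v -> vok w -> eval I (mtm (MD (vhad w (vhad u v)))) (at2 x y) =
   (eval I (mtm (MP u v)) (at2 x y) * eval I (mtm (MD w)) (at2 x y))%R.
  move=> hu hv hw; rewrite eval_MP /= !eval_had //; last exact: vok_had.
  case: eqP => [e|_]; last by rewrite !mul0r mulr0.
  rewrite !mul1r mulrC; congr (_ * _ * _)%R; exact: vtm_eq.
case: m1 => [R xs f|u v|u]; case: m2 => [R' xs' f'|u' v'|u'] h1 h2 //.
- case: h1 h2 => [? ?] [? ?]; rewrite !eval_MP !eval_had //.
  by rewrite !mulrA; congr (_ * _)%R; rewrite mulrAC.
- by case: h1 => ? ?; rewrite [LHS]pd.
- by case: h2 => ? ?; rewrite [LHS]pd // mulrC.
- rewrite /= eval_had //; case: eqP => _; last by rewrite !mul0r.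
  by rewrite !mul1r.
Qed.

End Matlang.

(** * Plans for matrix representations *)

Section MatPlan.
Variables (K : comNzSemiRingType) (ars : seq nat) (nc : nat).
Hypothesis hK : semi_integral K.
Implicit Types (I : inst K).

(** With no shared variable the filter has an empty key, so it is closed and decided before the
    loops. *)
Lemma plan_support ls chk P R xs ys f : plan (K := K) ars nc ls chk P ->
  wf ars nc f -> wfgen ars R xs ys [::] f -> uniq ys ->
  (forall y, y \in ys -> y \notin bnd [::] ls) ->
  plan (K := K) ars nc (rcons ls (LRel R xs ys f [::])) (TMul chk (TAny R xs ys f [::] [::]))
    (fun I nu => [/\ P I nu, map nu ys \in gen (rl I R) xs ys & eval I f nu <> 0%R]).
Proof.
move=> pl wf_ wg uy hy.
have wt : wf ars nc (TAny R xs ys f [::] [::]) by rewrite /= wf_ wg.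
have pl1 := plan_closed hK pl wt (erefl _).
have wl : wflv ars nc (bnd [::] ls) (LRel R xs ys f [::]).
  rewrite /= wf_ wg uy /=; apply/allP => y /hy /negbTE ->; exact: isT.
apply: (plan_eq (plan_rel pl1 wl _)) => [I nu _ [_]//|I nu]; split.
  by case=> -[].
move=> [h1 h2 h3]; split=> //; split=> //.
have /and5P[_ _ _ _ /allP fy] := wg.
rewrite /=; apply/eqP; rewrite natr_bool_neq0 -has_count.
apply/hasP; exists (map nu ys) => //=; apply/eqP.
by rewrite (@eval_fv _ I f _ nu) // => y /fy h; rewrite asg_map.
Qed.

Lemma plan_vec (z : nat) u ls chk P : plan (K := K) ars nc ls chk P -> vok K ars nc u ->
  z \notin bnd [::] ls ->
  exists ls' chk' P', [/\ plan (K := K) ars nc ls' chk' P', bnd [::] ls' = z :: bnd [::] ls &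
    forall I nu, (exists N, bounded ars I N) ->
      (P' I nu <-> [/\ P I nu, eval I (vtm u) (at1 (nu z)) <> 0%R & 0 < nu z])].
Proof.
move=> pl hu hz; case: u hu => [c cs s [hc hcs ws fs]|R xs f hu].
  have pl1 := plan_int (plan_closed hK pl ws fs) hz hc hcs.
  do 3 eexists; split; [exact: pl1|by rewrite bnd_rcons|].
  move=> I nu _; rewrite eval_VInt.
  have -> : eval I s (at1 (nu z)) = eval I s nu by apply: eval_fv => x; rewrite fs.
  split=> [[[p1 /eqP p2] /andP[p3 p4]]|[p1 /eqP]].
    by split=> //; apply/eqP; rewrite mulr_neq0P // p2 natr_bool_neq0.
  by rewrite mulr_neq0P // natr_bool_neq0 => /andP[/eqP h1 h2] h3; rewrite h3 h2.
(* The shift moves the vector to variable [z], so that the loops for rows and columns bind different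
   variables. *)
pose r x := x + z.
case: hu => [w /and5P[hR sx /allP h0 _ /allP fy] sxs h].
have wg : wfgen ars R (map r xs) [:: z] [::] (tren r f).
  rewrite /wfgen hR size_map sx /= fv_tren; apply/andP; split.
    by rewrite andbT; apply/mapP; exists 0 => //; exact: h0.
  by apply/allP => y /mapP[x /fy + ->]; rewrite !inE => /eqP->.
have hz1 y : y \in [:: z] -> y \notin bnd [::] ls by rewrite inE => /eqP->.
have pl1 := plan_support pl (etrans (wf_tren ars nc r f) w) wg isT hz1.
do 3 eexists; split; [exact: pl1|by rewrite bnd_rcons|].
move=> I nu [N bN].
have -> : eval I (vtm (VRel R xs f)) (at1 (nu z)) = eval I (tren r f) nu.
  by rewrite eval_tren; apply: eval_fv => x /fy; rewrite inE => /eqP->.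
split=> [[p1 p2 p3]|[p1 p2 p3]]; split=> //.
  move: p3; rewrite eval_tren => /h[nu' e hl].
  by move: (lkp_bound bN hR hl (h0 0 isT)); rewrite e /= => /andP[].
move: p2; rewrite eval_tren => /h[nu' e hl].
pose nu2 y := nu' (y - z).
have -> : map nu [:: z] = map nu2 [:: z] by rewrite /= /nu2 subnn e.
apply: gen_lkp; first by case/and5P: wg.
by rewrite -map_comp (eq_map (g := nu')) // => x /=; rewrite /nu2 /r addnK.
Qed.

Lemma mrep_plan m : mok K ars nc m -> exists hd F ls chk P,
  [/\ plan (K := K) ars nc ls chk P, wf ars nc F, bnd [::] ls =i hd, subl (fv F) hd &
    (forall I nu, (exists N, bounded ars I N) ->
      (P I nu <-> eval I F nu <> 0%R /\ forall x, x \in hd -> 0 < nu x)) /\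
    (forall I e, (exists mu, [/\ eval I F mu <> 0%R, forall y, y \in hd -> 0 < mu y
         & e = (map mu hd, eval I F mu)]) <->
       (exists x y, [/\ 0 < x, 0 < y, eval I (mtm m) (at2 x y) <> 0%R
         & e = ([:: x; y], eval I (mtm m) (at2 x y))]))].
Proof.
move=> hm; have [fm wm] := mtm_fv hm.
have head01 I e : (exists mu, [/\ eval I (mtm m) mu <> 0%R, forall y, y \in [:: 0; 1] -> 0 < mu y
         & e = (map mu [:: 0; 1], eval I (mtm m) mu)]) <->
       (exists x y, [/\ 0 < x, 0 < y, eval I (mtm m) (at2 x y) <> 0%R
         & e = ([:: x; y], eval I (mtm m) (at2 x y))]).
  split=> [[mu [h1 h2 ->]]|[x [y [x0 y0 h ->]]]].
    by exists (mu 0), (mu 1); rewrite (@mtm_eq K ars nc I m _ mu) //; split=> //; apply: h2.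
  by exists (at2 x y); split=> // z; rewrite !inE => /orP[]/eqP->.
have in01 (Q : nat -> Prop) : (forall x, x \in [:: 0; 1] -> Q x) <-> Q 0 /\ Q 1.
  split=> [h|[h0 h1] x]; first by split; exact: h.
  by rewrite !inE => /orP[]/eqP->.
case: m hm fm wm head01 => [R xs f|u v|u] hm fm wm head01.
- have [w wg sx h] := hm.
  have pl := plan_support (@plan_nil K ars nc) w wg isT (fun _ _ => isT).
  exists [:: 0; 1], f; do 3 eexists; split; [exact: pl|exact: w|by []|exact: fm|split=> //].
  move=> I nu [N bN]; have /and5P[hR _ h01 _ _] := wg; split.
    move=> [_ _ hf]; split=> // x hx; have hl := h I nu hf.
    by have /andP[] := lkp_bound bN hR hl (allP h01 x hx).
  by move=> [hf _]; split=> //; apply: gen_lkp => //; exact: h.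
- have [hu hv] := hm.
  have [ls1 [chk1 [P1 [pl1 b1 h1]]]] := plan_vec (z := 0) (@plan_nil K ars nc) hu isT.
  have [|ls2 [chk2 [P2 [pl2 b2 h2]]]] := plan_vec (z := 1) pl1 hv _; first by rewrite b1.
  exists [:: 0; 1], (mtm (MP u v)), ls2, chk2, P2; split=> //; last split=> //.
    by move=> x; rewrite b2 b1 !inE orbC.
  move=> I nu bI; rewrite (propext (h2 I nu bI)) (propext (h1 I nu bI)) (propext (in01 _)) eval_MP.
  have -> : eval I (vtm u) nu = eval I (vtm u) (at1 (nu 0)) by exact: (vtm_eq _ hu).
  have -> : eval I (vtm v) (nu \o to1) = eval I (vtm v) (at1 (nu 1)) by exact: (vtm_eq _ hv).
  split=> [[[_ /eqP p1 p2] /eqP p3 p4]|[/eqP]].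
    by split=> //; apply/eqP; rewrite mulr_neq0P // p1.
  by rewrite mulr_neq0P // => /andP[/eqP g1 /eqP g2] [g3 g4].
- have hu : vok K ars nc u by [].
  have [ls1 [chk1 [P1 [pl1 b1 h1]]]] := plan_vec (z := 0) (@plan_nil K ars nc) hu isT.
  have [fu wu] := vtm_fv hu.
  have e1 I nu mu : nu 0 = mu 0 -> eval I (vtm u) nu = eval I (vtm u) mu by exact: (vtm_eq _ hu).
  (* A diagonal matrix needs one loop only; its index is printed as row and as column. *)
  exists [:: 0; 0], (vtm u), ls1, chk1, P1; split=> //; first by move=> x; rewrite b1 !inE orbb.
    by apply/allP => x /(allP fu); rewrite !inE => ->.
  split=> [I nu bI|I e].
    rewrite (propext (h1 I nu bI)) (e1 I nu (at1 (nu 0))) //; split=> [[_ p1 p2]|[p1 p2]].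
      by split=> // x; rewrite !inE orbb => /eqP->.
    by split=> //; apply: p2.
  split=> [[mu [g1 g2 ->]]|[x [y [x0 y0]]]].
    exists (mu 0), (mu 0); have p0 := g2 0 isT.
    by rewrite /= eqxx mul1r (e1 I (at2 _ _) mu).
  rewrite /= /at2 /=; case: eqP => [<-|_]; last by rewrite mul0r.
  rewrite mul1r => hne ->.
  by exists (at2 x x); split=> // z; rewrite !inE orbb => /eqP->.
Qed.

End MatPlan.

(** * Comparison of representations with matrices of given dimensions *)

Section Spec.
Variables (K : comNzSemiRingType) (ars : seq nat) (nc : nat).
Variables (I : inst K) (N : nat).
Hypotheses (pI : proper_inst ars I) (bN : big_bound ars nc I N).

(** The second clause excludes indices beyond the dimension: the loops follow the support among all
    positive integers and never consult the dimension of the result. *)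
Definition vspec u p (g : 'I_p -> K) :=
  (forall i : 'I_p, eval I (vtm u) (at1 i.+1) = g i) /\
  (forall x, 0 < x -> eval I (vtm u) (at1 x) <> 0%R -> x <= p).

Definition mspec m p q (M : 'I_p -> 'I_q -> K) :=
  (forall (i : 'I_p) (j : 'I_q), eval I (mtm m) (at2 i.+1 j.+1) = M i j) /\
  (forall x y, 0 < x -> 0 < y -> eval I (mtm m) (at2 x y) <> 0%R -> x <= p /\ y <= q).

Lemma sum_iota_ord q (F : nat -> K) : q <= N ->
  (forall d, 0 < d -> F d <> 0%R -> d <= q) ->
  (\sum_(d <- iota 1 N) F d = \sum_(j < q) F j.+1)%R.
Proof.
move=> hq h; rewrite -(subnKC hq) iotaD big_cat /=.
rewrite [X in (_ + X)%R](_ : _ = 0%R) ?addr0; last rewrite big_seq big1 //.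
  rewrite -[iota 1 q]/(iota (1 + 0) q) iotaDl big_map.
  by rewrite -(big_mkord xpredT (fun j => F j.+1)) /index_iota subn0.
move=> d; rewrite mem_iota => hd; apply: contrapT => /h; lia.
Qed.

Lemma mspec_eq m p q (M M' : 'I_p -> 'I_q -> K) :
  mspec m M -> (forall i j, M i j = M' i j) -> mspec m M'.
Proof. by move=> [h1 h2] e; split=> // i j; rewrite h1. Qed.

Lemma rsum_spec m p q (M : 'I_p -> 'I_q -> K) : mok K ars nc m -> q <= N ->
  mspec m M -> vspec (rsum m) (fun i => \sum_j M i j)%R.
Proof.
move=> hm hq [h1 h2].
have row x : 0 < x -> eval I (vtm (rsum m)) (at1 x) =
    (\sum_(j < q) eval I (mtm m) (at2 x j.+1))%R.
  move=> x0; rewrite (rsum_ok pI hm bN x0) (@sum_iota_ord q) // => d d0.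
  by case/h2.
split=> [i|x x0]; first by rewrite row //; apply: eq_bigr => j _; rewrite h1.
rewrite row // => hne; apply: contrapT => hx; apply: hne.
by rewrite big1 // => j _; apply: contrapT => /h2[].
Qed.

Lemma vtot_spec u p (g : 'I_p -> K) nu : vok K ars nc u -> p <= N ->
  vspec u g -> eval I (vtot u) nu = (\sum_i g i)%R.
Proof.
move=> hu hp [h1 h2]; rewrite (vtot_ok nu pI hu bN) (@sum_iota_ord p) //.
by apply: eq_bigr => i _.
Qed.

Lemma ones_spec c : vspec (VInt c [::] TOne) (fun _ : 'I_(cv I c) => 1%R).
Proof.
split=> [i|x x0]; rewrite eval_VInt /= mul1r /vmin /at1 /=; first by rewrite ltn_ord.
by case: leqP.
Qed.

Lemma MP_spec u v p q (g : 'I_p -> K) (h : 'I_q -> K) : vok K ars nc u ->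
  vok K ars nc v -> vspec u g -> vspec v h -> mspec (MP u v) (fun i j => g i * h j)%R.
Proof.
move=> hu hv [g1 g2] [h1 h2].
have e x y : eval I (mtm (MP u v)) (at2 x y) =
    (eval I (vtm u) (at1 x) * eval I (vtm v) (at1 y))%R.
  rewrite eval_MP; by congr (_ * _)%R; exact: (vtm_eq _ hu).
split=> [i j|x y x0 y0]; rewrite e; first by rewrite g1 h1.
by move=> /mulK0[/(g2 x x0) ? /(h2 y y0)].
Qed.

Lemma MD_spec u p (g : 'I_p -> K) : vok K ars nc u -> vspec u g ->
  mspec (MD u) (fun i j => ((i == j) : nat)%:R * g i)%R.
Proof.
move=> hu [g1 g2].
have e x y : eval I (mtm (MD u)) (at2 x y) =
    (((x == y) : nat)%:R * eval I (vtm u) (at1 x))%R.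
  by rewrite /=; congr (_ * _)%R; exact: (vtm_eq _ hu).
split=> [i j|x y x0 y0]; rewrite e; first by rewrite g1 eqSS.
move=> /mulK0[]; case: eqP => // <- _ /(g2 x x0); by split.
Qed.

Lemma mtr_spec m p q (M : 'I_p -> 'I_q -> K) : mok K ars nc m -> mspec m M ->
  mspec (mtr m) (fun j i => M i j).
Proof.
move=> hm [h1 h2]; split=> [i j|x y x0 y0]; rewrite (mtr_eval _ _ _ hm) //.
by move=> /(h2 y x y0 x0)[].
Qed.

Lemma mhad_spec m1 m2 p q (M1 M2 : 'I_p -> 'I_q -> K) : mok K ars nc m1 -> mok K ars nc m2 ->
  mspec m1 M1 -> mspec m2 M2 -> mspec (mhad m1 m2) (fun i j => M1 i j * M2 i j)%R.
Proof.
move=> k1 k2 [h1 h2] [g1 g2]; split=> [i j|x y x0 y0]; rewrite (mhad_eval _ _ _ k1 k2).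
  by rewrite h1 g1.
by move=> /mulK0[/(h2 x y x0 y0)].
Qed.

Lemma mscale_spec t k m p q (M : 'I_p -> 'I_q -> K) : (forall nu, eval I t nu = k) ->
  mspec m M -> mspec (mscale t m) (fun i j => k * M i j)%R.
Proof.
move=> ht [h1 h2]; split=> [i j|x y x0 y0]; rewrite mscale_eval ht; first by rewrite h1 mulrC.
by move=> /mulK0[/(h2 x y x0 y0)].
Qed.

End Spec.

Lemma lkp_mx_entries (K : comNzSemiRingType) p q (M : 'M[K]_(p, q)) (i : 'I_p) (j : 'I_q) :
  lkp (mx_entries M) [:: i.+1; j.+1] = M i j.
Proof.
rewrite /lkp /mx_entries big_map /= big_filter_cond big_enum_cond /=.
have eP (r : 'I_p * 'I_q) : ([:: r.1.+1; r.2.+1] == [:: i.+1; j.+1]) = (r == (i, j)).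
  by case: r => r1 r2; rewrite !eqseq_cons andbT.
have [z|nz] := eqVneq (M i j) 0%R.
  rewrite big1 // => -[r1 r2]; rewrite (eP (r1, r2)) => /andP[_ /eqP[-> ->]].
  by rewrite z.
rewrite (eq_bigl (pred1 (i, j))); first by rewrite big_pred1_eq.
by move=> r; rewrite /= eP; have [->|] := eqVneq r (i, j); rewrite ?andbF //= nz.
Qed.

Lemma mx_entriesP (K : comNzSemiRingType) p q (M : 'M[K]_(p, q)) e :
  e \in mx_entries M <-> exists i j, M i j != 0%R /\ e = ([:: (i : nat).+1; (j : nat).+1], M i j).
Proof.
split=> [/mapP[[i j]]|[i [j [h ->]]]].
  by rewrite mem_filter => /andP[h _] ->; exists i, j.
apply/mapP; exists (i, j) => //; by rewrite mem_filter h mem_enum.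
Qed.

Section RankOne.
Variables (K : comNzSemiRingType).
Local Open Scope ring_scope.

Lemma mulmx_rank1 p q (A : 'M[K]_(p, 1)) (B : 'M[K]_(1, q)) i j :
  (\sum_k A i k) * (\sum_k B k j) = (A *m B) i j.
Proof. by rewrite mxE !big_ord1. Qed.

(** A matrix times a column is the row sum of the entrywise product with a matrix all of whose rows
    are the transposed column. The factors 1 stem from all-ones vectors. *)
Lemma mulmx_colr p q (A : 'M[K]_(p, q)) (B : 'M[K]_(q, 1)) i k :
  (\sum_j A i j * (1 * \sum_k' B j k')) * 1 = (A *m B) i k.
Proof.
rewrite mulr1 mxE; apply: eq_bigr => j _; rewrite mul1r big_ord1.
by rewrite (ord1 k).
Qed.

Lemma mulmx_rowl p q (A : 'M[K]_(1, p)) (B : 'M[K]_(p, q)) i k :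
  1 * (\sum_j B j k * (1 * \sum_i' A i' j)) = (A *m B) i k.
Proof.
rewrite mul1r mxE; apply: eq_bigr => j _; rewrite mul1r big_ord1 mulrC.
by rewrite (ord1 i).
Qed.

End RankOne.

(** * Evaluation of fc-MATLANG expressions *)

Section MatSem.
Variables (K : comNzSemiRingType) (S : mschema).
Hypothesis hK : semi_integral K.
Let ars := sig_ars (fun _ : msym S => 2).
Let nc := #|ssym S|.+1.

Definition ones (a : size_sym S) := VInt (cidx a) [::] TOne.

Lemma ones_ok a : vok K ars nc (ones a).
Proof. by split=> //; exact: cidx_lt. Qed.

(** Matrix products stay within the three forms: across a dimension 1 they are products of a column
    and a row, and otherwise one factor is a vector, which reduces them to row sums of an entrywise
    product. *)
Lemma mat_rep a b (e : fcmatlang a b) : exists m, mok K ars nc m /\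
  forall (J : minstance K S) (l : msym S -> seq (seq nat * K)) N, let I := mkinst l (fun s => val (mdim J s)) in
    (forall A, perm_eq (l A) (mx_entries (mval J A))) ->
    proper_inst ars I -> big_bound ars nc I N -> mspec I m (mat_sem J e).
Proof.
have dimE (J : minstance K S) (l : msym S -> seq (seq nat * K)) c :
  cv (mkinst (K := K) l (fun s => val (mdim J s))) (cidx c) = mdim_of J c.
  by rewrite cv_mkinst; case: c.
have dimN (J : minstance K S) (l : msym S -> seq (seq nat * K)) N c :
    big_bound ars nc (mkinst (K := K) l (fun s => val (mdim J s))) N -> mdim_of J c <= N.
  by move=> [_ h]; rewrite -(dimE J l); apply: h; exact: cidx_lt.
have onesE (J : minstance K S) (l : msym S -> seq (seq nat * K)) c :
    vspec (mkinst l (fun s => val (mdim J s))) (ones c) (fun _ : 'I_(mdim_of J c) => 1%R : K).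
  by rewrite -(dimE J l); exact: ones_spec.
have rank1 a' b' (e1 : fcmatlang a' None) (e2 : fcmatlang None b') m1 m2 :
    mok K ars nc m1 -> mok K ars nc m2 -> forall (J : minstance K S) (l : msym S -> seq (seq nat * K)) N,
    let I := mkinst l (fun s => val (mdim J s)) in
    proper_inst ars I -> big_bound ars nc I N ->
    mspec I m1 (mat_sem J e1) -> mspec I m2 (mat_sem J e2) ->
    mspec I (MP (rsum m1) (rsum (mtr m2))) (mat_sem J e1 *m mat_sem J e2)%R.
  move=> k1 k2 J l N I pI bN s1 s2.
  apply: (mspec_eq (MP_spec (rsum_vok k1) (rsum_vok (mtr_ok k2))
    (rsum_spec pI bN k1 (dimN J l N _ bN) s1)
    (rsum_spec pI bN (mtr_ok k2) (dimN J l N _ bN) (mtr_spec k2 s2)))).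
  by move=> i j; exact: mulmx_rank1.
elim: e => {a b} [A|a|a|a b e [m [k h]]|a b e1 [m1 [k1 h1]] e2 [m2 [k2 h2]]
  |a b e1 [m1 [k1 h1]] e2 [m2 [k2 h2]]|a b c e1 [m1 [k1 h1]] e2 [m2 [k2 h2]] o
  |a b c e1 [m1 [k1 h1]] e2 [m2 [k2 h2]] o].
- exists (MS (ridx A) [:: 0; 1] (TRel (ridx A) [:: 0; 1])); split.
    split=> //.
    + by rewrite /= ridx_lt nth_ars.
    + by rewrite /wfgen ridx_lt nth_ars.
    + by move=> I nu /eqP.
  move=> J l N I pl pI bN.
  have eA nu : eval I (TRel (ridx A) [:: 0; 1]) nu = lkp (l A) [:: nu 0; nu 1].
    by rewrite -[LHS]/(lkp (rl I (ridx A)) [:: nu 0; nu 1]) rl_mkinst.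
  split=> [i j|x y x0 y0]; rewrite eA.
    by rewrite (lkp_perm _ (pl A)); exact: lkp_mx_entries.
  move=> /eqP/lkp_neq0[e]; rewrite (perm_mem (pl A)) => /mx_entriesP[i [j [_ ->]]].
  rewrite /at2 /= => -[<- <-].
  by split; exact: ltn_ord.
- exists (MP (ones a) (ones None)); split; first by split; exact: ones_ok.
  move=> J l N I pl pI bN.
  apply: (mspec_eq (MP_spec (ones_ok a) (ones_ok None) (onesE J l a) (onesE J l None))).
  by move=> i j; rewrite /= mxE mulr1.
- exists (MD (ones a)); split; first exact: ones_ok.
  move=> J l N I pl pI bN.
  apply: (mspec_eq (MD_spec (ones_ok a) (onesE J l a))).
  by move=> i j; rewrite /= mxE mulr1.
- exists (mtr m); split; first exact: mtr_ok.
  move=> J l N I pl pI bN; apply: (mspec_eq (mtr_spec k (h J l N pl pI bN))).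
  by move=> i j; rewrite /= mxE.
(* A matrix of size 1 equals the sum of its entries, which is a closed term. *)
- exists (mscale (vtot (rsum m1)) m2); split.
    by have [? ?] := vtot_wf (rsum_vok k1); exact: mscale_ok.
  move=> J l N I pl pI bN.
  apply: (mspec_eq (mscale_spec (k := (mat_sem J e1 : 'M_1) ord0 ord0) _ (h2 J l N pl pI bN))).
    move=> nu; rewrite (vtot_spec pI bN nu (rsum_vok k1) (dimN J l N None bN)
      (rsum_spec pI bN k1 (dimN J l N None bN) (h1 J l N pl pI bN))).
    by rewrite !big_ord1.
  by move=> i j; rewrite /= mxE.
- exists (mhad m1 m2); split; first exact: mhad_ok.
  move=> J l N I pl pI bN.
  apply: (mspec_eq (mhad_spec k1 k2 (h1 J l N pl pI bN) (h2 J l N pl pI bN))).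
  by move=> i j; rewrite /= mxE.
- case: o => E; subst.
    exists (MP (rsum m1) (rsum (mtr m2))); split.
      by split; apply: rsum_vok => //; exact: mtr_ok.
    by move=> J l N I pl pI bN; exact: rank1 pI bN (h1 _ _ _ _ pI bN) (h2 _ _ _ _ pI bN).
  (* The vector has a single column, so [rsum m2] represents the vector itself; multiplying by all
     ones repeats it in every row. *)
  set w := mhad m1 (MP (ones a) (rsum m2)).
  have kp : mok K ars nc (MP (ones a) (rsum m2)) by split; [exact: ones_ok|exact: rsum_vok].
  have kw : mok K ars nc w by exact: mhad_ok.
  exists (MP (rsum w) (ones None)); split; first by split; [exact: rsum_vok|exact: ones_ok].
  move=> J l N I pl pI bN; have s1 := h1 J l N pl pI bN; have s2 := h2 J l N pl pI bN.
  have sp := MP_spec (ones_ok a) (rsum_vok k2) (onesE J l a)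
    (rsum_spec pI bN k2 (dimN J l N _ bN) s2).
  apply: (mspec_eq (MP_spec (rsum_vok kw) (ones_ok None)
    (rsum_spec pI bN kw (dimN J l N _ bN) (mhad_spec k1 kp s1 sp)) (onesE J l None))).
  by move=> i j; exact: mulmx_colr.
- case: o => E; subst; last first.
    exists (MP (rsum m1) (rsum (mtr m2))); split.
      by split; apply: rsum_vok => //; exact: mtr_ok.
    by move=> J l N I pl pI bN; exact: rank1 pI bN (h1 _ _ _ _ pI bN) (h2 _ _ _ _ pI bN).
  (* A row times a matrix, treated as the transposed matrix times a column. *)
  set w := mhad (mtr m2) (MP (ones c) (rsum (mtr m1))).
  have kp : mok K ars nc (MP (ones c) (rsum (mtr m1))).
    by split; [exact: ones_ok|apply: rsum_vok; exact: mtr_ok].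
  have kw : mok K ars nc w by apply: mhad_ok => //; exact: mtr_ok.
  exists (MP (ones None) (rsum w)); split; first by split; [exact: ones_ok|exact: rsum_vok].
  move=> J l N I pl pI bN; have s1 := h1 J l N pl pI bN; have s2 := h2 J l N pl pI bN.
  have sp := MP_spec (ones_ok c) (rsum_vok (mtr_ok k1)) (onesE J l c)
    (rsum_spec pI bN (mtr_ok k1) (dimN J l N _ bN) (mtr_spec k1 s1)).
  apply: (mspec_eq (MP_spec (ones_ok None) (rsum_vok kw) (onesE J l None)
    (rsum_spec pI bN kw (dimN J l N _ bN) (mhad_spec (mtr_ok k2) kp (mtr_spec k2 s2) sp)))).
  by move=> i j; exact: mulmx_rowl.
Qed.

Theorem eval_matlang_linear_prep a b (e : fcmatlang a b) :
  linear_prep_const_delay (@eval_matlang K S a b e).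
Proof.
have [m [hm sem]] := mat_rep e.
have [hd [F [ls [chk [P [pl wF hb fF [hP hF]]]]]]] := mrep_plan hK hm.
have [p [c hp]] := from_plan (a := fun _ : msym S => 2) pl wF hb fF (fun I nu pI => hP I nu pI.2).
exists p, c => J w hw.
set L := fun A => mx_entries (mval J A).
set v := fun s => val (mdim J s).
have hL A t : t \in L A -> size t.1 = 2 /\ forall x, x \in t.1 -> 0 < x.
  move=> /mx_entriesP[i [j [_ ->]]]; split=> // x.
  by rewrite !inE => /orP[]/eqP->.
have hv s : 0 < v s by rewrite /v; case: (mdim J s).
have [l [ans [pl' ua hans en]]] := hp L v w hL hv hw.
exists ans; split=> //; last first.
  have [t [t1 t2 t3 t4]] := en; exists t; split=> //.
  apply: leq_trans t1 _; rewrite leq_mul2l; apply/orP; right.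
  by rewrite /= /inst_size -addn1 leq_add2l card_option.
set I := mkinst l v in hans.
have pI : positive_inst (fun _ : msym S => 2) I by exact: mkinst_positive hL hv.
have [N0 bN0] := pI.2.
pose N := N0 + \sum_(c < nc) cv I c.
have bN : big_bound ars nc I N.
  split=> [R hR t ht x hx|k hk].
    by have /andP[-> h] := bN0 R hR t ht x hx; rewrite (leq_trans h) ?leq_addr.
  by rewrite /N (bigD1 (Ordinal hk)) //=; lia.
have [s1 s2] := sem J l N pl' pI.1 bN.
move=> x; rewrite hans; apply: iff_trans (hF I x) _.
apply: iff_trans _ (iff_sym (mx_entriesP _ _)); split.
  move=> [i [j [i0 j0 h ->]]]; have [hi hj] := s2 i j i0 j0 h.
  case: i i0 h hi => // i _ h hi; case: j j0 h hj => // j _ h hj.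
  exists (Ordinal hi), (Ordinal hj).
  by rewrite -(s1 (Ordinal hi) (Ordinal hj)) /=; split=> //; apply/eqP.
move=> [i [j [h ->]]]; exists i.+1, j.+1; rewrite -s1 in h *.
by split=> //; apply/eqP.
Qed.

End MatSem.

Theorem theorem10 (K : comNzSemiRingType) (hK : semi_integral K) :
  (forall (S : vocab) (Q : cq S),
     free_connex Q -> linear_prep_const_delay (@eval_cq K S Q)) /\
  (forall (S : mschema) (a b : size_sym S) (e : fcmatlang a b),
     linear_prep_const_delay (@eval_matlang K S a b e)).
Proof.
by split=> [S Q|S a b e]; [exact: eval_cq_linear_prep|exact: eval_matlang_linear_prep].
Qed.
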